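(* Assume the weight regularity condition and that the weight sequence satisfies either (i) $\frac1N\sum_{i\in[N]}w_i^4\to\mathbb E[W^4]<\infty$, in which case set $\boldsymbol\delta=3$, or (ii) $w_i=c_w(N/i)^{1/(\tau-1)}$ for $i\in[N]$, for some constant $c_w>0$ and $\tau\in(3,5)$, in which case set $\boldsymbol\delta=\tau-2$. Let $P_N$ be the annealed Ising measure on $\mathrm{GRG}_N(\boldsymbol w)$ at inverse temperature $\beta_{c,N}={\rm asinh}(1/\nu_N)$ and external field $B=0$, where $\nu_N=\mathbb E[W_N^2]/\mathbb E[W_N]$. Then $S_N/N^{\boldsymbol\delta/(\boldsymbol\delta+1)}$ converges in distribution under $P_N$ to a random variable $X$ with density proportional to $e^{-f(x)}$, where \[ f(x)=\frac1{12}\frac{\mathbb E[W^4]}{\mathbb E[W]^4}x^4\quad\text{in case (i)}, \] \[ f(x)=\sum_{i\ge1}\Big(\frac12\Big(\frac{\tau-2}{\tau-1}\,x\,i^{-1/(\tau-1)}\Big)^2-\log\cosh\Big(\frac{\tau-2}{\tau-1}\,x\,i^{-1/(\tau-1)}\Big)\Big)\quad\text{in case (ii)}. \] Moreover $\lim_{x\to\infty}f(x)/x^{1+\boldsymbol\delta}=C$ with $C=\frac1{12}\mathbb E[W^4]/\mathbb E[W]^4$ in case (i) and $C=\big(\frac{\tau-2}{\tau-1}\big)^{\tau-1}\int_0^\infty\big(\frac12y^{-2/(\tau-1)}-\log\cosh y^{-1/(\tau-1)}\big)\,dy\in(0,\infty)$ in case (ii). The same result holds for the rank-1 inhomogeneous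 Curie–Weiss model at inverse temperature $\beta_{c,N}=1/\nu_N$ and $B=0$.
   Context: Weights $w_i>0$, $\ell_N=\sum_iw_i$, $W_N=w_{U_N}$ with $U_N$ uniform on $[N]$, so $\mathbb E[W_N^k]=\frac1N\sum_iw_i^k$. Weight regularity condition: there is a random variable $W$ with $W_N\to W$ in distribution, $\mathbb E[W_N^2]\to\mathbb E[W^2]<\infty$, $\mathbb E[W]>0$. Generalized random graph $\mathrm{GRG}_N(\boldsymbol w)$: edges $ij$ independent, present with probability $w_iw_j/(\ell_N+w_iw_j)$, law $Q_N$. Annealed Ising measure: $P_N(\sigma)=Q_N(\exp[\beta\sum_{(i,j)\in E_N}\sigma_i\sigma_j+B\sum_i\sigma_i])/Q_N(Z_N(\beta,B))$ on $\sigma\in\{-1,1\}^N$. Rank-1 inhomogeneous Curie–Weiss model: measure proportional to $\exp(\frac12\sum_{i,j\in[N]}\beta\frac{w_iw_j}{\ell_N}\sigma_i\sigma_j+B\sum_i\sigma_i)$. $S_N=\sum_{i\in[N]}\sigma_i$. *)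

(* Defs.v *)
From Stdlib Require Import Reals Lra List.
Import ListNotations.
Open Scope R_scope.

Definition sumR {A : Type} (l : list A) (f : A -> R) : R :=
  fold_right (fun a acc => f a + acc) 0 l.
Definition prodR {A : Type} (l : list A) (f : A -> R) : R :=
  fold_right (fun a acc => f a * acc) 1 l.

Definition asinh (y : R) : R := ln (y + sqrt (y ^ 2 + 1)).

(* ---------- weights ----------
   w N i  (i = 0..N-1) is the weight of vertex i+1 of [N] in the N-th graph. *)
Definition ellN (w : nat -> nat -> R) (N : nat) : R := sumR (seq 0 N) (w N).
Definition EWN (w : nat -> nat -> R) (N k : nat) : R :=
  / INR N * sumR (seq 0 N) (fun i => (w N i) ^ k).
Definition nuN (w : nat -> nat -> R) (N : nat) : R := EWN w N 2 / EWN w N 1.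
Definition FN (w : nat -> nat -> R) (N : nat) (x : R) : R :=
  / INR N * sumR (seq 0 N) (fun i => if Rle_dec (w N i) x then 1 else 0).

Definition IsRInt (h : R -> R) (a b v : R) : Prop :=
  exists pr : Riemann_integrable h a b, RiemannInt pr = v.

Definition ImpInt0Inf (h : R -> R) (v : R) : Prop :=
  (forall b, 0 <= b -> exists v', IsRInt h 0 b v') /\
  (forall eps, 0 < eps -> exists M, forall b v', M <= b -> IsRInt h 0 b v' ->
      Rabs (v' - v) < eps).

Definition ImpIntOpen0Inf (h : R -> R) (v : R) : Prop :=
  (forall a b, 0 < a -> a <= b -> exists v', IsRInt h a b v') /\
  (forall eps, 0 < eps -> exists d, 0 < d /\ exists M, forall a b v',
      0 < a -> a <= d -> M <= b -> IsRInt h a b v' -> Rabs (v' - v) < eps).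

Definition ImpIntLower (h : R -> R) (x v : R) : Prop :=
  (forall a, a <= x -> exists v', IsRInt h a x v') /\
  (forall eps, 0 < eps -> exists M, forall a v', a <= M -> IsRInt h a x v' ->
      Rabs (v' - v) < eps).

Definition ImpIntFull (h : R -> R) (v : R) : Prop :=
  (forall a b, a <= b -> exists v', IsRInt h a b v') /\
  (forall eps, 0 < eps -> exists M, forall a b v', a <= - M -> M <= b ->
      IsRInt h a b v' -> Rabs (v' - v) < eps).

(* ---------- the limiting weight W, described by its distribution function ---------- *)
Definition IsCDF (F : R -> R) : Prop :=
  (forall x y, x <= y -> F x <= F y) /\
  (forall x eps, 0 < eps -> exists d, 0 < d /\
      forall y, x <= y < x + d -> Rabs (F y - F x) < eps) /\
  (forall eps, 0 < eps -> exists M, forall x, x <= - M -> Rabs (F x) < eps) /\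
  (forall eps, 0 < eps -> exists M, forall x, M <= x -> Rabs (F x - 1) < eps).

(* E[W^k] = m for a nonnegative random variable W with CDF F
   (layer-cake formula E[W^k] = int_0^infty k x^(k-1) P(W > x) dx). *)
Definition MomentW (F : R -> R) (k : nat) (m : R) : Prop :=
  ImpInt0Inf (fun x => INR k * x ^ (k - 1) * (1 - F x)) m.

Definition WeightRegularity (w : nat -> nat -> R) (FW : R -> R) (m1 m2 : R) : Prop :=
  IsCDF FW /\
  (forall x, continuity_pt FW x -> Un_cv (fun N => FN w N x) (FW x)) /\
  MomentW FW 1 m1 /\ MomentW FW 2 m2 /\
  Un_cv (fun N => EWN w N 2) m2 /\
  0 < m1.

Fixpoint bconfigs (n : nat) : list (list bool) :=
  match n with
  | O => [ [] ]
  | S n' => map (cons true) (bconfigs n') ++ map (cons false) (bconfigs n')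
  end.

Definition spin (s : list bool) (i : nat) : R := if nth i s false then 1 else -1.

Definition SN (N : nat) (s : list bool) : R := sumR (seq 0 N) (spin s).

Fixpoint pairs (N : nat) : list (nat * nat) :=
  match N with
  | O => []
  | S n => pairs n ++ map (fun i => (i, n)) (seq 0 n)
  end.

Definition pGRG (w : nat -> nat -> R) (N : nat) (e : nat * nat) : R :=
  w N (fst e) * w N (snd e) / (ellN w N + w N (fst e) * w N (snd e)).

(* Q_N-probability of the graph encoded by g (g_k = edge pairs_k present) *)
Definition QN (w : nat -> nat -> R) (N : nat) (g : list bool) : R :=
  prodR (combine (pairs N) g)
    (fun eb => if snd eb then pGRG w N (fst eb) else 1 - pGRG w N (fst eb)).

Definition HamGRG (N : nat) (beta B : R) (g s : list bool) : R :=
  beta * sumR (combine (pairs N) g)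
    (fun eb => if snd eb then spin s (fst (fst eb)) * spin s (snd (fst eb)) else 0)
  + B * SN N s.

Definition annealedWeight (w : nat -> nat -> R) (N : nat) (beta B : R) (s : list bool) : R :=
  sumR (bconfigs (length (pairs N))) (fun g => QN w N g * exp (HamGRG N beta B g s)).

Definition cwWeight (w : nat -> nat -> R) (N : nat) (beta B : R) (s : list bool) : R :=
  exp (/ 2 * sumR (seq 0 N) (fun i => sumR (seq 0 N) (fun j =>
          beta * (w N i * w N j / ellN w N) * spin s i * spin s j))
       + B * SN N s).

Definition probOf (N : nat) (wt : list bool -> R) (E : list bool -> bool) : R :=
  sumR (bconfigs N) (fun s => if E s then wt s else 0) / sumR (bconfigs N) wt.

Definition cdfSN (N : nat) (wt : list bool -> R) (a x : R) : R :=
  probOf N wt (fun s => if Rle_dec (SN N s / Rpower (INR N) a) x then true else false).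

Definition ConvToDensity (wt : nat -> list bool -> R) (a : R) (f : R -> R) : Prop :=
  exists Z, 0 < Z /\ ImpIntFull (fun y => exp (- f y)) Z /\
  forall x, exists I, ImpIntLower (fun y => exp (- f y)) x I /\
     Un_cv (fun N => cdfSN N (wt N) a x) (I / Z).

Definition Conclusion (w : nat -> nat -> R) (delta : R) (f : R -> R) (C : R) : Prop :=
  ConvToDensity (fun N => annealedWeight w N (asinh (/ nuN w N)) 0)
                (delta / (delta + 1)) f /\
  ConvToDensity (fun N => cwWeight w N (/ nuN w N) 0) (delta / (delta + 1)) f /\
  (forall eps, 0 < eps -> exists M, forall x, M < x ->
      Rabs (f x / Rpower x (1 + delta) - C) < eps).

(* Main.v *)
Require Import Defs.
From Stdlib Require Import Reals List.
From Stdlib Require Import Lra Lia Psatz FunctionalExtensionality.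
From Coquelicot Require Import Coquelicot.
Import ListNotations.
Open Scope R_scope.

(** With K = N^(delta/(delta+1)) and b_i = w_i K / ell_N, the critical Curie-Weiss weight is
    exp((sum b_i s_i)^2 / (2 sum b_i^2)), and the Hubbard-Stratonovich transform writes it as a
    mixture over a real variable y under which the spins are independent with means
    tanh(b_i y). The mixing density is proportional to exp(-f_N(y)) with
    f_N(y) = sum h(b_i y), h(t) = t^2/2 - log cosh t: criticality is what cancels the quadratic
    term. Since sum b_i = K, the conditional mean of S_N/K is y up to o(1) and its conditional
    variance is at most N/K^2 -> 0, so S_N/K has the limit law of y; as h is convex,
    f_N(y) >= |y| f_N(1) for |y| >= 1, which dominates the densities, and pointwise convergence
    f_N -> f suffices.

    Averaging over the graph turns each edge into a coupling
    sinh(beta) x_ij - sinh(2 beta) x_ij^2 / 2 + O(x_ij^3) with x_ij = w_i w_j / ell_N. The first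
    order is the Curie-Weiss coupling, the second order sums to a negative multiple of
    (sum w_i^2 s_i / ell_N)^2, which vanishes in mean under the Curie-Weiss measure, and the
    remainder is uniformly small. *)

(** One list of conditions, [regime], serves both cases. Its key entry bounds the sum of
    [b N i ^ 4]: [h] is quartic at the origin with a derivative of cubic size, so this bound makes
    the [fN] Lipschitz on bounded sets with one constant for all large N, and by Cauchy-Schwarz it
    controls the bias of the conditional mean. In case (ii) the fourth powers are summable because
    4/(tau-1) > 1, and each of the largest weights keeps its own term of [f]. In case (i) only the
    quartic coefficient survives, provided that no share of the fourth moment sits on exceptional
    weights; this uniform integrability is extracted from convergence in distribution together with
    convergence of the moment. Integrals stay unnormalised: the constants of the Gaussian transform
    and of the graph average are common to numerator and denominator and cancel. The second order
    term of the annealed coupling is not small uniformly in the spins, but being a negative square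
    it can only lower a weight, and exp g >= 1 + g bounds the loss linearly, which is why smallness
    in mean is enough. *)

(** * Finite sums and products *)

Lemma sumR_ext_in {A} (l : list A) f g :
  (forall x, In x l -> f x = g x) -> sumR l f = sumR l g.
Proof.
  induction l as [|a l IH]; simpl; intros H; [reflexivity|].
  rewrite (H a), IH; auto.
Qed.

Lemma sumR_ext {A} (l : list A) f g :
  (forall x, f x = g x) -> sumR l f = sumR l g.
Proof. intros H; apply sumR_ext_in; auto. Qed.

Lemma sumR_plus {A} (l : list A) f g :
  sumR l (fun x => f x + g x) = sumR l f + sumR l g.
Proof. induction l as [|a l IH]; simpl; [lra|rewrite IH; lra]. Qed.

Lemma sumR_scal {A} (l : list A) c f :
  sumR l (fun x => c * f x) = c * sumR l f.
Proof. induction l as [|a l IH]; simpl; [lra|rewrite IH; lra]. Qed.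

Lemma sumR_minus {A} (l : list A) f g :
  sumR l (fun x => f x - g x) = sumR l f - sumR l g.
Proof. induction l as [|a l IH]; simpl; [lra|rewrite IH; lra]. Qed.

Lemma sumR_le_in {A} (l : list A) f g :
  (forall x, In x l -> f x <= g x) -> sumR l f <= sumR l g.
Proof.
  induction l as [|a l IH]; simpl; intros H; [lra|].
  apply Rplus_le_compat; auto.
Qed.

Lemma sumR_le {A} (l : list A) f g :
  (forall x, f x <= g x) -> sumR l f <= sumR l g.
Proof. intros H; apply sumR_le_in; auto. Qed.

Lemma sumR_ge0_in {A} (l : list A) f :
  (forall x, In x l -> 0 <= f x) -> 0 <= sumR l f.
Proof.
  induction l as [|a l IH]; simpl; intros H; [lra|].
  apply Rplus_le_le_0_compat; auto.
Qed.

Lemma sumR_gt0_in {A} (l : list A) f :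
  l <> [] -> (forall x, In x l -> 0 < f x) -> 0 < sumR l f.
Proof.
  destruct l as [|a l]; [congruence|]; simpl; intros _ H.
  apply Rplus_lt_le_0_compat; [auto|].
  apply sumR_ge0_in; intros x Hx; left; auto.
Qed.

Lemma sumR_abs {A} (l : list A) f : Rabs (sumR l f) <= sumR l (fun x => Rabs (f x)).
Proof.
  induction l as [|a l IH]; simpl; [rewrite Rabs_R0; lra|].
  eapply Rle_trans; [apply Rabs_triang|]; lra.
Qed.

Lemma sumR_const {A} (l : list A) c : sumR l (fun _ => c) = INR (length l) * c.
Proof.
  induction l as [|a l IH]; [simpl; lra|].
  change (length (a :: l)) with (S (length l)); rewrite S_INR; simpl; rewrite IH; lra.
Qed.

Lemma sumR_app {A} (l l' : list A) f : sumR (l ++ l') f = sumR l f + sumR l' f.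
Proof. induction l as [|a l IH]; simpl; [lra|rewrite IH; lra]. Qed.

Lemma sumR_map {A B} (g : A -> B) (l : list A) f :
  sumR (map g l) f = sumR l (fun x => f (g x)).
Proof. induction l as [|a l IH]; simpl; [lra|rewrite IH; lra]. Qed.

Lemma sumR_seq_last n f : sumR (seq 0 (S n)) f = sumR (seq 0 n) f + f n.
Proof. rewrite seq_S, sumR_app; simpl; lra. Qed.

Lemma sumR_seq_first n f :
  sumR (seq 0 (S n)) f = f 0%nat + sumR (seq 0 n) (fun i => f (S i)).
Proof.
  change (seq 0 (S n)) with (0%nat :: seq 1 n).
  rewrite <- seq_shift; simpl; now rewrite sumR_map.
Qed.

Lemma sumR_double {A B} (l : list A) (l' : list B) f g :
  sumR l (fun i => sumR l' (fun j => f i * g j)) = sumR l f * sumR l' g.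
Proof.
  rewrite (sumR_ext l _ (fun i => sumR l' g * f i)).
  - rewrite sumR_scal; ring.
  - intros i; rewrite sumR_scal; ring.
Qed.

Lemma in_seq0 n i : In i (seq 0 n) <-> (i < n)%nat.
Proof. rewrite in_seq; lia. Qed.

Lemma sumR_seq_le n f g :
  (forall i, (i < n)%nat -> f i <= g i) -> sumR (seq 0 n) f <= sumR (seq 0 n) g.
Proof. intros H; apply sumR_le_in; intros i Hi; apply H; now apply in_seq0. Qed.

Lemma sumR_seq_ext n f g :
  (forall i, (i < n)%nat -> f i = g i) -> sumR (seq 0 n) f = sumR (seq 0 n) g.
Proof. intros H; apply sumR_ext_in; intros i Hi; apply H; now apply in_seq0. Qed.

Lemma sumR_seq_ge0 n f :
  (forall i, (i < n)%nat -> 0 <= f i) -> 0 <= sumR (seq 0 n) f.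
Proof. intros H; apply sumR_ge0_in; intros i Hi; apply H; now apply in_seq0. Qed.

Lemma sumR_seq_gt0 n f : (0 < n)%nat ->
  (forall i, (i < n)%nat -> 0 < f i) -> 0 < sumR (seq 0 n) f.
Proof.
  intros Hn H; apply sumR_gt0_in; [destruct n; [lia|simpl; congruence]|].
  intros i Hi; apply H; now apply in_seq0.
Qed.

Lemma sumR_seq_const n c : sumR (seq 0 n) (fun _ => c) = INR n * c.
Proof. now rewrite sumR_const, length_seq. Qed.

(** Cauchy-Schwarz against the constant 1: the squares of [n * f x - S] sum to
    [n * (n * Q - S ^ 2)]. *)
Lemma sumR_sqr_le {A} (l : list A) f :
  (sumR l f) ^ 2 <= INR (length l) * sumR l (fun x => f x ^ 2).
Proof.
  destruct l as [|a l']; [simpl; lra|]; set (l := a :: l').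
  set (n := INR (length l)); set (S := sumR l f); set (Q := sumR l (fun x => f x ^ 2)).
  assert (Hn : 0 < n) by (apply lt_0_INR; simpl; lia).
  assert (H : 0 <= sumR l (fun x => (n * f x - S) ^ 2))
    by (apply sumR_ge0_in; intros; apply pow2_ge_0).
  rewrite (sumR_ext l _ (fun x => n ^ 2 * f x ^ 2 + ((- (2 * n * S)) * f x + S ^ 2)))
    in H by (intros; ring).
  rewrite !sumR_plus, !sumR_scal, sumR_const in H; fold n S Q in H.
  assert (H' : 0 <= n * (n * Q - S ^ 2)) by (replace (n * (n * Q - S ^ 2))
    with (n ^ 2 * Q + (- (2 * n * S) * S + n * S ^ 2)) by ring; exact H).
  assert (0 <= n * Q - S ^ 2) by (apply (Rmult_le_reg_l n); lra).
  lra.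
Qed.

(** For [u i = c i * spin s i] the diagonal removed here does not depend on the spins; it ends up in
    [annealed_const]. *)
Lemma sumR_pairs (N : nat) (u : nat -> R) :
  sumR (pairs N) (fun e => u (fst e) * u (snd e)) =
  / 2 * ((sumR (seq 0 N) u) ^ 2 - sumR (seq 0 N) (fun i => u i ^ 2)).
Proof.
  induction N as [|n IH]; [simpl; lra|].
  change (pairs (S n)) with (pairs n ++ map (fun i => (i, n)) (seq 0 n)).
  rewrite sumR_app, IH, sumR_map, !sumR_seq_last; cbn [fst snd].
  rewrite (sumR_ext _ (fun x => u x * u n) (fun x => u n * u x)) by (intros; ring).
  rewrite sumR_scal; field.
Qed.

Lemma in_pairs N e : In e (pairs N) -> (fst e < N)%nat /\ (snd e < N)%nat.
Proof.
  induction N as [|n IH]; [simpl; tauto|].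
  change (pairs (S n)) with (pairs n ++ map (fun i => (i, n)) (seq 0 n)).
  rewrite in_app_iff, in_map_iff; intros [H|[i [<- H]]].
  - apply IH in H; lia.
  - apply in_seq0 in H; simpl; lia.
Qed.

Lemma prodR_ext_in {A} (l : list A) f g :
  (forall x, In x l -> f x = g x) -> prodR l f = prodR l g.
Proof.
  induction l as [|a l IH]; simpl; intros H; [reflexivity|].
  rewrite (H a), IH; auto.
Qed.

Lemma prodR_mult {A} (l : list A) f g :
  prodR l (fun x => f x * g x) = prodR l f * prodR l g.
Proof. induction l as [|a l IH]; simpl; [lra|rewrite IH; ring]. Qed.

Lemma prodR_map {A B} (g : A -> B) (l : list A) f :
  prodR (map g l) f = prodR l (fun x => f (g x)).
Proof. induction l as [|a l IH]; simpl; [lra|rewrite IH; lra]. Qed.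

Lemma prodR_seq_first n f :
  prodR (seq 0 (S n)) f = f 0%nat * prodR (seq 0 n) (fun i => f (S i)).
Proof.
  change (seq 0 (S n)) with (0%nat :: seq 1 n).
  rewrite <- seq_shift; simpl; now rewrite prodR_map.
Qed.

Lemma prodR_exp {A} (l : list A) f : prodR l (fun x => exp (f x)) = exp (sumR l f).
Proof. induction l as [|a l IH]; simpl; [now rewrite exp_0|rewrite IH, exp_plus; ring]. Qed.

Lemma prodR_gt0_in {A} (l : list A) f :
  (forall x, In x l -> 0 < f x) -> 0 < prodR l f.
Proof.
  induction l as [|a l IH]; simpl; intros H; [lra|].
  apply Rmult_lt_0_compat; auto.
Qed.

(** * Spin configurations *)

Lemma sumR_bconfigs_S n F :
  sumR (bconfigs (S n)) F =
  sumR (bconfigs n) (fun s => F (true :: s)) + sumR (bconfigs n) (fun s => F (false :: s)).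
Proof.
  change (bconfigs (S n)) with (map (cons true) (bconfigs n) ++ map (cons false) (bconfigs n)).
  now rewrite sumR_app, !sumR_map.
Qed.

Lemma spin_sqr s i : spin s i ^ 2 = 1.
Proof. unfold spin; destruct (nth i s false); ring. Qed.

Lemma spin_cases s i : spin s i = 1 \/ spin s i = -1.
Proof. unfold spin; destruct (nth i s false); auto. Qed.

Definition lin (n : nat) (c : nat -> R) (s : list bool) : R :=
  sumR (seq 0 n) (fun i => c i * spin s i).

Lemma lin_cons n c a s :
  lin (S n) c (a :: s) = c 0%nat * (if a then 1 else -1) + lin n (fun i => c (S i)) s.
Proof. unfold lin; rewrite sumR_seq_first; reflexivity. Qed.

Lemma cosh_gt0 x : 0 < cosh x.
Proof. unfold cosh; generalize (exp_pos x) (exp_pos (-x)); lra. Qed.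

(** Under the weight [exp (y * lin n b s)] the spins are independent with means [tanh (b i * y)], so
    the right side is the partition function times squared mean plus variance. The offset [d] is
    general so that the induction can absorb the first spin into it, with either sign. *)
Lemma second_moment n : forall b c d y,
  sumR (bconfigs n) (fun s => (d + lin n c s) ^ 2 * exp (y * lin n b s)) =
  prodR (seq 0 n) (fun i => 2 * cosh (b i * y)) *
  ((d + sumR (seq 0 n) (fun i => c i * tanh (b i * y))) ^ 2
   + sumR (seq 0 n) (fun i => c i ^ 2 * (1 - tanh (b i * y) ^ 2))).
Proof.
  induction n as [|n IH]; intros b c d y.
  - unfold lin; simpl; rewrite Rmult_0_r, exp_0; ring.
  - rewrite sumR_bconfigs_S.
    set (b' := fun i => b (S i)); set (c' := fun i => c (S i)).
    rewrite (sumR_ext _ (fun s => (d + lin (S n) c (true :: s)) ^ 2 *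
        exp (y * lin (S n) b (true :: s)))
      (fun s => exp (b 0%nat * y) *
        ((d + c 0%nat + lin n c' s) ^ 2 * exp (y * lin n b' s)))).
    2:{ intros s; rewrite !lin_cons.
        replace (y * (b 0%nat * 1 + lin n (fun i => b (S i)) s))
          with (b 0%nat * y + y * lin n b' s) by (unfold b'; ring).
        rewrite exp_plus; unfold c'; ring. }
    rewrite (sumR_ext _ (fun s => (d + lin (S n) c (false :: s)) ^ 2 *
        exp (y * lin (S n) b (false :: s)))
      (fun s => exp (- (b 0%nat * y)) *
        ((d - c 0%nat + lin n c' s) ^ 2 * exp (y * lin n b' s)))).
    2:{ intros s; rewrite !lin_cons.
        replace (y * (b 0%nat * -1 + lin n (fun i => b (S i)) s))
          with (- (b 0%nat * y) + y * lin n b' s) by (unfold b'; ring).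
        rewrite exp_plus; unfold c'; ring. }
    rewrite !sumR_scal, !IH, !sumR_seq_first.
    rewrite prodR_seq_first; fold b' c'.
    change (prodR (seq 0 n) (fun i => 2 * cosh (b (S i) * y)))
      with (prodR (seq 0 n) (fun i => 2 * cosh (b' i * y))).
    change (fun i => c (S i) * tanh (b (S i) * y)) with (fun i => c' i * tanh (b' i * y)).
    change (fun i => c (S i) ^ 2 * (1 - tanh (b (S i) * y) ^ 2))
      with (fun i => c' i ^ 2 * (1 - tanh (b' i * y) ^ 2)).
    set (P := prodR _ _); set (X := sumR _ _); set (V := sumR _ _); set (t := b 0%nat * y).
    assert (Ht : cosh t * tanh t = sinh t)
      by (unfold tanh; field; apply Rgt_not_eq, cosh_gt0).
    (* Adding the two signs leaves a [cosh] part and a cross term in [sinh]; the square of [tanh] in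
       the mean cancels the one in the variance. *)
    transitivity (P * (2 * cosh t * ((d + X) ^ 2 + c 0%nat ^ 2 + V)
      + 2 * 2 * (cosh t * tanh t) * c 0%nat * (d + X))); [|ring].
    rewrite Ht; unfold cosh, sinh; field.
Qed.

Lemma partition_fun n b y :
  sumR (bconfigs n) (fun s => exp (y * lin n b s)) =
  prodR (seq 0 n) (fun i => 2 * cosh (b i * y)).
Proof.
  rewrite (sumR_ext _ _ (fun s => (1 + lin n (fun _ => 0) s) ^ 2 * exp (y * lin n b s))).
  - rewrite second_moment, (sumR_ext (seq 0 n) (fun i => 0 * _) (fun _ => 0)) by (intros; ring).
    rewrite (sumR_ext (seq 0 n) (fun i => 0 ^ 2 * _) (fun _ => 0)) by (intros; ring).
    rewrite sumR_const; ring.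
  - intros s; unfold lin at 2; rewrite (sumR_ext (seq 0 n) (fun i => 0 * _) (fun _ => 0))
      by (intros; ring).
    rewrite sumR_const; ring.
Qed.

(** Distributivity. This is where independence of the edges enters: it turns the average over graphs
    into a product over pairs. *)
Lemma sumR_bconfigs_prod {A} (l : list A) (F : A -> bool -> R) :
  sumR (bconfigs (length l)) (fun g => prodR (combine l g) (fun eb => F (fst eb) (snd eb)))
  = prodR l (fun e => F e true + F e false).
Proof.
  induction l as [|a l IH]; [simpl; lra|].
  change (length (a :: l)) with (S (length l)); rewrite sumR_bconfigs_S.
  cbn [prodR fold_right]; fold (prodR l (fun e => F e true + F e false)).
  rewrite <- IH, Rmult_plus_distr_r, <- !sumR_scal; reflexivity.
Qed.

(** * Hyperbolic inequalities *)

(** The Taylor-type bounds below apply this to a difference vanishing at 0. They form a chain: as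
    the derivative of tanh is 1 - tanh^2, a bound on [tanh] controls the derivative for the next
    order. *)
Lemma le_of_derive_ge0 (F F' : R -> R) t : 0 <= t ->
  (forall x, 0 <= x -> is_derive F x (F' x)) ->
  (forall x, 0 <= x -> 0 <= F' x) -> F 0 <= F t.
Proof.
  intros Ht HF HF'; destruct Ht as [Ht| <-]; [|lra].
  destruct (MVT_cor2 F F' 0 t Ht) as [c [Hc Hct]].
  { intros c Hc; apply is_derive_Reals, HF; lra. }
  assert (0 <= F' c * (t - 0)) by (apply Rmult_le_pos; [apply HF'|]; lra); lra.
Qed.

Lemma cosh2_sinh2 x : cosh x ^ 2 - sinh x ^ 2 = 1.
Proof.
  unfold cosh, sinh; rewrite exp_Ropp; field; apply Rgt_not_eq, exp_pos.
Qed.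

Lemma is_derive_cosh x : is_derive cosh x (sinh x).
Proof. apply is_derive_Reals, derivable_pt_lim_cosh. Qed.

Lemma is_derive_tanh x : is_derive tanh x (1 - tanh x ^ 2).
Proof.
  assert (Hc := cosh_gt0 x); unfold tanh at 1.
  replace (1 - tanh x ^ 2) with ((cosh x * cosh x - sinh x * sinh x) / cosh x ^ 2)
    by (unfold tanh; field; lra).
  apply (is_derive_div sinh cosh x (cosh x) (sinh x)).
  - apply is_derive_Reals, derivable_pt_lim_sinh.
  - apply is_derive_cosh.
  - lra.
Qed.

Lemma tanh_0 : tanh 0 = 0.
Proof. unfold tanh, sinh; rewrite Ropp_0; field; apply Rgt_not_eq, cosh_gt0. Qed.

Lemma tanh_opp x : tanh (- x) = - tanh x.
Proof.
  assert (Hc := cosh_gt0 x); unfold tanh, sinh, cosh in *; rewrite Ropp_involutive.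
  field; lra.
Qed.

Lemma tanh_sqr_lt1 x : 0 <= tanh x ^ 2 < 1.
Proof.
  split; [apply pow2_ge_0|].
  assert (Hc := cosh_gt0 x); assert (H := cosh2_sinh2 x).
  assert (H' : 1 - tanh x ^ 2 = / cosh x ^ 2)
    by (unfold tanh; apply (Rmult_eq_reg_r (cosh x ^ 2)); [|nra]; field_simplify; lra).
  assert (0 < / cosh x ^ 2) by (apply Rinv_0_lt_compat, pow_lt, Hc); lra.
Qed.

Definition h (t : R) : R := / 2 * t ^ 2 - ln (cosh t).

Lemma is_derive_h x : is_derive h x (x - tanh x).
Proof.
  assert (Hc := cosh_gt0 x); unfold h.
  replace (x - tanh x) with (minus x (scal (sinh x) (/ cosh x)))
    by (unfold minus, plus, opp, scal, tanh; simpl; unfold mult; simpl; field; lra).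
  apply (is_derive_minus (V := R_NormedModule)); [auto_derive; [auto|field]|].
  apply (is_derive_comp ln cosh); [apply is_derive_ln, Hc|apply is_derive_cosh].
Qed.

Lemma cosh_opp x : cosh (- x) = cosh x.
Proof. unfold cosh; rewrite Ropp_involutive; field. Qed.

Lemma h_opp x : h (- x) = h x.
Proof. unfold h; rewrite cosh_opp; ring. Qed.

Lemma h_abs x : h (Rabs x) = h x.
Proof. unfold Rabs; destruct (Rcase_abs x); [apply h_opp|reflexivity]. Qed.

Lemma h_0 : h 0 = 0.
Proof. unfold h; rewrite cosh_0, ln_1; ring. Qed.

Lemma tanh_ge0 t : 0 <= t -> 0 <= tanh t.
Proof.
  intros Ht; rewrite <- tanh_0 at 1.
  apply (le_of_derive_ge0 tanh (fun x => 1 - tanh x ^ 2)); auto using is_derive_tanh.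
  intros x _; generalize (tanh_sqr_lt1 x); lra.
Qed.

Lemma tanh_le t : 0 <= t -> tanh t <= t.
Proof.
  intros Ht; enough (0 - tanh 0 <= t - tanh t) by (rewrite tanh_0 in *; lra).
  apply (le_of_derive_ge0 (fun x => x - tanh x) (fun x => 1 - (1 - tanh x ^ 2))); auto.
  - intros x _; apply (is_derive_minus (V := R_NormedModule) (fun x => x));
      [apply is_derive_Reals, derivable_pt_lim_id|apply is_derive_tanh].
  - intros x _; generalize (tanh_sqr_lt1 x); lra.
Qed.

Lemma tanh_ge_cubic t : 0 <= t -> t - t ^ 3 / 3 <= tanh t.
Proof.
  intros Ht; enough (tanh 0 - (0 - 0 ^ 3 / 3) <= tanh t - (t - t ^ 3 / 3))
    by (rewrite tanh_0 in *; lra).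
  apply (le_of_derive_ge0 (fun x => tanh x - (x - x ^ 3 / 3))
    (fun x => (1 - tanh x ^ 2) - (1 - x ^ 2))); auto.
  - intros x _; apply (is_derive_minus (V := R_NormedModule) tanh);
      [apply is_derive_tanh|auto_derive; [auto|field]].
  - intros x Hx; generalize (tanh_ge0 x Hx) (tanh_le x Hx); nra.
Qed.

(** The coefficient 2/15 is the Taylor one. The difference increases since x^2 - tanh^2 x = (x -
    tanh x)(x + tanh x) is at most (x^3/3)(2x). *)
Lemma tanh_le_quintic t : 0 <= t -> tanh t <= t - t ^ 3 / 3 + 2 * t ^ 5 / 15.
Proof.
  intros Ht; enough ((0 - 0 ^ 3 / 3 + 2 * 0 ^ 5 / 15) - tanh 0 <=
    (t - t ^ 3 / 3 + 2 * t ^ 5 / 15) - tanh t) by (rewrite tanh_0 in *; lra).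
  apply (le_of_derive_ge0 (fun x => (x - x ^ 3 / 3 + 2 * x ^ 5 / 15) - tanh x)
    (fun x => (1 - x ^ 2 + 2 * x ^ 4 / 3) - (1 - tanh x ^ 2))); auto.
  - intros x _; apply (is_derive_minus (V := R_NormedModule)
      (fun x => x - x ^ 3 / 3 + 2 * x ^ 5 / 15) tanh);
      [auto_derive; [auto|field]|apply is_derive_tanh].
  - intros x Hx; generalize (tanh_ge0 x Hx) (tanh_le x Hx) (tanh_ge_cubic x Hx).
    intros H1 H2 H3.
    assert (x ^ 2 - tanh x ^ 2 <= x ^ 3 / 3 * (2 * x)); [|lra].
    replace (x ^ 2 - tanh x ^ 2) with ((x - tanh x) * (x + tanh x)) by ring.
    apply Rmult_le_compat; lra.
Qed.

Lemma h_ge0 t : 0 <= h t.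
Proof.
  rewrite <- h_abs, <- h_0 at 1.
  apply (le_of_derive_ge0 h (fun x => x - tanh x)); auto using is_derive_h, Rabs_pos.
  intros x Hx; generalize (tanh_le x Hx); lra.
Qed.

Lemma h_le_quartic t : h t <= t ^ 4 / 12.
Proof.
  rewrite <- h_abs; replace (t ^ 4) with (Rabs t ^ 4)
    by (replace (t ^ 4) with ((t ^ 2) ^ 2) by ring; rewrite <- (pow2_abs t); ring).
  generalize (Rabs t) (Rabs_pos t); clear t; intros t Ht.
  enough (0 ^ 4 / 12 - h 0 <= t ^ 4 / 12 - h t) by (rewrite h_0 in *; lra).
  apply (le_of_derive_ge0 (fun x => x ^ 4 / 12 - h x) (fun x => x ^ 3 / 3 - (x - tanh x))); auto.
  - intros x _; apply (is_derive_minus (V := R_NormedModule) (fun x => x ^ 4 / 12) h);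
      [auto_derive; [auto|field]|apply is_derive_h].
  - intros x Hx; generalize (tanh_ge_cubic x Hx); lra.
Qed.

(** Integrated form of [tanh_le_quintic], as [h] has derivative x - tanh x; 1/45 is (2/15)/6. *)
Lemma h_ge_quartic t : t ^ 4 / 12 - t ^ 6 / 45 <= h t.
Proof.
  rewrite <- h_abs; replace (t ^ 4) with (Rabs t ^ 4)
    by (replace (t ^ 4) with ((t ^ 2) ^ 2) by ring; rewrite <- (pow2_abs t); ring).
  replace (t ^ 6) with (Rabs t ^ 6)
    by (replace (t ^ 6) with ((t ^ 2) ^ 3) by ring; rewrite <- (pow2_abs t); ring).
  generalize (Rabs t) (Rabs_pos t); clear t; intros t Ht.
  enough (h 0 - (0 ^ 4 / 12 - 0 ^ 6 / 45) <= h t - (t ^ 4 / 12 - t ^ 6 / 45))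
    by (rewrite h_0 in *; lra).
  apply (le_of_derive_ge0 (fun x => h x - (x ^ 4 / 12 - x ^ 6 / 45))
    (fun x => (x - tanh x) - (x ^ 3 / 3 - 2 * x ^ 5 / 15))); auto.
  - intros x _; apply (is_derive_minus (V := R_NormedModule) h);
      [apply is_derive_h|auto_derive; [auto|field]].
  - intros x Hx; generalize (tanh_le_quintic x Hx); lra.
Qed.

Lemma h_le_quadratic t : h t <= t ^ 2 / 2.
Proof.
  unfold h; enough (0 <= ln (cosh t)) by lra.
  rewrite <- ln_1; assert (1 <= cosh t).
  { generalize (cosh2_sinh2 t) (cosh_gt0 t) (pow2_ge_0 (sinh t)); nra. }
  destruct H as [H| <-]; [left; apply ln_increasing; lra|lra].
Qed.

Lemma dh_mono s t : 0 <= s <= t -> s - tanh s <= t - tanh t.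
Proof.
  intros [Hs Hst]; destruct Hst as [Hst| <-]; [|lra].
  destruct (MVT_cor2 tanh (fun x => 1 - tanh x ^ 2) s t Hst) as [c [Hc _]].
  { intros c _; apply is_derive_Reals, is_derive_tanh. }
  generalize (tanh_sqr_lt1 c); nra.
Qed.

Lemma h_mono s t : 0 <= s <= t -> h s <= h t.
Proof.
  intros [Hs Hst]; destruct Hst as [Hst| <-]; [|lra].
  destruct (MVT_cor2 h (fun x => x - tanh x) s t Hst) as [c [Hc Hc']].
  { intros c _; apply is_derive_Reals, is_derive_h. }
  generalize (tanh_le c); nra.
Qed.

Lemma h_gt0 t : 0 < t -> 0 < h t.
Proof.
  (* The quartic minorant is positive only near 0, so it is used at min(t, 1) and monotonicity does
     the rest. *)
  intros Ht; set (s := Rmin t 1).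
  assert (Hs : 0 < s <= 1 /\ s <= t) by (unfold s, Rmin; destruct (Rle_dec t 1); lra).
  apply Rlt_le_trans with (h s); [|apply h_mono; lra].
  apply Rlt_le_trans with (s ^ 4 / 12 - s ^ 6 / 45); [|apply h_ge_quartic].
  replace (s ^ 4 / 12 - s ^ 6 / 45) with (s ^ 4 * (/ 12 - s ^ 2 / 45)) by field.
  apply Rmult_lt_0_compat; [apply pow_lt; lra|nra].
Qed.

(** Convexity seen from the origin: the tangent at t lies below h(0) = 0. The difference has
    derivative x tanh^2 x. *)
Lemma h_le_dh t : 0 <= t -> h t <= t * (t - tanh t).
Proof.
  intros Ht; enough (0 * (0 - tanh 0) - h 0 <= t * (t - tanh t) - h t)
    by (rewrite h_0 in *; lra).
  apply (le_of_derive_ge0 (fun x => x * (x - tanh x) - h x)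
    (fun x => (1 * (x - tanh x) + x * (1 - (1 - tanh x ^ 2))) - (x - tanh x))); auto.
  - intros x _; apply (is_derive_minus (V := R_NormedModule) (fun x => x * (x - tanh x)) h);
      [|apply is_derive_h].
    apply (is_derive_mult (fun x => x) (fun x => x - tanh x));
      [apply is_derive_Reals, derivable_pt_lim_id| |intros; apply Rmult_comm].
    apply (is_derive_minus (V := R_NormedModule) (fun x => x));
      [apply is_derive_Reals, derivable_pt_lim_id|apply is_derive_tanh].
  - intros x Hx; generalize (tanh_sqr_lt1 x); nra.
Qed.

(** In u = y - 1 the difference has derivative b h'(b(1+u)) - h(b). As h' increases, this is at
    least b h'(b) - h(b), which [h_le_dh] makes nonnegative. *)
Lemma h_superlinear b y : 0 <= b -> 1 <= y -> y * h b <= h (b * y).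
Proof.
  intros Hb Hy.
  enough (h (b * (1 + 0)) - (1 + 0) * h b <= h (b * (1 + (y - 1))) - (1 + (y - 1)) * h b).
  { replace (b * (1 + 0)) with b in H by ring.
    replace (b * (1 + (y - 1))) with (b * y) in H by ring; lra. }
  apply (le_of_derive_ge0 (fun u => h (b * (1 + u)) - (1 + u) * h b)
    (fun u => b * (b * (1 + u) - tanh (b * (1 + u))) - h b)); [lra| |].
  - intros x _; apply (is_derive_minus (V := R_NormedModule) (fun u => h (b * (1 + u)))
      (fun u => (1 + u) * h b)); [|auto_derive; [auto|ring]].
    apply (is_derive_comp h (fun u => b * (1 + u))); [apply is_derive_h|].
    auto_derive; [auto|ring].
  - intros x Hx; generalize (h_le_dh b Hb) (dh_mono b (b * (1 + x))); nra.
Qed.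

Lemma dh_abs_le_cubic t : Rabs (t - tanh t) <= Rabs t ^ 3.
Proof.
  destruct (Rle_dec 0 t) as [Ht|Ht].
  - generalize (tanh_le t Ht) (tanh_ge_cubic t Ht) (pow_le t 3 Ht); intros.
    rewrite !Rabs_pos_eq by lra; lra.
  - assert (Ht' : 0 <= - t) by lra; generalize (tanh_le _ Ht') (tanh_ge_cubic _ Ht').
    generalize (pow_le _ 3 Ht'); rewrite tanh_opp; intros.
    rewrite (Rabs_left t), Rabs_left1 by lra; lra.
Qed.

(** The cubic bound serves for |t| <= 1 and a linear one beyond. The power 2 holds for all t and
    sums over the vertices to [sumsq], which Cauchy-Schwarz controls by the fourth powers. *)
Lemma dh_abs_le_quadratic t : Rabs (tanh t - t) <= t ^ 2.
Proof.
  rewrite <- Rabs_Ropp, Ropp_minus_distr.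
  destruct (Rle_dec (Rabs t) 1) as [H|H].
  - eapply Rle_trans; [apply dh_abs_le_cubic|].
    rewrite <- pow2_abs; generalize (Rabs_pos t); nra.
  - rewrite <- pow2_abs; apply Rle_trans with (Rabs t); [|nra].
    destruct (Rle_dec 0 t) as [Ht|Ht].
    + generalize (tanh_le t Ht) (tanh_ge0 t Ht); intros; rewrite !Rabs_pos_eq; lra.
    + assert (Ht' : 0 <= - t) by lra; generalize (tanh_le _ Ht') (tanh_ge0 _ Ht').
      rewrite tanh_opp; intros; rewrite (Rabs_left t), Rabs_left1 by lra; lra.
Qed.

Lemma tanh_abs_le t : Rabs (tanh t) <= Rabs t.
Proof.
  destruct (Rle_dec 0 t) as [Ht|Ht].
  - generalize (tanh_le t Ht) (tanh_ge0 t Ht); intros; rewrite !Rabs_pos_eq; lra.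
  - assert (Ht' : 0 <= - t) by lra; generalize (tanh_le _ Ht') (tanh_ge0 _ Ht').
    rewrite tanh_opp; intros; rewrite (Rabs_left t), Rabs_left1 by lra; lra.
Qed.

(** The cubic size of the derivative is kept because, with one more factor [b i] from the increment,
    it gives the sum of [b i ^ 4]. *)
Lemma h_lipschitz M s t : Rabs s <= M -> Rabs t <= M -> Rabs (h s - h t) <= M ^ 3 * Rabs (s - t).
Proof.
  intros Hs Ht.
  destruct (MVT_abs h (fun x => x - tanh x) t s) as [c [-> Hc]].
  { intros c _; apply is_derive_Reals, is_derive_h. }
  apply Rmult_le_compat_r; [apply Rabs_pos|].
  eapply Rle_trans; [apply dh_abs_le_cubic|].
  apply pow_incr; split; [apply Rabs_pos|].
  unfold Rmin, Rmax in Hc; destruct (Rle_dec t s);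
    apply Rabs_le; apply Rabs_le_between in Hs; apply Rabs_le_between in Ht; lra.
Qed.

Lemma continuous_h x : continuous h x.
Proof. apply (ex_derive_continuous h); exists (x - tanh x); apply is_derive_h. Qed.

(** * Improper integrals *)

Lemma is_lim_seq_eps (u : nat -> R) (l : R) :
  is_lim_seq u l <-> forall eps, 0 < eps -> eventually (fun n => Rabs (u n - l) < eps).
Proof.
  rewrite is_lim_seq_Reals; split; intros H eps He; destruct (H eps He) as [N HN];
    exists N; exact HN.
Qed.

Lemma is_lim_seq_le_eps (u : nat -> R) (l : R) :
  (forall eps, 0 < eps -> eventually (fun n => Rabs (u n - l) <= eps)) -> is_lim_seq u l.
Proof.
  intros H; apply is_lim_seq_eps; intros eps He.
  destruct (H (eps / 2)) as [N HN]; [lra|]; exists N; intros n Hn; specialize (HN n Hn); lra.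
Qed.

Lemma is_lim_seq_ub (u : nat -> R) (l m : R) :
  is_lim_seq u l -> eventually (fun n => u n <= m) -> l <= m.
Proof.
  intros Hl He.
  apply (is_lim_seq_le_loc u (fun _ => m) l m He Hl (is_lim_seq_const m)).
Qed.

Lemma is_lim_seq_lb (u : nat -> R) (l m : R) :
  is_lim_seq u l -> eventually (fun n => m <= u n) -> m <= l.
Proof.
  intros Hl He.
  apply (is_lim_seq_le_loc (fun _ => m) u m l He (is_lim_seq_const m) Hl).
Qed.

Lemma is_lim_seq_squeeze0 (u v : nat -> R) :
  eventually (fun n => Rabs (u n) <= v n) -> is_lim_seq v 0 -> is_lim_seq u 0.
Proof.
  intros [N H] Hv; apply is_lim_seq_eps; intros eps He.
  destruct (proj1 (is_lim_seq_eps v 0) Hv eps He) as [N' HN'].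
  exists (max N N'); intros n Hn; specialize (H n ltac:(lia)); specialize (HN' n ltac:(lia)).
  rewrite Rminus_0_r in *; generalize (Rle_abs (v n)); lra.
Qed.

Lemma eventually_INR_ge M : eventually (fun n => M <= INR n).
Proof.
  destruct (INR_unbounded M) as [n Hn]; exists n; intros m Hm.
  apply le_INR in Hm; lra.
Qed.

Lemma ex_RInt_cont (u : R -> R) a b : (forall x, continuous u x) -> ex_RInt u a b.
Proof. intros H; apply (ex_RInt_continuous (V := R_CompleteNormedModule)); intros; apply H. Qed.

Lemma RInt_Chasles_R (u : R -> R) a b c : ex_RInt u a b -> ex_RInt u b c ->
  RInt u a c = RInt u a b + RInt u b c.
Proof. intros H1 H2; symmetry; apply (RInt_Chasles u a b c H1 H2). Qed.

Lemma IsRInt_RInt u a b v : IsRInt u a b v <-> ex_RInt u a b /\ RInt u a b = v.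
Proof.
  split.
  - intros [pr <-]; split; [now apply ex_RInt_Reals_1|apply RInt_Reals].
  - intros [H <-]; exists (ex_RInt_Reals_0 _ _ _ H); symmetry; apply RInt_Reals.
Qed.

(** Cauchy criterion for truncated integrals: [EL] and [ER] bound what is missed on the left and on
    the right. One exhausting sequence of intervals yields the limit, and the error bound passes to
    it for every admissible pair. *)
Lemma net_limit (P : R -> R -> R) (dom : R -> R -> Prop) (EL ER : R -> R) (an bn : nat -> R) :
  (forall n, dom (an n) (bn n)) ->
  is_lim_seq (fun n => EL (an n) + ER (bn n)) 0 ->
  (forall a b, dom a b ->
     eventually (fun n => Rabs (P a b - P (an n) (bn n)) <= EL a + ER b)) ->
  exists l : R, is_lim_seq (fun n => P (an n) (bn n)) l /\
    forall a b, dom a b -> Rabs (P a b - l) <= EL a + ER b.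
Proof.
  intros Hd He HP.
  assert (Hc : ex_finite_lim_seq (fun n => P (an n) (bn n))).
  { apply ex_lim_seq_cauchy_corr; intros eps.
    destruct (proj1 (is_lim_seq_eps _ _) He (eps / 2)) as [N HN].
    { generalize (cond_pos eps); lra. }
    destruct (HP _ _ (Hd N)) as [N1 HN1]; exists N1; intros n m Hn Hm.
    specialize (HN N ltac:(lia)); rewrite Rminus_0_r in HN; apply Rabs_def2 in HN.
    assert (H1 := HN1 n Hn); assert (H2 := HN1 m Hm).
    apply Rabs_le_between in H1; apply Rabs_le_between in H2; apply Rabs_def1; lra. }
  destruct Hc as [l Hl]; exists l; split; [exact Hl|].
  intros a b Hab.
  apply (is_lim_seq_ub (fun n => Rabs (P a b - P (an n) (bn n)))); [|now apply HP].
  apply (is_lim_seq_abs _ (Finite (P a b - l))), is_lim_seq_minus'; [|exact Hl].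
  apply is_lim_seq_const.
Qed.

Lemma atan_le x : 0 <= x -> atan x <= x.
Proof.
  intros Hx; enough (0 - atan 0 <= x - atan x) by (rewrite atan_0 in *; lra).
  apply (le_of_derive_ge0 (fun x => x - atan x) (fun x => 1 - / (1 + x ^ 2))); auto.
  - intros y _; auto_derive; [auto|unfold Rsqr; field; nra].
  - intros y _; enough (/ (1 + y ^ 2) <= 1) by lra.
    rewrite <- Rinv_1 at 2; apply Rinv_le_contravar; generalize (pow2_ge_0 y); lra.
Qed.

Lemma atan_tail x : 0 < x -> 0 <= PI / 2 - atan x <= / x.
Proof.
  intros Hx; rewrite <- atan_inv by exact Hx; split.
  - rewrite <- atan_0; left; apply atan_increasing, Rinv_0_lt_compat, Hx.
  - apply atan_le; left; apply Rinv_0_lt_compat, Hx.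
Qed.

Lemma is_lim_seq_inv_INR : is_lim_seq (fun n => / INR n) 0.
Proof.
  apply (is_lim_seq_inv _ p_infty); [apply is_lim_seq_INR|easy].
Qed.

Lemma is_lim_seq_atan_tail : is_lim_seq (fun n => PI / 2 - atan (INR n)) 0.
Proof.
  apply (is_lim_seq_squeeze0 _ (fun n => / INR n)); [|apply is_lim_seq_inv_INR].
  exists 1%nat; intros n Hn; assert (0 < INR n) by (apply lt_0_INR; lia).
  rewrite Rabs_pos_eq; apply atan_tail; auto.
Qed.

(** The majorant is a multiple of the Cauchy density because its primitive [D * atan x] makes every
    tail explicit and its total mass is [D * PI]. Continuity provides integrability on bounded
    intervals. *)
Definition dominated (D : R) (u : R -> R) : Prop :=
  (forall x, continuous u x) /\ (forall x, 0 <= u x <= D / (1 + x ^ 2)).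

Lemma is_RInt_cauchy D a b : is_RInt (fun x => D / (1 + x ^ 2)) a b (D * atan b - D * atan a).
Proof.
  apply (is_RInt_derive (fun x => D * atan x)).
  - intros x _; auto_derive; [auto|field; nra].
  - intros x _; apply (ex_derive_continuous (V := R_NormedModule)).
    auto_derive; generalize (pow2_ge_0 x); simpl; lra.
Qed.

Lemma RInt_nonneg_dominated D u a b : dominated D u -> a <= b ->
  0 <= RInt u a b <= D * (atan b - atan a).
Proof.
  intros [Hc Hu] Hab; split.
  - apply RInt_ge_0; auto using ex_RInt_cont; intros; apply Hu.
  - rewrite Rmult_minus_distr_l, <- (is_RInt_unique _ _ _ _ (is_RInt_cauchy D a b)).
    apply RInt_le; auto using ex_RInt_cont; [|intros; apply Hu].
    eexists; apply is_RInt_cauchy.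
Qed.

(** Mass of the majorant to the right of [a]; by evenness its mass to the left of [a] is
    [etail D (- a)]. *)
Definition etail (D a : R) : R := D * (PI / 2 - atan a).

Lemma dominated_ge0 D u : dominated D u -> 0 <= D.
Proof. intros [_ H]; specialize (H 0); replace (D / (1 + 0 ^ 2)) with D in H by field; lra. Qed.

Lemma etail_opp D a : etail D (- a) = D * (PI / 2 + atan a).
Proof. unfold etail; rewrite atan_opp; ring. Qed.

Lemma etail_ge0 D a : 0 <= D -> 0 <= etail D a.
Proof. intros HD; apply Rmult_le_pos; [exact HD|generalize (atan_bound a); lra]. Qed.

Lemma RInt_enlarge D u a b a' b' : dominated D u -> a' <= a -> a <= b -> b <= b' ->
  RInt u a b <= RInt u a' b' <= RInt u a b + (etail D (- a) + etail D b).
Proof.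
  intros H Ha Hab Hb; assert (HD := dominated_ge0 _ _ H).
  assert (Hex : forall x y, ex_RInt u x y) by (intros; apply ex_RInt_cont, H).
  rewrite (RInt_Chasles_R u a' a b'), (RInt_Chasles_R u a b b') by auto.
  assert (H1 := RInt_nonneg_dominated D u a' a H Ha).
  assert (H2 := RInt_nonneg_dominated D u b b' H Hb).
  rewrite etail_opp; unfold etail.
  assert (D * (atan a - atan a') <= D * (PI / 2 + atan a))
    by (apply Rmult_le_compat_l; [auto|generalize (atan_bound a'); lra]).
  assert (D * (atan b' - atan b) <= D * (PI / 2 - atan b))
    by (apply Rmult_le_compat_l; [auto|generalize (atan_bound b'); lra]).
  lra.
Qed.

Lemma is_lim_seq_etail D : is_lim_seq (fun n => etail D (INR n)) 0.
Proof.
  replace (Finite 0) with (Rbar_mult D 0) by (simpl; f_equal; ring).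
  apply is_lim_seq_scal_l, is_lim_seq_atan_tail.
Qed.

Lemma etail_small D eps : 0 < eps -> exists M, 0 < M /\ forall x, M <= x -> etail D x < eps.
Proof.
  intros He; exists (Rabs D / eps + 1).
  assert (H0 : 0 <= Rabs D / eps)
    by (apply Rmult_le_pos; [apply Rabs_pos|left; apply Rinv_0_lt_compat, He]).
  split; [lra|]; intros x Hx.
  assert (Hx0 : 0 < x) by lra; destruct (atan_tail x Hx0) as [H1 H2].
  apply Rle_lt_trans with (Rabs D * / x).
  - unfold etail; apply Rle_trans with (Rabs D * (PI / 2 - atan x)).
    + apply Rmult_le_compat_r; [auto|apply Rle_abs].
    + apply Rmult_le_compat_l; [apply Rabs_pos|auto].
  - apply (Rmult_lt_reg_r x); [auto|]; rewrite Rmult_assoc, Rinv_l, Rmult_1_r by lra.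
    apply (Rmult_lt_reg_r (/ eps)); [apply Rinv_0_lt_compat, He|].
    replace (eps * x * / eps) with x by (field; lra); unfold Rdiv in *; lra.
Qed.

Lemma dominated_full D u : dominated D u ->
  exists Z : R, is_lim_seq (fun n => RInt u (- INR n) (INR n)) Z /\
    forall a b, a <= b -> Rabs (RInt u a b - Z) <= etail D (- a) + etail D b.
Proof.
  intros H.
  apply (net_limit (RInt u) Rle (fun a => etail D (- a)) (etail D)
    (fun n => - INR n) INR).
  - intros n; generalize (pos_INR n); lra.
  - apply (is_lim_seq_ext (fun n => etail D (INR n) + etail D (INR n))).
    { intros n; now rewrite Ropp_involutive. }
    replace (Finite 0) with (Finite (0 + 0)) by (f_equal; ring).
    apply is_lim_seq_plus'; apply is_lim_seq_etail.
  - intros a b Hab; destruct (eventually_INR_ge (- a)) as [N1 H1].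
    destruct (eventually_INR_ge b) as [N2 H2].
    exists (max N1 N2); intros n Hn; specialize (H1 n ltac:(lia)); specialize (H2 n ltac:(lia)).
    assert (He := RInt_enlarge D u a b (- INR n) (INR n) H ltac:(lra) Hab H2).
    apply Rabs_le; lra.
Qed.

Lemma dominated_lower D u x : dominated D u ->
  exists I : R, forall a, a <= x -> Rabs (RInt u a x - I) <= etail D (- a).
Proof.
  intros H.
  assert (HD := dominated_ge0 _ _ H).
  assert (Hex : forall x y, ex_RInt u x y) by (intros; apply ex_RInt_cont, H).
  (* Only the left end moves, so the second index and its error are dummies; the term |x| keeps
     every truncation point below [x]. *)
  destruct (net_limit (fun a _ => RInt u a x) (fun a _ => a <= x) (fun a => etail D (- a))
    (fun _ => 0) (fun n => - (Rabs x + INR n)) (fun _ => 0)) as [I [_ HI]].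
  - intros n; generalize (pos_INR n) (Rle_abs (- x)); rewrite Rabs_Ropp; lra.
  - apply is_lim_seq_eps; intros eps He.
    destruct (etail_small D eps He) as [M [_ HM]].
    destruct (eventually_INR_ge M) as [N HN]; exists N; intros n Hn.
    specialize (HN n Hn); rewrite Ropp_involutive, Rplus_0_r, Rminus_0_r.
    rewrite Rabs_pos_eq by now apply etail_ge0.
    apply HM; generalize (Rabs_pos x); lra.
  - intros a _ Ha; destruct (eventually_INR_ge (- a)) as [N HN]; exists N; intros n Hn.
    specialize (HN n Hn); assert (Hn' : - (Rabs x + INR n) <= a)
      by (generalize (Rabs_pos x); lra).
    rewrite (RInt_Chasles_R u (- (Rabs x + INR n)) a x), Rplus_0_r by auto.
    assert (H1 := RInt_nonneg_dominated D u _ a H Hn').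
    assert (D * (atan a - atan (- (Rabs x + INR n))) <= etail D (- a)).
    { rewrite etail_opp; apply Rmult_le_compat_l; [auto|].
      generalize (atan_bound (- (Rabs x + INR n))); lra. }
    apply Rabs_le; lra.
  - exists I; intros a Ha; specialize (HI a 0 Ha); lra.
Qed.

Lemma ImpIntFull_dominated D u Z : dominated D u ->
  (forall a b, a <= b -> Rabs (RInt u a b - Z) <= etail D (- a) + etail D b) ->
  ImpIntFull u Z.
Proof.
  intros H HZ; split.
  - intros a b _; exists (RInt u a b); apply IsRInt_RInt; split; auto.
    apply ex_RInt_cont, H.
  - intros eps He; destruct (etail_small D (eps / 2)) as [M [HM0 HM]]; [lra|].
    exists M; intros a b v' Ha Hb Hv; apply IsRInt_RInt in Hv; destruct Hv as [_ <-].
    eapply Rle_lt_trans; [apply HZ; lra|].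
    generalize (HM (- a) ltac:(lra)) (HM b Hb); lra.
Qed.

Lemma ImpIntLower_dominated D u x I : dominated D u ->
  (forall a, a <= x -> Rabs (RInt u a x - I) <= etail D (- a)) -> ImpIntLower u x I.
Proof.
  intros H HI; split.
  - intros a _; exists (RInt u a x); apply IsRInt_RInt; split; auto.
    apply ex_RInt_cont, H.
  - intros eps He; destruct (etail_small D eps) as [M [HM0 HM]]; [lra|].
    exists (- Rabs x - M); intros a v' Ha Hv; apply IsRInt_RInt in Hv; destruct Hv as [_ <-].
    generalize (Rle_abs (- x)) (Rabs_pos x); rewrite Rabs_Ropp; intros.
    eapply Rle_lt_trans; [apply HI; lra|]; apply HM; lra.
Qed.

Lemma RInt_R_scal (u : R -> R) c a b : ex_RInt u a b ->
  RInt (fun x => c * u x) a b = c * RInt u a b.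
Proof. intros H; apply (RInt_scal u a b c H). Qed.

(* Completing the square reduces the transform to a translate of a centred Gaussian integral;
   the translation moves the end points only, so the limit is unaffected. *)
Lemma gaussian_transform v : 0 < v -> exists G, 0 < G /\ forall A,
  is_lim_seq (fun m => RInt (fun y => exp (y * A - v * y ^ 2 / 2)) (- INR m) (INR m))
    (G * exp (A ^ 2 / (2 * v))).
Proof.
  (* With e^t >= 1 + t at t = v x^2 / 2, the choice D = 1 + 2/v gives D e^t >= 1 + x^2. *)
  intros Hv; set (u := fun y => exp (- (v * y ^ 2 / 2))); set (D := 1 + 2 / v).
  assert (HD : 0 < 2 / v) by (apply Rdiv_lt_0_compat; lra).
  assert (Hdom : dominated D u).
  { split.
    - intros x; apply (ex_derive_continuous (V := R_NormedModule)); unfold u; auto_derive; auto.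
    - intros x; unfold u; split; [left; apply exp_pos|].
      rewrite exp_Ropp; generalize (pow2_ge_0 x) (exp_ineq1_le (v * x ^ 2 / 2)); intros Hx He.
      assert (0 <= v * x ^ 2) by nra.
      apply (Rmult_le_reg_r (exp (v * x ^ 2 / 2) * (1 + x ^ 2))).
      { apply Rmult_lt_0_compat; [apply exp_pos|lra]. }
      replace (/ exp (v * x ^ 2 / 2) * (exp (v * x ^ 2 / 2) * (1 + x ^ 2))) with (1 + x ^ 2)
        by (field; apply Rgt_not_eq, exp_pos).
      replace (D / (1 + x ^ 2) * (exp (v * x ^ 2 / 2) * (1 + x ^ 2)))
        with (D * exp (v * x ^ 2 / 2)) by (field; lra).
      apply Rle_trans with (D * (1 + v * x ^ 2 / 2)); [|apply Rmult_le_compat_l; unfold D; lra].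
      unfold D; replace ((1 + 2 / v) * (1 + v * x ^ 2 / 2))
        with (1 + x ^ 2 + (v * x ^ 2 / 2 + 2 / v)) by (field; lra); lra. }
  destruct (dominated_full D u Hdom) as [G [HG HGb]].
  assert (Hex : forall x y, ex_RInt u x y) by (intros; apply ex_RInt_cont, Hdom).
  exists G; split.
  { apply Rlt_le_trans with (RInt u 0 1).
    - apply RInt_gt_0; [lra| |intros; apply Hdom]; intros; apply exp_pos.
    - apply (is_lim_seq_lb _ _ _ HG); exists 1%nat; intros n Hn; apply le_INR in Hn; simpl in Hn.
      apply (RInt_enlarge D u 0 1 (- INR n) (INR n) Hdom); lra. }
  intros A; set (c := A / v).
  apply (is_lim_seq_ext (fun m => RInt u (- INR m - c) (INR m - c) * exp (A ^ 2 / (2 * v)))).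
  { intros m; rewrite Rmult_comm.
    assert (Hl := RInt_comp_lin u 1 (- c) (- INR m) (INR m) (Hex _ _)).
    replace (1 * - INR m + - c) with (- INR m - c) in Hl by ring.
    replace (1 * INR m + - c) with (INR m - c) in Hl by ring.
    rewrite <- Hl, <- RInt_R_scal.
    - apply RInt_ext; intros y _; unfold scal, u; simpl; unfold mult; simpl.
      rewrite Rmult_1_l, <- exp_plus; f_equal; unfold c; field; lra.
    - apply (ex_RInt_comp_lin u 1 (- c)), Hex. }
  apply (is_lim_seq_scal_r _ _ G), is_lim_seq_eps; intros eps He.
  destruct (etail_small D (eps / 2)) as [M [HM0 HM]]; [lra|].
  destruct (eventually_INR_ge (M + Rabs c)) as [N HN]; exists N; intros n Hn; specialize (HN n Hn).
  generalize (Rle_abs c) (Rle_abs (- c)); rewrite Rabs_Ropp; intros.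
  eapply Rle_lt_trans; [apply HGb; generalize (pos_INR n); lra|].
  generalize (HM (- (- INR n - c)) ltac:(lra)) (HM (INR n - c) ltac:(lra)); lra.
Qed.

(** For v > 0 this is the Gaussian integral sqrt(2 pi / v), kept as a limit since it cancels from
    every probability. *)
Definition gauss (v : R) : R :=
  real (Lim_seq (fun m => RInt (fun y => exp (y * 0 - v * y ^ 2 / 2)) (- INR m) (INR m))).

Lemma gauss_transform v : 0 < v -> 0 < gauss v /\ forall A,
  is_lim_seq (fun m => RInt (fun y => exp (y * A - v * y ^ 2 / 2)) (- INR m) (INR m))
    (gauss v * exp (A ^ 2 / (2 * v))).
Proof.
  intros Hv; destruct (gaussian_transform v Hv) as [G [HG H]].
  replace (gauss v) with G; [auto|].
  unfold gauss; rewrite (is_lim_seq_unique _ _ (H 0)); simpl.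
  replace (0 * (0 * 1) / (2 * v)) with 0 by (field; lra); rewrite exp_0; ring.
Qed.

(** * Limits of integrals over a bounded interval *)

Lemma eventually_forall_le (P : nat -> nat -> Prop) m :
  (forall j, eventually (P j)) -> eventually (fun n => forall j, (j <= m)%nat -> P j n).
Proof.
  intros H; induction m as [|m [N HN]].
  - destruct (H 0%nat) as [N HN]; exists N; intros n Hn j Hj.
    replace j with 0%nat by lia; auto.
  - destruct (H (S m)) as [N' HN']; exists (max N N'); intros n Hn j Hj.
    destruct (Nat.eq_dec j (S m)) as [->|Hj']; [apply HN'; lia|apply HN; lia].
Qed.

(** The limit inherits the Lipschitz constant. On a grid so fine that [L] times the mesh is at most
    eps/3, finitely many pointwise limits give uniform closeness. *)
Lemma uniform_of_lipschitz (u : nat -> R -> R) (v : R -> R) a b L : a < b ->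
  (forall x, is_lim_seq (fun n => u n x) (v x)) ->
  eventually (fun n => forall x y, a <= x <= b -> a <= y <= b ->
    Rabs (u n x - u n y) <= L * Rabs (x - y)) ->
  forall eps, 0 < eps -> eventually (fun n => forall x, a <= x <= b -> Rabs (u n x - v x) <= eps).
Proof.
  intros Hab Hlim HL eps He.
  assert (Hv : forall x y, a <= x <= b -> a <= y <= b -> Rabs (v x - v y) <= L * Rabs (x - y)).
  { intros x y Hx Hy; apply (is_lim_seq_ub (fun n => Rabs (u n x - u n y))).
    - apply (is_lim_seq_abs _ (Finite (v x - v y))), is_lim_seq_minus'; apply Hlim.
    - destruct HL as [N HN]; exists N; auto. }
  assert (HL0 : 0 <= L).
  { specialize (Hv a b ltac:(lra) ltac:(lra)); generalize (Rabs_pos (v a - v b)).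
    rewrite (Rabs_left (a - b)) in Hv by lra; nra. }
  (* More than [q] cells make [L] times the mesh at most eps/3. *)
  set (q := 3 * L * (b - a) / eps).
  destruct (INR_unbounded q) as [m Hm].
  assert (Hq : 0 <= q) by (unfold q; apply Rmult_le_pos;
    [nra|left; apply Rinv_0_lt_compat, He]).
  assert (Hm0 : 0 < INR m) by lra.
  set (p := fun j => a + INR j * ((b - a) / INR m)).
  destruct (eventually_forall_le (fun j n => Rabs (u n (p j) - v (p j)) <= eps / 3) m) as [N1 H1].
  { intros j; destruct (proj1 (is_lim_seq_eps _ _) (Hlim (p j)) (eps / 3)) as [N HN]; [lra|].
    exists N; intros n Hn; left; auto. }
  destruct HL as [N2 H2]; exists (max N1 N2); intros n Hn x Hx.
  set (d := (b - a) / INR m); assert (Hd : 0 < d) by (apply Rdiv_lt_0_compat; lra).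
  assert (Hmd : INR m * d = b - a) by (unfold d; field; lra).
  destruct (nfloor_ex ((x - a) / d)) as [j [Hj1 Hj2]].
  { apply Rmult_le_pos; [lra|left; apply Rinv_0_lt_compat, Hd]. }
  assert (Hj1' : INR j * d <= x - a)
    by (replace (x - a) with ((x - a) / d * d) by (field; lra); apply Rmult_le_compat_r; lra).
  assert (Hj2' : x - a < (INR j + 1) * d)
    by (replace (x - a) with ((x - a) / d * d) by (field; lra); apply Rmult_lt_compat_r; lra).
  assert (Hjm : (j <= m)%nat).
  { apply INR_le, (Rmult_le_reg_r d); lra. }
  assert (Hpj : a <= p j <= b).
  { unfold p; fold d; generalize (pos_INR j); nra. }
  assert (Hxp : Rabs (x - p j) <= d) by (unfold p; fold d; apply Rabs_le; lra).
  assert (HLd : L * d <= eps / 3).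
  { unfold d; apply (Rmult_le_reg_r (3 * INR m / eps)).
    - apply Rdiv_lt_0_compat; lra.
    - replace (eps / 3 * (3 * INR m / eps)) with (INR m) by (field; lra).
      replace (L * ((b - a) / INR m) * (3 * INR m / eps)) with q by (unfold q; field; lra); lra. }
  assert (E1 := H1 n ltac:(lia) j Hjm); assert (E2 := H2 n ltac:(lia) x (p j) Hx Hpj).
  assert (E3 := Hv x (p j) Hx Hpj).
  assert (L * Rabs (x - p j) <= L * d) by (apply Rmult_le_compat_l; auto).
  replace (u n x - v x) with ((u n x - u n (p j)) + (u n (p j) - v (p j)) - (v x - v (p j))) by ring.
  apply Rabs_le_between in E1; apply Rabs_le; 
  assert (E2' : Rabs (u n x - u n (p j)) <= eps / 3) by lra;
  assert (E3' : Rabs (v x - v (p j)) <= eps / 3) by lra;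
  apply Rabs_le_between in E2'; apply Rabs_le_between in E3'; lra.
Qed.

(** A common Lipschitz constant upgrades pointwise to uniform convergence on [a, b]; the mass
    outside bounded intervals is left to the common majorant. *)
Lemma RInt_lim_lipschitz (u : nat -> R -> R) (v : R -> R) a b L : a <= b ->
  (forall n x, continuous (u n) x) -> (forall x, continuous v x) ->
  (forall x, is_lim_seq (fun n => u n x) (v x)) ->
  eventually (fun n => forall x y, a <= x <= b -> a <= y <= b ->
    Rabs (u n x - u n y) <= L * Rabs (x - y)) ->
  is_lim_seq (fun n => RInt (u n) a b) (RInt v a b).
Proof.
  intros [Hab| <-] Hu Hv Hlim HL.
  2:{ apply (is_lim_seq_ext (fun _ => RInt v a a)); [|apply is_lim_seq_const].
      intros n; now rewrite !RInt_point. }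
  apply is_lim_seq_le_eps; intros eps He.
  assert (He' : 0 < eps / (b - a)) by (apply Rdiv_lt_0_compat; lra).
  destruct (uniform_of_lipschitz u v a b L Hab Hlim HL _ He') as [N HN].
  exists N; intros n Hn; specialize (HN n Hn).
  assert (Hex : forall w : R -> R, (forall x, continuous w x) -> ex_RInt w a b)
    by (intros; apply ex_RInt_cont; auto).
  assert (Hm := RInt_minus (u n) v a b (Hex _ (Hu n)) (Hex _ Hv)).
  unfold minus, plus, opp in Hm; simpl in Hm.
  unfold Rminus; rewrite <- Hm.
  replace eps with ((b - a) * (eps / (b - a))) by (field; lra).
  apply abs_RInt_le_const; [lra| |intros; now apply HN].
  apply (ex_RInt_minus (V := R_NormedModule) (u n) v); auto.
Qed.

(** * The Hubbard-Stratonovich coupling *)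

Definition fN (n : nat) (b : nat -> R) (y : R) : R := sumR (seq 0 n) (fun i => h (b i * y)).

Definition sumsq (n : nat) (b : nat -> R) : R := sumR (seq 0 n) (fun i => b i ^ 2).

Definition wtcw (n : nat) (b : nat -> R) (s : list bool) : R :=
  exp (lin n b s ^ 2 / (2 * sumsq n b)).

(* Unnormalized joint density of the spins and the auxiliary Gaussian variable. *)
Definition rho (n : nat) (b : nat -> R) (s : list bool) (y : R) : R :=
  / 2 ^ n * exp (y * lin n b s - sumsq n b * y ^ 2 / 2).

Lemma rho_gt0 n b s y : 0 < rho n b s y.
Proof.
  apply Rmult_lt_0_compat; [apply Rinv_0_lt_compat, pow_lt; lra|apply exp_pos].
Qed.

Lemma prod_cosh n b y :
  / 2 ^ n * prodR (seq 0 n) (fun i => 2 * cosh (b i * y)) =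
  exp (- fN n b y + sumsq n b * y ^ 2 / 2).
Proof.
  rewrite prodR_mult.
  replace (prodR (seq 0 n) (fun _ => 2)) with (2 ^ n).
  2:{ generalize 0%nat; induction n as [|n IH]; intros k; simpl; [auto|].
      unfold prodR in IH; now rewrite (IH (S k)). }
  rewrite (prodR_ext_in _ (fun i => cosh (b i * y)) (fun i => exp (ln (cosh (b i * y)))))
    by (intros; now rewrite exp_ln by apply cosh_gt0).
  rewrite prodR_exp, <- Rmult_assoc, Rinv_l, Rmult_1_l by (apply pow_nonzero; lra).
  f_equal; unfold fN, sumsq, h; rewrite sumR_minus.
  rewrite (sumR_ext _ (fun i => / 2 * (b i * y) ^ 2) (fun i => y ^ 2 / 2 * b i ^ 2))
    by (intros; field).
  rewrite sumR_scal; field.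
Qed.

Lemma rho_split n b s y :
  rho n b s y = exp (- (sumsq n b * y ^ 2 / 2)) * / 2 ^ n * exp (y * lin n b s).
Proof. unfold rho, Rminus; rewrite exp_plus; ring. Qed.

(** Each spin contributes cosh(b y) exp(- b^2 y^2 / 2) = exp(- h(b y)); the factor [/ 2 ^ n] in
    [rho] removes the 2 of [2 * cosh]. *)
Lemma rho_sum n b y : sumR (bconfigs n) (fun s => rho n b s y) = exp (- fN n b y).
Proof.
  rewrite (sumR_ext _ _ _ (fun s => rho_split n b s y)), sumR_scal, partition_fun.
  rewrite Rmult_assoc, prod_cosh, <- exp_plus; f_equal; ring.
Qed.

Lemma rho_second_moment n b c d y :
  sumR (bconfigs n) (fun s => (d + lin n c s) ^ 2 * rho n b s y) = exp (- fN n b y) *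
  ((d + sumR (seq 0 n) (fun i => c i * tanh (b i * y))) ^ 2
   + sumR (seq 0 n) (fun i => c i ^ 2 * (1 - tanh (b i * y) ^ 2))).
Proof.
  rewrite (sumR_ext _ _ (fun s => exp (- (sumsq n b * y ^ 2 / 2)) * / 2 ^ n *
    ((d + lin n c s) ^ 2 * exp (y * lin n b s)))) by (intros; rewrite rho_split; ring).
  rewrite sumR_scal, second_moment, <- Rmult_assoc; f_equal.
  rewrite Rmult_assoc, prod_cosh, <- exp_plus; f_equal; ring.
Qed.

Lemma continuous_exp_comp (u : R -> R) x : continuous u x -> continuous (fun y => exp (u y)) x.
Proof. intros H; apply (continuous_comp u exp); [exact H|apply continuous_exp]. Qed.

Lemma continuous_opp_R (u : R -> R) x : continuous u x -> continuous (fun y => - u y) x.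
Proof. apply (continuous_opp (V := R_NormedModule)). Qed.

Lemma continuous_sumR {A} (l : list A) (u : A -> R -> R) x :
  (forall a, continuous (u a) x) -> continuous (fun y => sumR l (fun a => u a y)) x.
Proof.
  intros H; induction l as [|a l IH]; simpl; [apply continuous_const|].
  apply (continuous_plus (V := R_NormedModule) (u a)); auto.
Qed.

Lemma continuous_rho n b s x : continuous (rho n b s) x.
Proof.
  apply (ex_derive_continuous (V := R_NormedModule)); unfold rho; auto_derive; auto.
Qed.

Lemma continuous_rho_sum n b (phi : list bool -> R) x :
  continuous (fun y => sumR (bconfigs n) (fun s => phi s * rho n b s y)) x.
Proof.
  apply continuous_sumR; intros s.
  apply (continuous_scal_r (V := R_NormedModule) (phi s) (rho n b s)), continuous_rho.
Qed.

Lemma continuous_fN n b x : continuous (fN n b) x.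
Proof.
  apply continuous_sumR; intros i.
  apply (continuous_comp (fun y => b i * y) h); [|apply continuous_h].
  apply (continuous_scal_r (V := R_NormedModule) (b i) (fun y => y)), continuous_id.
Qed.

(** Factor between the spin marginal of [rho] and [wtcw]; being free of the spins, it cancels in
    probabilities. *)
Definition kappa (n : nat) (b : nat -> R) : R := / 2 ^ n * gauss (sumsq n b).

Lemma kappa_gt0 n b : 0 < sumsq n b -> 0 < kappa n b.
Proof.
  intros H; apply Rmult_lt_0_compat; [apply Rinv_0_lt_compat, pow_lt; lra|].
  apply (gauss_transform _ H).
Qed.

Lemma hubbard_stratonovich n b (phi : list bool -> R) : 0 < sumsq n b ->
  is_lim_seq (fun m => RInt (fun y => sumR (bconfigs n) (fun s => phi s * rho n b s y))
      (- INR m) (INR m))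
    (kappa n b * sumR (bconfigs n) (fun s => phi s * wtcw n b s)).
Proof.
  intros Hv; destruct (gauss_transform _ Hv) as [_ HG].
  (* The claim is additive over configurations, so it is proved for an arbitrary list, one Gaussian
     transform at a time. *)
  generalize (bconfigs n); intros l; induction l as [|s l IH].
  - simpl; rewrite Rmult_0_r.
    apply (is_lim_seq_ext (fun _ => 0)); [|apply is_lim_seq_const].
    intros m; rewrite RInt_const; unfold scal; simpl; unfold mult; simpl; ring.
  - apply (is_lim_seq_ext (fun m =>
      phi s * / 2 ^ n * RInt (fun y => exp (y * lin n b s - sumsq n b * y ^ 2 / 2))
        (- INR m) (INR m)
      + RInt (fun y => sumR l (fun s => phi s * rho n b s y)) (- INR m) (INR m))).
    + intros m.
      assert (He : ex_RInt (fun y => exp (y * lin n b s - sumsq n b * y ^ 2 / 2))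
        (- INR m) (INR m)).
      { apply ex_RInt_cont; intros x; apply (ex_derive_continuous (V := R_NormedModule)).
        auto_derive; auto. }
      rewrite <- RInt_R_scal by exact He.
      rewrite <- (RInt_plus (V := R_CompleteNormedModule)).
      * apply RInt_ext; intros y _; simpl; unfold plus, rho; simpl; ring.
      * apply (ex_RInt_scal (V := R_NormedModule) _ _ _ (phi s * / 2 ^ n)), He.
      * apply ex_RInt_cont; intros x; apply continuous_sumR; intros a.
        apply (continuous_scal_r (V := R_NormedModule) (phi a) (rho n b a)), continuous_rho.
    + replace (kappa n b * sumR (s :: l) (fun s0 => phi s0 * wtcw n b s0)) with
        (phi s * / 2 ^ n * (gauss (sumsq n b) * exp (lin n b s ^ 2 / (2 * sumsq n b)))
         + kappa n b * sumR l (fun s0 => phi s0 * wtcw n b s0))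
        by (simpl; unfold kappa, wtcw; simpl; ring).
      apply is_lim_seq_plus'; [|exact IH].
      apply (is_lim_seq_scal_l _ (phi s * / 2 ^ n) (Finite _)), HG.
Qed.

(** Transfers a bound at fixed y to the Curie-Weiss measure: the Cauchy majorant integrates to
    [E * PI]. *)
Lemma expect_le n b (phi : list bool -> R) E : 0 < sumsq n b -> 0 <= E ->
  (forall y, sumR (bconfigs n) (fun s => phi s * rho n b s y) <= E / (1 + y ^ 2)) ->
  kappa n b * sumR (bconfigs n) (fun s => phi s * wtcw n b s) <= E * PI.
Proof.
  intros Hv HE H; apply (is_lim_seq_ub _ _ _ (hubbard_stratonovich n b phi Hv)).
  exists 0%nat; intros m _; assert (Hm := pos_INR m).
  apply Rle_trans with (RInt (fun y => E / (1 + y ^ 2)) (- INR m) (INR m)).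
  - apply RInt_le; [lra| | |auto].
    + apply ex_RInt_cont; intros; apply continuous_rho_sum.
    + eexists; apply is_RInt_cauchy.
  - rewrite (is_RInt_unique _ _ _ _ (is_RInt_cauchy _ _ _)).
    rewrite <- Rmult_minus_distr_l; apply Rmult_le_compat_l; [auto|].
    generalize (atan_bound (INR m)) (atan_bound (- INR m)); lra.
Qed.

(** * Asymptotics of the mixing density *)

(** The properties of the scaled weights from which the limit law follows in both cases.
    [regime_sum] puts the conditional mean of S_N near K y, [regime_fourth] yields equicontinuity
    and the bias bound, [regime_scale] kills the conditional fluctuations, and [regime_pos] with the
    convexity of [h] yields domination. *)
Record regime (b : nat -> nat -> R) (K : nat -> R) (f : R -> R) (B : R) : Prop := {
  regime_K : forall N, 0 < K N;
  regime_b : forall N i, (i < N)%nat -> 0 < b N i;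
  regime_sum : forall N, (0 < N)%nat -> sumR (seq 0 N) (b N) = K N;
  regime_B : 0 <= B;
  regime_fourth : eventually (fun N => sumR (seq 0 N) (fun i => b N i ^ 4) <= B);
  regime_scale : is_lim_seq (fun N => INR N / K N ^ 2) 0;
  regime_lim : forall y, is_lim_seq (fun N => fN N (b N) y) (f y);
  regime_pos : 0 < f 1 }.

Lemma fN_ge0 n b y : 0 <= fN n b y.
Proof. apply sumR_ge0_in; intros; apply h_ge0. Qed.

Lemma fN_abs n b y : fN n b (Rabs y) = fN n b y.
Proof.
  apply sumR_ext; intros i; rewrite <- h_abs, <- (h_abs (b i * y)), !Rabs_mult, Rabs_Rabsolu.
  reflexivity.
Qed.

Lemma fN_superlinear n b y : (forall i, (i < n)%nat -> 0 < b i) -> 1 <= Rabs y ->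
  Rabs y * fN n b 1 <= fN n b y.
Proof.
  intros Hb Hy; rewrite <- (fN_abs n b y); unfold fN; rewrite <- sumR_scal.
  apply sumR_seq_le; intros i Hi; rewrite Rmult_1_r; apply h_superlinear; auto.
  left; auto.
Qed.

(** The derivative of [h] contributes |b_i M|^3 and the increment |b_i|, hence the fourth powers. *)
Lemma fN_lipschitz n b M x y : Rabs x <= M -> Rabs y <= M ->
  Rabs (fN n b x - fN n b y) <= M ^ 3 * sumR (seq 0 n) (fun i => b i ^ 4) * Rabs (x - y).
Proof.
  intros Hx Hy; unfold fN; rewrite <- sumR_minus.
  eapply Rle_trans; [apply sumR_abs|].
  rewrite Rmult_comm, <- Rmult_assoc, <- sumR_scal; apply sumR_le; intros i.
  apply Rle_trans with ((Rabs (b i) * M) ^ 3 * Rabs (b i * x - b i * y)).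
  - apply h_lipschitz; rewrite Rabs_mult; apply Rmult_le_compat_l; auto using Rabs_pos.
  - replace (b i * x - b i * y) with (b i * (x - y)) by ring; rewrite Rabs_mult.
    right; replace (b i ^ 4) with (Rabs (b i) ^ 4).
    + ring.
    + replace (b i ^ 4) with ((b i ^ 2) ^ 2) by ring; rewrite <- (pow2_abs (b i)); ring.
Qed.

Lemma exp_opp_lipschitz x y : 0 <= x -> 0 <= y -> Rabs (exp (- x) - exp (- y)) <= Rabs (x - y).
Proof.
  assert (H : forall x y, 0 <= x <= y -> 0 <= exp (- x) - exp (- y) <= y - x).
  { clear; intros x y [Hx Hxy].
    assert (E1 : exp (- x) <= 1).
    { rewrite <- exp_0; destruct Hx as [Hx| <-]; [left; apply exp_increasing; lra|].
      rewrite Ropp_0; lra. }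
    assert (E2 := exp_ineq1_le (x - y)); assert (E3 := exp_pos (- x)).
    assert (E4 : exp (- y) = exp (- x) * exp (x - y)) by (rewrite <- exp_plus; f_equal; ring).
    assert (E5 : exp (x - y) <= 1).
    { rewrite <- exp_0; destruct Hxy as [Hxy| <-]; [left; apply exp_increasing; lra|].
      rewrite Rminus_diag; lra. }
    rewrite E4; nra. }
  intros Hx Hy; destruct (Rle_dec x y) as [Hxy|Hxy].
  - rewrite (Rabs_left1 (x - y)) by lra; apply Rabs_le; generalize (H x y); lra.
  - rewrite (Rabs_pos_eq (x - y)) by lra; apply Rabs_le; generalize (H y x); lra.
Qed.

Lemma continuous_of_local_lipschitz (u : R -> R) :
  (forall M, exists L, forall x y, Rabs x <= M -> Rabs y <= M ->
    Rabs (u x - u y) <= L * Rabs (x - y)) -> forall x, continuous u x.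
Proof.
  intros H x; destruct (H (Rabs x + 1)) as [L HL].
  set (L' := Rmax L 1); assert (HL' : L <= L' /\ 1 <= L')
    by (split; [apply Rmax_l|apply Rmax_r]).
  apply filterlim_locally; intros eps.
  assert (Hd : 0 < Rmin 1 (eps / L')).
  { apply Rmin_case; [lra|apply Rdiv_lt_0_compat; [apply cond_pos|lra]]. }
  exists (mkposreal _ Hd); intros y Hy.
  unfold ball in *; simpl in *; unfold AbsRing_ball, abs, minus, plus, opp in *; simpl in *.
  assert (H1 : Rabs (y + - x) < 1) by (eapply Rlt_le_trans; [exact Hy|apply Rmin_l]).
  assert (H2 : Rabs (y + - x) < eps / L') by (eapply Rlt_le_trans; [exact Hy|apply Rmin_r]).
  apply Rle_lt_trans with (L' * Rabs (y - x)).
  - eapply Rle_trans; [apply HL|].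
    + replace y with ((y + - x) + x) by ring; eapply Rle_trans; [apply Rabs_triang|]; lra.
    + generalize (Rabs_pos x); lra.
    + apply Rmult_le_compat_r; [apply Rabs_pos|lra].
  - apply (Rmult_lt_reg_r (/ L')); [apply Rinv_0_lt_compat; lra|].
    replace (L' * Rabs (y - x) * / L') with (Rabs (y - x)) by (field; lra); exact H2.
Qed.

Section Regime.
Context {b : nat -> nat -> R} {K : nat -> R} {f : R -> R} {B : R} (HR : regime b K f B).

Lemma regime_lipschitz : eventually (fun N => forall M x y, Rabs x <= M -> Rabs y <= M ->
  Rabs (fN N (b N) x - fN N (b N) y) <= M ^ 3 * B * Rabs (x - y)).
Proof.
  destruct (regime_fourth _ _ _ _ HR) as [N HN]; exists N; intros n Hn M x y Hx Hy.
  eapply Rle_trans; [apply (fN_lipschitz n (b n) M x y Hx Hy)|].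
  apply Rmult_le_compat_r, Rmult_le_compat_l; auto using Rabs_pos.
  apply pow_le; eapply Rle_trans; [apply Rabs_pos|exact Hx].
Qed.

Lemma limit_lipschitz M x y : Rabs x <= M -> Rabs y <= M ->
  Rabs (f x - f y) <= M ^ 3 * B * Rabs (x - y).
Proof.
  intros Hx Hy; apply (is_lim_seq_ub (fun N => Rabs (fN N (b N) x - fN N (b N) y))).
  - apply (is_lim_seq_abs _ (Finite (f x - f y))), is_lim_seq_minus'; apply HR.
  - destruct regime_lipschitz as [N HN]; exists N; auto.
Qed.

Lemma limit_continuous x : continuous f x.
Proof.
  apply continuous_of_local_lipschitz; intros M; exists (M ^ 3 * B).
  intros y z; apply limit_lipschitz.
Qed.

Lemma limit_ge0 x : 0 <= f x.
Proof.
  apply (is_lim_seq_lb _ _ _ (regime_lim _ _ _ _ HR x)); exists 0%nat; intros; apply fN_ge0.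
Qed.

Lemma is_lim_seq_exp_fN y : is_lim_seq (fun N => exp (- fN N (b N) y)) (exp (- f y)).
Proof.
  apply (is_lim_seq_continuous exp).
  - apply derivable_continuous_pt, derivable_pt_exp.
  - apply (is_lim_seq_opp _ (Finite (f y))), HR.
Qed.

(** With a = |y|, (1 + y^4)(1 + y^2) <= (1 + a)^6, while e^(c a) is the sixth power of e^(c a / 6)
    >= 1 + c a / 6 >= m (1 + a). The shift by 1 makes the linear minorant nonpositive for |y| <= 1,
    where superlinearity gives nothing. *)
Lemma exp_linear_dominates_cubic c : 0 < c -> exists D, forall y z, c * (Rabs y - 1) <= z ->
  (1 + y ^ 4) * exp (- z) <= D / (1 + y ^ 2).
Proof.
  intros Hc; set (m := Rmin 1 (c / 6)).
  assert (Hm : 0 < m <= 1 /\ m <= c / 6)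
    by (unfold m, Rmin; destruct (Rle_dec 1 (c / 6)); lra).
  exists (exp c / m ^ 6); intros y z Hz.
  assert (Hm6 : 0 < m ^ 6) by (apply pow_lt; lra).
  set (a := Rabs y) in *; assert (Ha : 0 <= a) by apply Rabs_pos.
  assert (Ha2 : y ^ 2 = a ^ 2) by (unfold a; now rewrite pow2_abs).
  replace (y ^ 4) with (a ^ 4) by (replace (y ^ 4) with ((y ^ 2) ^ 2) by ring; rewrite Ha2; ring).
  rewrite Ha2.
  assert (H1 : (m * (1 + a)) ^ 6 <= exp (c * a)).
  { replace (exp (c * a)) with (exp (c / 6 * a) ^ 6).
    - apply pow_incr; split; [nra|].
      eapply Rle_trans; [|apply exp_ineq1_le]; nra.
    - set (t := c / 6 * a); replace (c * a) with (t + (t + (t + (t + (t + t)))))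
        by (unfold t; field).
      rewrite !exp_plus; ring. }
  assert (H2 : exp (- z) <= exp (c - c * a)).
  { destruct (Req_dec (- z) (c - c * a)) as [->|]; [lra|left; apply exp_increasing; lra]. }
  assert (H3 : (1 + a ^ 4) * (1 + a ^ 2) <= (1 + a) ^ 6).
  { assert (0 <= a ^ 3 /\ 0 <= a ^ 5 /\ 0 <= a ^ 2 /\ 0 <= a ^ 4)
      by (repeat split; apply pow_le; auto); nra. }
  apply (Rmult_le_reg_r (1 + a ^ 2)); [generalize (pow2_ge_0 a); lra|].
  replace (exp c / m ^ 6 / (1 + a ^ 2) * (1 + a ^ 2)) with (exp c / m ^ 6)
    by (field; split; [lra|generalize (pow2_ge_0 a); lra]).
  replace ((1 + a ^ 4) * exp (- z) * (1 + a ^ 2)) with ((1 + a ^ 4) * (1 + a ^ 2) * exp (- z))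
    by ring.
  apply Rle_trans with ((1 + a) ^ 6 * exp (c - c * a)).
  { apply Rmult_le_compat; [|left; apply exp_pos|exact H3|exact H2].
    apply Rmult_le_pos; generalize (pow2_ge_0 a) (pow_le a 4 Ha); lra. }
  unfold Rminus; rewrite exp_plus, exp_Ropp.
  rewrite Rpow_mult_distr in H1.
  apply (Rmult_le_reg_r (m ^ 6 * exp (c * a))).
  { apply Rmult_lt_0_compat; [lra|apply exp_pos]. }
  replace ((1 + a) ^ 6 * (exp c * / exp (c * a)) * (m ^ 6 * exp (c * a)))
    with (exp c * (m ^ 6 * (1 + a) ^ 6)) by (field; apply Rgt_not_eq, exp_pos).
  replace (exp c / m ^ 6 * (m ^ 6 * exp (c * a))) with (exp c * exp (c * a)) by (field; lra).
  apply Rmult_le_compat_l; [left; apply exp_pos|exact H1].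
Qed.

(** Eventually fN(1) >= f(1)/2 = c, so superlinearity gives fN(y) >= c |y| for |y| >= 1. The extra
    factor 1 + y^4 is there to absorb the error of [spin_concentration]. *)
Lemma regime_domination : exists D,
  eventually (fun N => forall y, (1 + y ^ 4) * exp (- fN N (b N) y) <= D / (1 + y ^ 2)).
Proof.
  set (c := f 1 / 2); assert (Hf := regime_pos _ _ _ _ HR); assert (Hc : 0 < c)
    by (unfold c; lra).
  destruct (exp_linear_dominates_cubic c Hc) as [D HD]; exists D.
  destruct (proj1 (is_lim_seq_eps _ _) (regime_lim _ _ _ _ HR 1) c Hc) as [N HN].
  exists N; intros n Hn y; apply HD; specialize (HN n Hn); apply Rabs_def2 in HN.
  destruct (Rle_dec 1 (Rabs y)) as [Hy|Hy].
  - apply Rle_trans with (Rabs y * fN n (b n) 1).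
    + assert (c <= fN n (b n) 1) by (unfold c in *; lra); nra.
    + apply fN_superlinear; auto; apply HR.
  - apply Rle_trans with 0; [nra|apply fN_ge0].
Qed.
End Regime.

(** * Limit law of the Curie-Weiss model *)

Definition below (N : nat) (K x : R) (s : list bool) : R :=
  if Rle_dec (SN N s / K) x then 1 else 0.

Lemma SN_div N K s : SN N s / K = lin N (fun _ => / K) s.
Proof. unfold lin; rewrite sumR_scal; unfold SN, Rdiv; ring. Qed.

Lemma below_bounds N K x s : 0 <= below N K x s <= 1.
Proof. unfold below; destruct (Rle_dec _ _); lra. Qed.

Lemma sq_div_ge1 e t : 0 < e -> e <= Rabs t -> 1 <= t ^ 2 / e ^ 2.
Proof.
  intros He Ht; rewrite <- (pow2_abs t).
  apply (Rmult_le_reg_r (e ^ 2)); [apply pow_lt; auto|].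
  replace (Rabs t ^ 2 / e ^ 2 * e ^ 2) with (Rabs t ^ 2) by (field; lra); nra.
Qed.

(** Stated configuration by configuration, so that averaging with [rho] at fixed y turns it into
    Chebyshev's inequality around y. *)
Lemma below_le_chebyshev N K x e y s : 0 < e -> x + e <= y ->
  below N K x s <= (SN N s / K - y) ^ 2 / e ^ 2.
Proof.
  intros He Hy; unfold below; destruct (Rle_dec _ _) as [Hs|Hs].
  - apply sq_div_ge1; [auto|]; rewrite Rabs_left1; lra.
  - apply Rmult_le_pos; [apply pow2_ge_0|left; apply Rinv_0_lt_compat, pow_lt; auto].
Qed.

Lemma below_ge_chebyshev N K x e y s : 0 < e -> y <= x - e ->
  1 - (SN N s / K - y) ^ 2 / e ^ 2 <= below N K x s.
Proof.
  intros He Hy; unfold below; destruct (Rle_dec _ _) as [Hs|Hs].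
  - assert (0 <= (SN N s / K - y) ^ 2 / e ^ 2); [|lra].
    apply Rmult_le_pos; [apply pow2_ge_0|left; apply Rinv_0_lt_compat, pow_lt; auto].
  - assert (1 <= (SN N s / K - y) ^ 2 / e ^ 2); [|lra].
    apply sq_div_ge1; [auto|]; rewrite Rabs_pos_eq; lra.
Qed.

Section Regime.
Context {b : nat -> nat -> R} {K : nat -> R} {f : R -> R} {B : R} (HR : regime b K f B).

Lemma regime_sumsq N : (0 < N)%nat -> 0 < sumsq N (b N).
Proof.
  intros HN; apply sumR_seq_gt0; auto; intros; apply pow_lt; apply HR; auto.
Qed.

(** Squared bias plus variance of S_N/K given y. The bias is at most [sumsq] times y^2/K, and the
    square of [sumsq] is at most N B, so it contributes B y^4 N/K^2; the variance is at most
    N/K^2. *)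
Lemma spin_concentration : eventually (fun N => forall y,
  sumR (bconfigs N) (fun s => (SN N s / K N - y) ^ 2 * rho N (b N) s y) <=
  (B + 1) * (INR N / K N ^ 2) * ((1 + y ^ 4) * exp (- fN N (b N) y))).
Proof.
  destruct (regime_fourth _ _ _ _ HR) as [N1 H1]; exists (max N1 1); intros N HN y.
  assert (HB := H1 N ltac:(lia)); assert (HK := regime_K _ _ _ _ HR N).
  assert (HB0 := regime_B _ _ _ _ HR).
  assert (Hs := regime_sum _ _ _ _ HR N ltac:(lia)).
  rewrite (sumR_ext _ _ (fun s => (- y + lin N (fun _ => / K N) s) ^ 2 * rho N (b N) s y))
    by (intros; rewrite SN_div; ring).
  rewrite rho_second_moment, (Rmult_comm (exp _)), <- Rmult_assoc.
  apply Rmult_le_compat_r; [left; apply exp_pos|].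
  rewrite sumR_scal.
  set (E := sumR (seq 0 N) (fun i => tanh (b N i * y))).
  assert (HE : Rabs (E - K N * y) <= sumsq N (b N) * y ^ 2).
  { unfold E; rewrite <- Hs, Rmult_comm, <- sumR_scal, <- sumR_minus.
    eapply Rle_trans; [apply sumR_abs|].
    unfold sumsq; rewrite (Rmult_comm (sumR _ _)), <- sumR_scal; apply sumR_le; intros i.
    rewrite (Rmult_comm y); eapply Rle_trans; [apply dh_abs_le_quadratic|right; ring]. }
  assert (HV : sumR (seq 0 N) (fun i => (/ K N) ^ 2 * (1 - tanh (b N i * y) ^ 2))
    <= INR N / K N ^ 2).
  { rewrite sumR_scal; apply Rle_trans with ((/ K N) ^ 2 * INR N);
      [|right; field; lra].
    apply Rmult_le_compat_l; [apply pow2_ge_0|].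
    replace (INR N) with (INR N * 1) by ring; rewrite <- sumR_seq_const.
    apply sumR_le; intros i; generalize (tanh_sqr_lt1 (b N i * y)); lra. }
  assert (Hq : sumsq N (b N) ^ 2 <= INR N * B).
  { unfold sumsq; eapply Rle_trans; [apply sumR_sqr_le|]; rewrite length_seq.
    apply Rmult_le_compat_l; [apply pos_INR|].
    erewrite sumR_ext; [exact HB|]; intros; simpl; ring. }
  assert (HM : (- y + / K N * E) ^ 2 <= INR N / K N ^ 2 * (B * y ^ 4)).
  { replace (- y + / K N * E) with (/ K N * (E - K N * y)) by (field; lra).
    rewrite Rpow_mult_distr, <- (pow2_abs (E - K N * y)).
    apply Rle_trans with ((/ K N) ^ 2 * (INR N * B * y ^ 4)); [|right; field; lra].
    apply Rmult_le_compat_l; [apply pow2_ge_0|].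
    apply Rle_trans with ((sumsq N (b N) * y ^ 2) ^ 2).
    - apply pow_incr; split; [apply Rabs_pos|exact HE].
    - replace ((sumsq N (b N) * y ^ 2) ^ 2) with (sumsq N (b N) ^ 2 * y ^ 4) by ring.
      apply Rmult_le_compat_r; [|exact Hq].
      replace (y ^ 4) with ((y ^ 2) ^ 2) by ring; apply pow2_ge_0. }
  assert (H0 : 0 <= INR N / K N ^ 2)
    by (apply Rmult_le_pos; [apply pos_INR|left; apply Rinv_0_lt_compat, pow_lt, HK]).
  assert (Hy : 0 <= y ^ 4) by (replace (y ^ 4) with ((y ^ 2) ^ 2) by ring; apply pow2_ge_0).
  set (t := INR N / K N ^ 2) in *.
  assert (0 <= t * y ^ 4 + t * B) by (apply Rplus_le_le_0_compat; apply Rmult_le_pos; auto).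
  replace ((B + 1) * t * (1 + y ^ 4)) with (t * (B * y ^ 4) + t + (t * y ^ 4 + t * B)) by ring.
  lra.
Qed.

Lemma dominated_of_cubic D u : (forall x, continuous u x) -> (forall y, 0 <= u y) ->
  (forall y, (1 + y ^ 4) * exp (- u y) <= D / (1 + y ^ 2)) ->
  dominated D (fun y => exp (- u y)).
Proof.
  intros Hc H0 H; split; [intros; now apply continuous_exp_comp, continuous_opp_R|].
  intros y; split; [left; apply exp_pos|].
  eapply Rle_trans; [|apply H].
  assert (0 <= y ^ 4) by (replace (y ^ 4) with ((y ^ 2) ^ 2) by ring; apply pow2_ge_0).
  generalize (exp_pos (- u y)); nra.
Qed.

Lemma regime_dominated : exists D,
  eventually (fun N => forall y, (1 + y ^ 4) * exp (- fN N (b N) y) <= D / (1 + y ^ 2)) /\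
  eventually (fun N => dominated D (fun y => exp (- fN N (b N) y))) /\
  dominated D (fun y => exp (- f y)).
Proof.
  destruct (regime_domination HR) as [D HD]; exists D; split; [exact HD|split].
  - destruct HD as [N HN]; exists N; intros n Hn.
    apply dominated_of_cubic; auto using continuous_fN, fN_ge0.
  - apply dominated_of_cubic; [apply (limit_continuous HR)|apply (limit_ge0 HR)|].
    intros y; apply (is_lim_seq_ub (fun N => (1 + y ^ 4) * exp (- fN N (b N) y))).
    + apply (is_lim_seq_scal_l _ (1 + y ^ 4) (Finite _)), (is_lim_seq_exp_fN HR).
    + destruct HD as [N HN]; exists N; auto.
Qed.

Lemma RInt_exp_fN_lim a c : a <= c ->
  is_lim_seq (fun N => RInt (fun y => exp (- fN N (b N) y)) a c) (RInt (fun y => exp (- f y)) a c).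
Proof.
  intros Hac; set (M := Rmax (Rabs a) (Rabs c)).
  assert (HM : forall x, a <= x <= c -> Rabs x <= M).
  { intros x Hx; generalize (Rmax_l (Rabs a) (Rabs c)) (Rmax_r (Rabs a) (Rabs c)).
    generalize (Rle_abs c) (Rle_abs (- a)); rewrite Rabs_Ropp; fold M; intros.
    apply Rabs_le; lra. }
  apply (RInt_lim_lipschitz _ _ a c (M ^ 3 * B) Hac).
  - intros; apply continuous_exp_comp, continuous_opp_R, continuous_fN.
  - intros; apply continuous_exp_comp, continuous_opp_R, (limit_continuous HR).
  - apply (is_lim_seq_exp_fN HR).
  - destruct (regime_lipschitz HR) as [N HN]; exists N; intros n Hn x y Hx Hy.
    eapply Rle_trans; [apply exp_opp_lipschitz; apply fN_ge0|].
    apply (HN n Hn); auto.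
Qed.

(** Two limits in a fixed order. For given N the Gaussian cutoff m goes to infinity, squeezing the
    partition function between an integral over [-M, M] and the same plus two tails; then N grows.
    One M serves all large N because [D] does. *)
Lemma partition_limit (Z D : R) :
  eventually (fun N => dominated D (fun y => exp (- fN N (b N) y))) ->
  (forall a c, a <= c ->
    Rabs (RInt (fun y => exp (- f y)) a c - Z) <= etail D (- a) + etail D c) ->
  is_lim_seq (fun N => kappa N (b N) * sumR (bconfigs N) (wtcw N (b N))) Z.
Proof.
  intros [N1 H1] HZ; apply is_lim_seq_le_eps; intros eps He.
  destruct (etail_small D (eps / 8)) as [M [HM0 HM]]; [lra|]; specialize (HM M ltac:(lra)).
  specialize (HZ (- M) M ltac:(lra)); rewrite Ropp_involutive in HZ.
  assert (HL := RInt_exp_fN_lim (- M) M ltac:(lra)).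
  destruct (proj1 (is_lim_seq_eps _ _) HL (eps / 4)) as [N2 H2]; [lra|].
  exists (S (max N1 N2)); intros N HN; specialize (H1 N ltac:(lia)); specialize (H2 N ltac:(lia)).
  assert (HS := hubbard_stratonovich N (b N) (fun _ => 1) (regime_sumsq N ltac:(lia))).
  rewrite (sumR_ext _ _ (wtcw N (b N))) in HS by (intros; ring).
  set (X := kappa N (b N) * _) in *; set (J := RInt _ (- M) M) in H2.
  assert (HX : J <= X <= J + (etail D M + etail D M)).
  { destruct (eventually_INR_ge M) as [m0 Hm0].
    assert (HJ : forall m, (m0 <= m)%nat ->
      J <= RInt (fun y => sumR (bconfigs N) (fun s => 1 * rho N (b N) s y)) (- INR m) (INR m)
        <= J + (etail D M + etail D M)).
    { intros m Hm; specialize (Hm0 m Hm).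
      rewrite (RInt_ext _ (fun y => exp (- fN N (b N) y))).
      - rewrite <- (Ropp_involutive M) at 1; apply RInt_enlarge; auto; lra.
      - intros y _; rewrite <- rho_sum; apply sumR_ext; intros; ring. }
    split; [apply (is_lim_seq_lb _ _ _ HS)|apply (is_lim_seq_ub _ _ _ HS)]; exists m0;
      intros m Hm; apply HJ, Hm. }
  apply Rabs_def2 in H2; apply Rabs_le_between in HZ; apply Rabs_le; lra.
Qed.

(** Given y <= x - e the event S_N/K <= x is almost certain, given y >= x + e almost impossible,
    with error [q N / (1 + y ^ 2)] of total mass at most [q N * PI]. In between the limit density is
    at most 1, so each half of the window costs at most e. *)
Lemma cdf_limit (D x I : R) :
  eventually (fun N => forall y, (1 + y ^ 4) * exp (- fN N (b N) y) <= D / (1 + y ^ 2)) ->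
  eventually (fun N => dominated D (fun y => exp (- fN N (b N) y))) ->
  dominated D (fun y => exp (- f y)) ->
  (forall a, a <= x -> Rabs (RInt (fun y => exp (- f y)) a x - I) <= etail D (- a)) ->
  is_lim_seq (fun N => kappa N (b N) *
    sumR (bconfigs N) (fun s => below N (K N) x s * wtcw N (b N) s)) I.
Proof.
  intros [N0 H0] [N1 H1] Hdf HI; apply is_lim_seq_le_eps; intros eps Heps.
  set (e := eps / 8); assert (He : 0 < e) by (unfold e; lra).
  assert (HD := dominated_ge0 _ _ Hdf).
  destruct (etail_small D (eps / 8)) as [M' [HM0 HM']]; [lra|].
  set (M := M' + Rabs x + e).
  assert (HxM : - M <= x - e /\ - M <= x /\ M' <= M).
  { unfold M; generalize (Rle_abs (- x)) (Rabs_pos x); rewrite Rabs_Ropp; lra. }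
  assert (HM := HM' M ltac:(lra)).
  assert (HIx := HI (- M) ltac:(lra)); rewrite Ropp_involutive in HIx.
  set (g := fun y => exp (- f y)) in *; set (gN := fun N y => exp (- fN N (b N) y)) in *.
  assert (Hg : forall u v, ex_RInt g u v) by (intros; apply ex_RInt_cont, Hdf).
  assert (Hg1 : forall u v, u <= v -> 0 <= RInt g u v <= v - u).
  { intros u v Huv; assert (Hgy : forall y, 0 <= g y <= 1).
    { intros y; split; [apply Hdf|]; unfold g; rewrite <- exp_0.
      destruct (limit_ge0 HR y) as [Hp| <-]; [left; apply exp_increasing; lra|].
      rewrite Ropp_0; lra. }
    split; [apply RInt_ge_0; auto; intros; apply Hgy|].
    replace (v - u) with ((v - u) * 1) by ring.
    eapply Rle_trans; [apply Rle_abs|].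
    apply abs_RInt_le_const; auto; intros t _; rewrite Rabs_pos_eq; apply Hgy. }
  assert (HLu := RInt_exp_fN_lim (- M) (x + e) ltac:(lra)).
  assert (HLl := RInt_exp_fN_lim (- M) (x - e) ltac:(lra)).
  fold g in HLu, HLl.
  assert (HIu : RInt g (- M) (x + e) = RInt g (- M) x + RInt g x (x + e))
    by (apply RInt_Chasles_R; auto).
  assert (HIl : RInt g (- M) x = RInt g (- M) (x - e) + RInt g (x - e) x)
    by (apply RInt_Chasles_R; auto).
  assert (G1 := Hg1 x (x + e) ltac:(lra)); assert (G2 := Hg1 (x - e) x ltac:(lra)).
  (* The constant of [spin_concentration] times that of the majorant, over e^2 as in Chebyshev's
     inequality. *)
  set (q := fun N => (B + 1) * (INR N / K N ^ 2) * D / e ^ 2).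
  assert (Hq : is_lim_seq (fun N => q N * PI) 0).
  { apply (is_lim_seq_ext (fun N => (B + 1) * D / e ^ 2 * PI * (INR N / K N ^ 2))).
    { intros n; unfold q; unfold Rdiv; ring. }
    replace (Finite 0) with (Rbar_mult (Finite ((B + 1) * D / e ^ 2 * PI)) (Finite 0))
      by (simpl; f_equal; ring).
    apply is_lim_seq_scal_l, HR. }
  destruct (proj1 (is_lim_seq_eps _ _) HLu (eps / 8)) as [N2 H2]; [lra|].
  destruct (proj1 (is_lim_seq_eps _ _) HLl (eps / 8)) as [N3 H3]; [lra|].
  destruct (proj1 (is_lim_seq_eps _ _) Hq (eps / 8)) as [N4 H4]; [lra|].
  destruct spin_concentration as [N5 H5].
  exists (S (N0 + N1 + N2 + N3 + N4 + N5)); intros N HN.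
  specialize (H0 N ltac:(lia)); specialize (H1 N ltac:(lia)); specialize (H2 N ltac:(lia)).
  specialize (H3 N ltac:(lia)); specialize (H4 N ltac:(lia)); specialize (H5 N ltac:(lia)).
  fold (gN N) in H2, H3, H1; rewrite Rminus_0_r in H4; apply Rabs_def2 in H4.
  set (Psi := fun y => sumR (bconfigs N) (fun s => below N (K N) x s * rho N (b N) s y)).
  assert (HPc : forall y, continuous Psi y) by (intros; apply continuous_rho_sum).
  assert (HPe : forall u v, ex_RInt Psi u v) by (intros; apply ex_RInt_cont; auto).
  assert (HS : is_lim_seq (fun m => RInt Psi (- INR m) (INR m)) _)
    by apply (hubbard_stratonovich N (b N) (below N (K N) x) (regime_sumsq N ltac:(lia))).
  assert (Hrho := rho_gt0 N (b N)).
  assert (HP0 : forall y, 0 <= Psi y).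
  { intros y; apply sumR_ge0_in; intros s _; apply Rmult_le_pos; [apply below_bounds|].
    left; apply Hrho. }
  assert (HP1 : forall y, Psi y <= gN N y).
  { intros y; unfold gN; rewrite <- rho_sum; apply sumR_le; intros s.
    generalize (below_bounds N (K N) x s) (Hrho s y); nra. }
  assert (Hche : forall y, sumR (bconfigs N)
      (fun s => (SN N s / K N - y) ^ 2 / e ^ 2 * rho N (b N) s y) <= q N / (1 + y ^ 2)).
  { intros y; rewrite (sumR_ext _ _ (fun s => / e ^ 2 *
      ((SN N s / K N - y) ^ 2 * rho N (b N) s y))) by (intros; unfold Rdiv; ring).
    rewrite sumR_scal; unfold q.
    replace ((B + 1) * (INR N / K N ^ 2) * D / e ^ 2 / (1 + y ^ 2)) with
      (/ e ^ 2 * ((B + 1) * (INR N / K N ^ 2) * (D / (1 + y ^ 2)))) by (unfold Rdiv; ring).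
    apply Rmult_le_compat_l; [left; apply Rinv_0_lt_compat, pow_lt, He|].
    eapply Rle_trans; [apply H5|]; apply Rmult_le_compat_l; [|apply H0].
    apply Rmult_le_pos; [generalize (regime_B _ _ _ _ HR); lra|].
    apply Rmult_le_pos; [apply pos_INR|left; apply Rinv_0_lt_compat, pow_lt, HR]. }
  assert (HP2 : forall y, x + e <= y -> Psi y <= q N / (1 + y ^ 2)).
  { intros y Hy; eapply Rle_trans; [|apply Hche]; apply sumR_le; intros s.
    apply Rmult_le_compat_r; [left; apply Hrho|now apply below_le_chebyshev]. }
  assert (HP3 : forall y, y <= x - e -> gN N y - q N / (1 + y ^ 2) <= Psi y).
  { intros y Hy; apply Rle_trans with (gN N y - sumR (bconfigs N)
      (fun s => (SN N s / K N - y) ^ 2 / e ^ 2 * rho N (b N) s y)).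
    { generalize (Hche y); lra. }
    unfold gN; rewrite <- rho_sum, <- sumR_minus; apply sumR_le; intros s.
    rewrite <- (Rmult_1_l (rho N (b N) s y)) at 1; rewrite <- Rmult_minus_distr_r.
    apply Rmult_le_compat_r; [left; apply Hrho|now apply below_ge_chebyshev]. }
  assert (Hqi : forall u v, u <= v -> 0 <= RInt (fun y => q N / (1 + y ^ 2)) u v <= q N * PI).
  { assert (Hq0 : 0 <= q N).
    { unfold q; apply Rmult_le_pos; [|left; apply Rinv_0_lt_compat, pow_lt, He].
      apply Rmult_le_pos; [|auto]; apply Rmult_le_pos;
        [generalize (regime_B _ _ _ _ HR); lra|].
      apply Rmult_le_pos; [apply pos_INR|left; apply Rinv_0_lt_compat, pow_lt, HR]. }
    intros u v Huv; rewrite (is_RInt_unique _ _ _ _ (is_RInt_cauchy _ _ _)).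
    rewrite <- Rmult_minus_distr_l.
    assert (Hatan : atan u <= atan v)
      by (destruct Huv as [Huv| ->]; [left; now apply atan_increasing|lra]).
    split; [apply Rmult_le_pos; lra|apply Rmult_le_compat_l; [auto|]].
    generalize (atan_bound u) (atan_bound v); lra. }
  assert (Hqe : forall u v, ex_RInt (fun y => q N / (1 + y ^ 2)) u v)
    by (intros; eexists; apply is_RInt_cauchy).
  assert (HgNe : forall u v, ex_RInt (gN N) u v) by (intros; apply ex_RInt_cont, H1).
  set (X := kappa N (b N) * _) in *.
  destruct (eventually_INR_ge (M + Rabs x + e)) as [m0 Hm0].
  assert (HJ : forall m, (m0 <= m)%nat ->
    RInt (gN N) (- M) (x - e) - q N * PI <= RInt Psi (- INR m) (INR m)
      <= RInt (gN N) (- M) (x + e) + etail D M + q N * PI).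
  { intros m Hm; specialize (Hm0 m Hm).
    assert (Hxm := Rle_abs x); assert (Hxp := Rabs_pos x).
    split.
    - rewrite (RInt_Chasles_R Psi (- INR m) (- M) (INR m)) by auto.
      rewrite (RInt_Chasles_R Psi (- M) (x - e) (INR m)) by auto.
      assert (0 <= RInt Psi (- INR m) (- M)) by (apply RInt_ge_0; auto; lra).
      assert (0 <= RInt Psi (x - e) (INR m)) by (apply RInt_ge_0; auto; lra).
      assert (RInt (fun y => gN N y - q N / (1 + y ^ 2)) (- M) (x - e) <= RInt Psi (- M) (x - e)).
      { apply RInt_le; auto; [lra| |intros; apply HP3; lra].
        apply (ex_RInt_minus (V := R_NormedModule)); auto. }
      assert (Hmi : RInt (fun y => gN N y - q N / (1 + y ^ 2)) (- M) (x - e) =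
        RInt (gN N) (- M) (x - e) - RInt (fun y => q N / (1 + y ^ 2)) (- M) (x - e)).
      { apply (RInt_minus (V := R_CompleteNormedModule)); auto. }
      generalize (Hqi (- M) (x - e) ltac:(lra)); lra.
    - rewrite (RInt_Chasles_R Psi (- INR m) (x + e) (INR m)) by auto.
      assert (RInt Psi (- INR m) (x + e) <= RInt (gN N) (- INR m) (x + e))
        by (apply RInt_le; auto; lra).
      assert (RInt Psi (x + e) (INR m) <= RInt (fun y => q N / (1 + y ^ 2)) (x + e) (INR m))
        by (apply RInt_le; auto; [lra|intros; apply HP2; lra]).
      rewrite (RInt_Chasles_R (gN N) (- INR m) (- M) (x + e)) in * by auto.
      assert (Hta := RInt_nonneg_dominated D (gN N) (- INR m) (- M) H1 ltac:(lra)).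
      assert (D * (atan (- M) - atan (- INR m)) <= etail D M).
      { unfold etail; apply Rmult_le_compat_l; [auto|].
        rewrite atan_opp; generalize (atan_bound (- INR m)); lra. }
      generalize (Hqi (x + e) (INR m) ltac:(lra)); lra. }
  assert (HX : RInt (gN N) (- M) (x - e) - q N * PI <= X
      <= RInt (gN N) (- M) (x + e) + etail D M + q N * PI).
  { split; [apply (is_lim_seq_lb _ _ _ HS)|apply (is_lim_seq_ub _ _ _ HS)]; exists m0;
      intros m Hm; apply HJ, Hm. }
  apply Rabs_def2 in H2; apply Rabs_def2 in H3; apply Rabs_le_between in HIx.
  unfold e in *; apply Rabs_le; lra.
Qed.

(** With r = ell/K^2 and b_i = w_i K/ell the statistic is the sum of w_i^2 s_i / ell. Given y its
    mean is at most |y| r sum b_i^3, since |tanh t| <= |t|, and its variance at most r^2 sum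
    b_i^4. *)
Lemma quadratic_statistic_limit (r : nat -> R) :
  (forall N, 0 <= r N) -> is_lim_seq r 0 ->
  is_lim_seq (fun N => r N * sumR (seq 0 N) (fun i => b N i ^ 3)) 0 ->
  is_lim_seq (fun N => kappa N (b N) * sumR (bconfigs N) (fun s =>
    lin N (fun i => r N * b N i ^ 2) s ^ 2 * wtcw N (b N) s)) 0.
Proof.
  intros Hr0 Hr Hr3; destruct regime_dominated as [D [HD1 [_ HD2]]].
  assert (HD := dominated_ge0 _ _ HD2).
  set (A := fun N => r N * sumR (seq 0 N) (fun i => b N i ^ 3)).
  apply (is_lim_seq_squeeze0 _ (fun N => (A N * A N + B * (r N * r N)) * D * PI)).
  2:{ replace (Finite 0) with (Rbar_mult (Rbar_mult (Finite (0 * 0 + B * (0 * 0))) D) PI)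
        by (simpl; f_equal; ring).
      apply is_lim_seq_scal_r, is_lim_seq_scal_r, is_lim_seq_plus'.
      - now apply is_lim_seq_mult'.
      - apply (is_lim_seq_scal_l _ B (Finite (0 * 0))); now apply is_lim_seq_mult'. }
  destruct HD1 as [N1 H1]; destruct (regime_fourth _ _ _ _ HR) as [N2 H2].
  exists (S (N1 + N2)); intros N HN; specialize (H1 N ltac:(lia)); specialize (H2 N ltac:(lia)).
  assert (Hv := regime_sumsq N ltac:(lia)); assert (HB := regime_B _ _ _ _ HR).
  assert (HA : 0 <= A N).
  { apply Rmult_le_pos; auto; apply sumR_seq_ge0; intros; apply pow_le; left; apply HR; auto. }
  assert (HAB : 0 <= A N * A N + B * (r N * r N)).
  { specialize (Hr0 N); generalize (Rmult_le_pos _ _ HA HA) (Rmult_le_pos _ _ Hr0 Hr0); nra. }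
  rewrite Rabs_pos_eq.
  2:{ apply Rmult_le_pos; [left; now apply kappa_gt0|].
      apply sumR_ge0_in; intros; apply Rmult_le_pos; [apply pow2_ge_0|left; apply exp_pos]. }
  apply expect_le; [auto|now apply Rmult_le_pos|].
  intros y.
  rewrite (sumR_ext _ _ (fun s => (0 + lin N (fun i => r N * b N i ^ 2) s) ^ 2 *
    rho N (b N) s y)) by (intros; rewrite Rplus_0_l; auto).
  rewrite rho_second_moment, Rplus_0_l.
  set (E := sumR _ (fun i => r N * b N i ^ 2 * tanh (b N i * y))).
  set (V := sumR _ (fun i => (r N * b N i ^ 2) ^ 2 * _)).
  assert (HE : Rabs E <= A N * Rabs y).
  { unfold E, A; eapply Rle_trans; [apply sumR_abs|].
    rewrite (Rmult_comm (r N)), Rmult_assoc, Rmult_comm, <- sumR_scal.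
    apply sumR_seq_le; intros i Hi; assert (Hb := regime_b _ _ _ _ HR N i Hi).
    rewrite Rabs_mult, (Rabs_pos_eq (r N * b N i ^ 2))
      by (apply Rmult_le_pos; [auto|apply pow2_ge_0]).
    apply Rle_trans with (r N * b N i ^ 2 * Rabs (b N i * y)).
    - apply Rmult_le_compat_l; [apply Rmult_le_pos; [auto|apply pow2_ge_0]|apply tanh_abs_le].
    - rewrite Rabs_mult, (Rabs_pos_eq (b N i)) by lra; right; ring. }
  assert (HV : V <= B * (r N * r N)).
  { unfold V; apply Rle_trans with (sumR (seq 0 N) (fun i => r N * r N * b N i ^ 4)).
    - apply sumR_le; intros i.
      replace (r N * r N * b N i ^ 4) with ((r N * b N i ^ 2) ^ 2 * 1) by ring.
      apply Rmult_le_compat_l; [apply pow2_ge_0|generalize (tanh_sqr_lt1 (b N i * y)); lra].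
    - rewrite sumR_scal, (Rmult_comm B); apply Rmult_le_compat_l; [|auto].
      apply Rmult_le_pos; auto. }
  assert (HE2 : E ^ 2 <= A N * A N * (1 + y ^ 4)).
  { rewrite <- (pow2_abs E); apply Rle_trans with ((A N * Rabs y) ^ 2).
    - apply pow_incr; split; [apply Rabs_pos|auto].
    - rewrite Rpow_mult_distr, pow2_abs; replace (A N * A N) with (A N ^ 2) by ring.
      apply Rmult_le_compat_l; [apply pow2_ge_0|].
      generalize (pow2_ge_0 (y ^ 2 - 1)) (pow2_ge_0 (y ^ 2 + 1)); nra. }
  assert (Hy : 0 <= y ^ 4) by (replace (y ^ 4) with ((y ^ 2) ^ 2) by ring; apply pow2_ge_0).
  replace ((A N * A N + B * (r N * r N)) * D / (1 + y ^ 2)) with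
    ((A N * A N + B * (r N * r N)) * (D / (1 + y ^ 2))) by (unfold Rdiv; ring).
  apply Rle_trans with ((A N * A N + B * (r N * r N)) *
    ((1 + y ^ 4) * exp (- fN N (b N) y))); [|now apply Rmult_le_compat_l].
  rewrite <- Rmult_assoc, Rmult_comm; apply Rmult_le_compat_r; [left; apply exp_pos|].
  assert (0 <= B * (r N * r N)) by (apply Rmult_le_pos; auto; apply Rmult_le_pos; auto).
  nra.
Qed.

(** Numerator and denominator are kept apart, each with the factor [kappa], so that a perturbed
    weight can be compared with them before dividing. *)
Lemma curie_weiss_limit : exists Z, 0 < Z /\ ImpIntFull (fun y => exp (- f y)) Z /\
  is_lim_seq (fun N => kappa N (b N) * sumR (bconfigs N) (wtcw N (b N))) Z /\
  forall x, exists I, ImpIntLower (fun y => exp (- f y)) x I /\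
    is_lim_seq (fun N => kappa N (b N) *
      sumR (bconfigs N) (fun s => below N (K N) x s * wtcw N (b N) s)) I.
Proof.
  destruct regime_dominated as [D [HD1 [HD2 HD3]]].
  destruct (dominated_full D _ HD3) as [Z [HZl HZ]]; exists Z.
  split; [|split; [|split]].
  - apply Rlt_le_trans with (RInt (fun y => exp (- f y)) 0 1).
    + apply RInt_gt_0; [lra| |intros; apply HD3]; intros; apply exp_pos.
    + apply (is_lim_seq_lb _ _ _ HZl); exists 1%nat; intros n Hn; apply le_INR in Hn; simpl in Hn.
      apply (RInt_enlarge D _ 0 1 (- INR n) (INR n) HD3); lra.
  - now apply (ImpIntFull_dominated D).
  - now apply (partition_limit Z D).
  - intros x; destruct (dominated_lower D _ x HD3) as [I HI]; exists I; split.
    + now apply (ImpIntLower_dominated D).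
    + now apply (cdf_limit D).
Qed.
End Regime.

(** * The annealed measure as a perturbation of the Curie-Weiss measure *)

Lemma ln1p_bounds u : 0 <= u -> u - u ^ 2 / 2 <= ln (1 + u) <= u - u ^ 2 / 2 + u ^ 3 / 3.
Proof.
  intros Hu; split.
  - enough (ln (1 + 0) - (0 - 0 ^ 2 / 2) <= ln (1 + u) - (u - u ^ 2 / 2))
      by (rewrite Rplus_0_r, ln_1 in *; lra).
    apply (le_of_derive_ge0 (fun u => ln (1 + u) - (u - u ^ 2 / 2)) (fun u => u ^ 2 / (1 + u)));
      auto.
    + intros x Hx; auto_derive; [lra|field; lra].
    + intros x Hx; apply Rmult_le_pos; [apply pow2_ge_0|left; apply Rinv_0_lt_compat; lra].
  - enough ((0 - 0 ^ 2 / 2 + 0 ^ 3 / 3) - ln (1 + 0) <= (u - u ^ 2 / 2 + u ^ 3 / 3) - ln (1 + u))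
      by (rewrite Rplus_0_r, ln_1 in *; lra).
    apply (le_of_derive_ge0 (fun u => (u - u ^ 2 / 2 + u ^ 3 / 3) - ln (1 + u))
      (fun u => u ^ 3 / (1 + u))); auto.
    + intros x Hx; auto_derive; [lra|field; lra].
    + intros x Hx; apply Rmult_le_pos; [now apply pow_le|left; apply Rinv_0_lt_compat; lra].
Qed.

(* Half of log((1 + x e^beta) / (1 + x e^-beta)): the effective coupling of an edge after
   averaging over its presence. *)
Definition coupling (beta x : R) : R :=
  / 2 * (ln (1 + x * exp beta) - ln (1 + x * exp (- beta))).

Definition amplitude (beta x : R) : R :=
  exp (/ 2 * (ln (1 + x * exp beta) + ln (1 + x * exp (- beta)))) / (1 + x).

(** Any positive function of a sign has the form A e^(J sigma): half the difference of the two
    logarithms is [coupling], half their sum gives [amplitude]. *)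
Lemma edge_factor beta x sigma : 0 <= x -> sigma = 1 \/ sigma = -1 ->
  (1 + x * exp (beta * sigma)) / (1 + x) = amplitude beta x * exp (coupling beta x * sigma).
Proof.
  intros Hx Hs; unfold amplitude, Rdiv; rewrite Rmult_assoc, (Rmult_comm (/ (1 + x))).
  rewrite <- Rmult_assoc, <- exp_plus; f_equal.
  assert (H : forall t, 0 < 1 + x * exp t) by (intros t; generalize (exp_pos t); nra).
  rewrite <- (exp_ln _ (H (beta * sigma))); f_equal; unfold coupling.
  destruct Hs as [-> | ->].
  - rewrite Rmult_1_r; field.
  - replace (beta * -1) with (- beta) by ring; field.
Qed.

(** Both logarithms are expanded to second order; the differences of e^(k beta) and e^(-k beta)
    become [sinh], and the cubic errors add up to at most cosh(3 beta) x^3. *)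
Lemma coupling_expansion beta x : 0 <= x ->
  Rabs (coupling beta x - (x * sinh beta - / 2 * x ^ 2 * sinh (2 * beta)))
    <= cosh (3 * beta) * x ^ 3.
Proof.
  intros Hx; set (p := exp beta); set (m := exp (- beta)).
  assert (Hp : 0 < p) by apply exp_pos; assert (Hm : 0 < m) by apply exp_pos.
  assert (H1 := ln1p_bounds (x * p) ltac:(nra)); assert (H2 := ln1p_bounds (x * m) ltac:(nra)).
  assert (E : sinh beta = (p - m) / 2) by reflexivity.
  assert (E2 : sinh (2 * beta) = (p ^ 2 - m ^ 2) / 2).
  { unfold sinh, p, m; replace (2 * beta) with (beta + beta) by ring.
    rewrite Ropp_plus_distr, !exp_plus; field. }
  assert (E3 : cosh (3 * beta) = (p ^ 3 + m ^ 3) / 2).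
  { unfold cosh, p, m; replace (3 * beta) with (beta + (beta + beta)) by ring.
    rewrite !Ropp_plus_distr, !exp_plus; field. }
  rewrite E, E2, E3; unfold coupling; fold p m.
  assert (0 <= (x * p) ^ 3) by (apply pow_le; nra).
  assert (0 <= (x * m) ^ 3) by (apply pow_le; nra).
  replace ((p ^ 3 + m ^ 3) / 2 * x ^ 3) with (((x * p) ^ 3 + (x * m) ^ 3) / 2) by field.
  replace (x * ((p - m) / 2) - / 2 * x ^ 2 * ((p ^ 2 - m ^ 2) / 2)) with
    (/ 2 * ((x * p - (x * p) ^ 2 / 2) - (x * m - (x * m) ^ 2 / 2))) by field.
  apply Rabs_le; lra.
Qed.

Section Weights.
Context {w : nat -> nat -> R} (Hw : forall N i, (i < N)%nat -> 0 < w N i).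

Definition edge_x (N : nat) (e : nat * nat) : R := w N (fst e) * w N (snd e) / ellN w N.

Lemma ellN_gt0 N : (0 < N)%nat -> 0 < ellN w N.
Proof. intros HN; apply sumR_seq_gt0; auto. Qed.

Lemma sumsq_w_gt0 N : (0 < N)%nat -> 0 < sumsq N (w N).
Proof. intros HN; apply sumR_seq_gt0; auto; intros; apply pow_lt; auto. Qed.

Lemma edge_x_gt0 N e : In e (pairs N) -> 0 < edge_x N e.
Proof.
  intros He; apply in_pairs in He.
  apply Rdiv_lt_0_compat; [apply Rmult_lt_0_compat; apply Hw; tauto|apply ellN_gt0; lia].
Qed.

(** With x = w_i w_j / ell the edge probability is x/(1+x), so averaging one edge gives (1 + x
    e^(beta s_i s_j))/(1 + x). *)
Lemma annealed_product N beta s : (0 < N)%nat ->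
  annealedWeight w N beta 0 s =
  prodR (pairs N) (fun e => amplitude beta (edge_x N e)) *
  exp (sumR (pairs N) (fun e => coupling beta (edge_x N e) * (spin s (fst e) * spin s (snd e)))).
Proof.
  intros HN; assert (Hl := ellN_gt0 N HN).
  rewrite <- prodR_exp, <- prodR_mult.
  rewrite <- (prodR_ext_in (pairs N) (fun e =>
    pGRG w N e * exp (beta * (spin s (fst e) * spin s (snd e))) + (1 - pGRG w N e))).
  2:{ intros e He; assert (Hx := edge_x_gt0 N e He).
      rewrite <- edge_factor; [|lra|].
      - unfold pGRG, edge_x in *; set (t := w N (fst e) * w N (snd e)) in *.
        assert (0 < t).
        { replace t with (t / ellN w N * ellN w N) by (field; lra).
          now apply Rmult_lt_0_compat. }
        field; lra.
      - destruct (spin_cases s (fst e)) as [-> | ->], (spin_cases s (snd e)) as [-> | ->];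
          [left|right|right|left]; ring. }
  rewrite <- (sumR_bconfigs_prod (pairs N) (fun e a => if a
    then pGRG w N e * exp (beta * (spin s (fst e) * spin s (snd e))) else 1 - pGRG w N e)).
  apply sumR_ext; intros g; unfold QN, HamGRG.
  rewrite Rmult_0_l, Rplus_0_r, <- sumR_scal, <- prodR_exp, <- prodR_mult.
  apply prodR_ext_in; intros [e a] _; cbn [fst snd]; destruct a; [reflexivity|].
  rewrite Rmult_0_r, exp_0; ring.
Qed.

Lemma nuN_eq N : (0 < N)%nat -> nuN w N = sumsq N (w N) / ellN w N.
Proof.
  intros HN; assert (Hl := ellN_gt0 N HN); assert (HI : 0 < INR N) by now apply lt_0_INR.
  unfold nuN, EWN; rewrite (sumR_ext _ (fun i => w N i ^ 1) (w N)) by (intros; ring).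
  fold (ellN w N) (sumsq N (w N)); field; lra.
Qed.

Lemma nuN_gt0 N : (0 < N)%nat -> 0 < nuN w N.
Proof.
  intros HN; rewrite nuN_eq by auto; apply Rdiv_lt_0_compat; auto using sumsq_w_gt0, ellN_gt0.
Qed.

(** The exponent is homogeneous of degree 0, so the weights w can be exchanged for the scaled b. *)
Lemma wtcw_scale n b c s : c <> 0 -> 0 < sumsq n b ->
  wtcw n (fun i => b i * c) s = wtcw n b s.
Proof.
  intros Hc Hv; unfold wtcw, lin, sumsq in *.
  rewrite (sumR_ext _ (fun i => b i * c * spin s i) (fun i => c * (b i * spin s i)))
    by (intros; ring).
  rewrite (sumR_ext _ (fun i => (b i * c) ^ 2) (fun i => c ^ 2 * b i ^ 2)) by (intros; ring).
  rewrite !sumR_scal; f_equal; field; split; [lra|auto].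
Qed.

Lemma cwWeight_eq N s : (0 < N)%nat -> cwWeight w N (/ nuN w N) 0 s = wtcw N (w N) s.
Proof.
  intros HN; assert (Hl := ellN_gt0 N HN); assert (Hv := sumsq_w_gt0 N HN).
  unfold cwWeight, wtcw; rewrite nuN_eq by auto; f_equal.
  rewrite (sumR_ext (seq 0 N) _ (fun i => sumR (seq 0 N) (fun j =>
    (/ sumsq N (w N) * (w N i * spin s i)) * (w N j * spin s j)))).
  2:{ intros i; apply sumR_ext; intros j; field; lra. }
  rewrite sumR_double, sumR_scal; unfold lin; field; lra.
Qed.

(** Spin-free part of the annealed weight: the amplitudes and the diagonals removed by [sumR_pairs].
    The first order diagonal is exactly 1/2 because sinh(beta) = ell / sum w_i^2 at criticality. *)
Definition annealed_const (N : nat) (beta : R) : R :=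
  prodR (pairs N) (fun e => amplitude beta (edge_x N e)) *
  exp (/ 4 * sinh (2 * beta) * sumR (seq 0 N) (fun i => (w N i ^ 2 / ellN w N) ^ 2) - / 2).

Lemma annealed_const_gt0 N beta : 0 < annealed_const N beta.
Proof.
  apply Rmult_lt_0_compat; [|apply exp_pos].
  apply prodR_gt0_in; intros e He; apply Rdiv_lt_0_compat; [apply exp_pos|].
  generalize (edge_x_gt0 N e He); lra.
Qed.

(* The second order term of the coupling is a negative square, the third order one is uniformly
   small. *)
Lemma annealed_factor N beta s : (0 < N)%nat -> sinh beta = / nuN w N ->
  exists g, annealedWeight w N beta 0 s = annealed_const N beta * (wtcw N (w N) s * exp g) /\
    Rabs (g + / 4 * sinh (2 * beta) * lin N (fun i => w N i ^ 2 / ellN w N) s ^ 2)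
      <= cosh (3 * beta) * ((sumR (seq 0 N) (fun i => w N i ^ 3)) ^ 2 / ellN w N ^ 3).
Proof.
  intros HN Hb; assert (Hl := ellN_gt0 N HN); assert (Hv := sumsq_w_gt0 N HN).
  rewrite nuN_eq in Hb by auto.
  set (l := ellN w N) in *.
  set (sg := fun e : nat * nat => spin s (fst e) * spin s (snd e)).
  set (th := fun e => coupling beta (edge_x N e) -
    (edge_x N e * sinh beta - / 2 * edge_x N e ^ 2 * sinh (2 * beta))).
  exists (- (/ 4 * sinh (2 * beta) * lin N (fun i => w N i ^ 2 / l) s ^ 2)
    + sumR (pairs N) (fun e => th e * sg e)).
  split.
  - rewrite annealed_product by auto; unfold annealed_const.
    rewrite Rmult_assoc; f_equal; unfold wtcw; rewrite <- !exp_plus; f_equal.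
    rewrite (sumR_ext _ _ (fun e => (sinh beta * (edge_x N e * sg e) +
      (- (/ 2 * sinh (2 * beta))) * (edge_x N e ^ 2 * sg e)) + th e * sg e))
      by (intros; unfold th, sg; ring).
    rewrite !sumR_plus, !sumR_scal.
    rewrite (sumR_ext _ (fun e => edge_x N e * sg e) (fun e => / l *
      ((w N (fst e) * spin s (fst e)) * (w N (snd e) * spin s (snd e)))))
      by (intros; unfold edge_x, sg; fold l; field; lra).
    rewrite (sumR_ext _ (fun e => edge_x N e ^ 2 * sg e) (fun e =>
      ((w N (fst e) ^ 2 / l * spin s (fst e)) * (w N (snd e) ^ 2 / l * spin s (snd e)))))
      by (intros; unfold edge_x, sg; fold l; field; lra).
    rewrite sumR_scal, (sumR_pairs N (fun i => w N i * spin s i)).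
    rewrite (sumR_pairs N (fun i => w N i ^ 2 / l * spin s i)).
    fold (lin N (w N) s) (lin N (fun i => w N i ^ 2 / l) s).
    rewrite (sumR_ext _ (fun i => (w N i * spin s i) ^ 2) (fun i => w N i ^ 2))
      by (intros; rewrite Rpow_mult_distr, spin_sqr; ring).
    rewrite (sumR_ext _ (fun i => (w N i ^ 2 / l * spin s i) ^ 2) (fun i => (w N i ^ 2 / l) ^ 2))
      by (intros; rewrite (Rpow_mult_distr _ (spin s _)), spin_sqr; ring).
    fold l (sumsq N (w N)); rewrite Hb; field; lra.
  - match goal with |- Rabs ?X <= _ => replace X with (sumR (pairs N) (fun e => th e * sg e))
      by ring end.
    eapply Rle_trans; [apply sumR_abs|].
    apply Rle_trans with (sumR (pairs N) (fun e => cosh (3 * beta) / l ^ 3 *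
      (w N (fst e) ^ 3 * w N (snd e) ^ 3))).
    + apply sumR_le_in; intros e He; assert (Hx := edge_x_gt0 N e He).
      assert (Hsg : Rabs (sg e) = 1).
      { unfold sg; destruct (spin_cases s (fst e)) as [-> | ->],
          (spin_cases s (snd e)) as [-> | ->]; unfold Rabs; destruct (Rcase_abs _); lra. }
      rewrite Rabs_mult, Hsg, Rmult_1_r.
      eapply Rle_trans; [apply coupling_expansion; lra|].
      unfold edge_x; fold l; right; field; lra.
    + rewrite sumR_scal, (sumR_pairs N (fun i => w N i ^ 3)).
      replace (cosh (3 * beta) * ((sumR (seq 0 N) (fun i => w N i ^ 3)) ^ 2 / l ^ 3)) with
        (cosh (3 * beta) / l ^ 3 * (sumR (seq 0 N) (fun i => w N i ^ 3)) ^ 2) by (field; lra).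
      apply Rmult_le_compat_l.
      * left; apply Rdiv_lt_0_compat; [apply cosh_gt0|now apply pow_lt].
      * assert (0 <= sumR (seq 0 N) (fun i => (w N i ^ 3) ^ 2))
          by (apply sumR_ge0_in; intros; apply pow2_ge_0).
        generalize (pow2_ge_0 (sumR (seq 0 N) (fun i => w N i ^ 3))); lra.
Qed.

Lemma sinh_asinh y : sinh (asinh y) = y.
Proof. exact (sinh_arcsinh y). Qed.

(** The number exp(asinh y) = y + sqrt(y^2 + 1) lies in [1, 1 + 2Y], and the hyperbolic functions of
    multiples are combinations of its powers. With y = 1/nu_N this bounds the coefficients of the
    expansion. *)
Lemma asinh_bounds y Y : 0 < y <= Y ->
  0 <= sinh (2 * asinh y) <= (1 + 2 * Y) ^ 2 /\ cosh (3 * asinh y) <= (1 + 2 * Y) ^ 3.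
Proof.
  intros [Hy HY].
  assert (Hs : 1 <= sqrt (y ^ 2 + 1) <= y + 1).
  { split.
    - rewrite <- sqrt_1 at 1; apply sqrt_le_1_alt; generalize (pow2_ge_0 y); lra.
    - rewrite <- (sqrt_pow2 (y + 1)) by lra; apply sqrt_le_1_alt; nra. }
  assert (He : exp (asinh y) = y + sqrt (y ^ 2 + 1)) by (apply exp_ln; lra).
  set (p := exp (asinh y)) in *.
  assert (Hp : 1 <= p <= 1 + 2 * Y) by lra.
  assert (Hm : exp (- asinh y) = / p) by apply exp_Ropp.
  assert (Hm1 : 0 < / p <= 1).
  { split; [apply Rinv_0_lt_compat; lra|].
    rewrite <- Rinv_1; apply Rinv_le_contravar; lra. }
  assert (E2 : sinh (2 * asinh y) = (p ^ 2 - (/ p) ^ 2) / 2).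
  { unfold sinh; replace (2 * asinh y) with (asinh y + asinh y) by ring.
    rewrite Ropp_plus_distr, !exp_plus, Hm; fold p; field; lra. }
  assert (E3 : cosh (3 * asinh y) = (p ^ 3 + (/ p) ^ 3) / 2).
  { unfold cosh; replace (3 * asinh y) with (asinh y + (asinh y + asinh y)) by ring.
    rewrite !Ropp_plus_distr, !exp_plus, Hm; fold p; field; lra. }
  assert (1 <= p ^ 2 <= (1 + 2 * Y) ^ 2)
    by (split; [rewrite <- (pow1 2)|]; apply pow_incr; lra).
  assert (1 <= p ^ 3 <= (1 + 2 * Y) ^ 3)
    by (split; [rewrite <- (pow1 3)|]; apply pow_incr; lra).
  assert (0 <= (/ p) ^ 2 <= 1)
    by (split; [apply pow_le|rewrite <- (pow1 2); apply pow_incr]; lra).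
  assert (0 <= (/ p) ^ 3 <= 1)
    by (split; [apply pow_le|rewrite <- (pow1 3); apply pow_incr]; lra).
  rewrite E2, E3; lra.
Qed.

(** Above, g <= r suffices because [a] enters with a minus sign; below, exp g >= 1 + g. So [a], here
    the quadratic statistic, occurs only linearly and may be averaged. *)
Lemma exp_minus1_abs a r g : 0 <= a -> Rabs (g + a) <= r ->
  Rabs (exp g - 1) <= a + (r + (exp r - 1)).
Proof.
  intros Ha Hr; apply Rabs_le_between in Hr.
  assert (H1 := exp_ineq1_le g); assert (H2 := exp_ineq1_le r).
  assert (H3 : exp g <= exp r).
  { destruct (Req_dec g r) as [->|]; [lra|left; apply exp_increasing; lra]. }
  apply Rabs_le; lra.
Qed.

Lemma probOf_below N wt K x :
  probOf N wt (fun s => if Rle_dec (SN N s / K) x then true else false) =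
  sumR (bconfigs N) (fun s => below N K x s * wt s) / sumR (bconfigs N) wt.
Proof.
  unfold probOf; f_equal; apply sumR_ext; intros s; unfold below.
  destruct (Rle_dec _ _); ring.
Qed.

(** The prefactor [k] cancels in the ratio; the positive limit [Z] keeps the total mass nonzero for
    large N. *)
Lemma ConvToDensity_of_limits (wt : nat -> list bool -> R) a f (k : nat -> R) Z :
  0 < Z -> ImpIntFull (fun y => exp (- f y)) Z ->
  eventually (fun N => 0 < k N) ->
  is_lim_seq (fun N => k N * sumR (bconfigs N) (wt N)) Z ->
  (forall x, exists I, ImpIntLower (fun y => exp (- f y)) x I /\
    is_lim_seq (fun N => k N * sumR (bconfigs N)
      (fun s => below N (Rpower (INR N) a) x s * wt N s)) I) ->
  ConvToDensity wt a f.
Proof.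
  intros HZ HI [N0 Hk] Hl Hx; exists Z; split; [auto|split; [auto|]].
  intros x; destruct (Hx x) as [I [HI1 HI2]]; exists I; split; [auto|].
  apply is_lim_seq_Reals.
  apply (is_lim_seq_ext_loc (fun N =>
    (k N * sumR (bconfigs N) (fun s => below N (Rpower (INR N) a) x s * wt N s)) /
    (k N * sumR (bconfigs N) (wt N)))).
  - destruct (proj1 (is_lim_seq_eps _ _) Hl Z HZ) as [N1 H1].
    exists (max N0 N1); intros N HN; specialize (Hk N ltac:(lia)); specialize (H1 N ltac:(lia)).
    apply Rabs_def2 in H1; unfold cdfSN; rewrite probOf_below.
    assert (Hs : sumR (bconfigs N) (wt N) <> 0) by (intros E; rewrite E in H1; lra).
    field; split; lra.
  - apply is_lim_seq_div'; auto; lra.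
Qed.

(** The annealed weight is compared with the Curie-Weiss one configuration by configuration. With r
    = ell/K^2, the vanishing of r and of r sum b_i^3 disposes of both the quadratic term and the
    remainder. *)
Lemma converges_to_density (K : nat -> R) f B a nu0 :
  regime (fun N i => w N i * (K N / ellN w N)) K f B ->
  (forall N, K N = Rpower (INR N) a) ->
  is_lim_seq (fun N => ellN w N / K N ^ 2) 0 ->
  is_lim_seq (fun N => ellN w N / K N ^ 2 *
    sumR (seq 0 N) (fun i => (w N i * (K N / ellN w N)) ^ 3)) 0 ->
  0 < nu0 -> eventually (fun N => nu0 <= nuN w N) ->
  ConvToDensity (fun N => annealedWeight w N (asinh (/ nuN w N)) 0) a f /\
  ConvToDensity (fun N => cwWeight w N (/ nuN w N) 0) a f.
Proof.
  intros HR HKa HR0 HR3 Hnu0 [Nn Hnu].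
  set (b := fun N i => w N i * (K N / ellN w N)) in *.
  destruct (curie_weiss_limit HR) as [Z [HZ [HI [HlZ Hlx]]]].
  assert (HK := regime_K _ _ _ _ HR).
  assert (Hk : forall N, (0 < N)%nat -> 0 < kappa N (b N))
    by (intros; apply kappa_gt0, (regime_sumsq HR); auto).
  assert (Hwt : forall N s, (0 < N)%nat -> wtcw N (b N) s = wtcw N (w N) s).
  { intros N s HN; apply wtcw_scale; [|now apply sumsq_w_gt0].
    apply Rgt_not_eq, Rdiv_lt_0_compat; auto using ellN_gt0. }
  set (beta := fun N => asinh (/ nuN w N)).
  set (c := fun N => annealed_const N (beta N)).
  assert (Hc : forall N, 0 < c N) by (intros; apply annealed_const_gt0).
  (* Since sinh(beta) = 1/nu_N <= 1/nu0, these are the bounds of [asinh_bounds]. *)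
  set (Y := / nu0); set (A := (1 + 2 * Y) ^ 2); set (A3 := (1 + 2 * Y) ^ 3).
  assert (HY : 0 < Y) by now apply Rinv_0_lt_compat.
  assert (HA : 0 <= A) by apply pow2_ge_0.
  assert (HA3 : 0 <= A3) by (apply pow_le; lra).
  set (r := fun N => ellN w N / K N ^ 2).
  set (q := fun N => r N * sumR (seq 0 N) (fun i => b N i ^ 3)).
  (* The product [q N * q N * r N] equals (sum w_i^3)^2 / ell^3, the remainder in
     [annealed_factor]. *)
  set (rem := fun N => A3 * (q N * q N * r N)).
  set (dl := fun N => A * (kappa N (b N) * sumR (bconfigs N) (fun s =>
    lin N (fun i => r N * b N i ^ 2) s ^ 2 * wtcw N (b N) s))
    + (rem N + (exp (rem N) - 1)) * (kappa N (b N) * sumR (bconfigs N) (wtcw N (b N)))).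
  assert (Hrem : is_lim_seq rem 0).
  { replace (Finite 0) with (Rbar_mult (Finite A3) (Finite (0 * 0 * 0))) by (simpl; f_equal; ring).
    apply is_lim_seq_scal_l, is_lim_seq_mult'; [apply is_lim_seq_mult'|]; assumption. }
  assert (Hdl : is_lim_seq dl 0).
  { replace (Finite 0) with (Finite (A * 0 + (0 + (1 - 1)) * Z)) by (f_equal; ring).
    apply is_lim_seq_plus'.
    - apply (is_lim_seq_scal_l _ A (Finite 0)), (quadratic_statistic_limit HR r); auto.
      intros N; unfold r; destruct N as [|N].
      + unfold ellN; simpl; lra.
      + left; apply Rdiv_lt_0_compat; [apply ellN_gt0; lia|apply pow_lt; auto].
    - apply is_lim_seq_mult'; [|exact HlZ].
      apply is_lim_seq_plus'; [exact Hrem|].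
      apply is_lim_seq_minus'; [|apply is_lim_seq_const].
      rewrite <- exp_0; apply (is_lim_seq_continuous exp); [|exact Hrem].
      apply derivable_continuous_pt, derivable_pt_exp. }
  (* Applied below to the constant 1 and to the indicator of S_N/K <= x. *)
  assert (Hpert : forall phi : nat -> list bool -> R, (forall N s, 0 <= phi N s <= 1) ->
    forall l : R, is_lim_seq (fun N => kappa N (b N) *
      sumR (bconfigs N) (fun s => phi N s * wtcw N (b N) s)) l ->
    is_lim_seq (fun N => kappa N (b N) / c N *
      sumR (bconfigs N) (fun s => phi N s * annealedWeight w N (beta N) 0 s)) l).
  { intros phi Hphi l Hl.
    apply (is_lim_seq_ext (fun N => kappa N (b N) *
        sumR (bconfigs N) (fun s => phi N s * wtcw N (b N) s) +
      (kappa N (b N) / c N *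
        sumR (bconfigs N) (fun s => phi N s * annealedWeight w N (beta N) 0 s)
      - kappa N (b N) * sumR (bconfigs N) (fun s => phi N s * wtcw N (b N) s))));
      [intros; ring|].
    replace (Finite l) with (Finite (l + 0)) by (f_equal; ring).
    apply is_lim_seq_plus'; [exact Hl|].
    apply (is_lim_seq_squeeze0 _ dl); [|exact Hdl].
    exists (S Nn); intros N HN; specialize (Hnu N ltac:(lia)); specialize (Hk N ltac:(lia)).
    assert (HN0 : (0 < N)%nat) by lia; assert (Hl0 := ellN_gt0 N HN0).
    assert (Hnug := nuN_gt0 N HN0); specialize (Hc N); specialize (HK N).
    unfold Rdiv at 1; rewrite (Rmult_assoc (kappa N (b N))), <- Rmult_minus_distr_l.
    rewrite <- sumR_scal, <- sumR_minus, Rabs_mult, (Rabs_pos_eq (kappa N (b N))) by lra.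
    unfold dl; rewrite <- !Rmult_assoc, (Rmult_comm A), (Rmult_comm (_ + _) (kappa N (b N))).
    rewrite !Rmult_assoc, <- Rmult_plus_distr_l.
    apply Rmult_le_compat_l; [lra|].
    rewrite <- !sumR_scal, <- sumR_plus.
    eapply Rle_trans; [apply sumR_abs|]; apply sumR_le; intros s.
    destruct (annealed_factor N (beta N) s HN0 (sinh_asinh _)) as [g [-> Hg]].
    fold (c N); rewrite <- Hwt by auto.
    replace (/ c N * (phi N s * (c N * (wtcw N (b N) s * exp g))) - phi N s * wtcw N (b N) s)
      with (wtcw N (b N) s * (phi N s * (exp g - 1))) by (field; lra).
    assert (Hw0 : 0 < wtcw N (b N) s) by apply exp_pos.
    rewrite Rabs_mult, (Rabs_pos_eq (wtcw N (b N) s)) by lra.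
    replace (A * (lin N (fun i => r N * b N i ^ 2) s ^ 2 * wtcw N (b N) s) +
      (rem N + (exp (rem N) - 1)) * wtcw N (b N) s) with
      (wtcw N (b N) s * (A * lin N (fun i => r N * b N i ^ 2) s ^ 2 +
        (rem N + (exp (rem N) - 1)))) by ring.
    apply Rmult_le_compat_l; [lra|].
    rewrite Rabs_mult, (Rabs_pos_eq (phi N s)) by apply Hphi.
    apply Rle_trans with (Rabs (exp g - 1)).
    { generalize (Hphi N s) (Rabs_pos (exp g - 1)); nra. }
    destruct (asinh_bounds (/ nuN w N) Y) as [Hsh Hch].
    { split; [now apply Rinv_0_lt_compat|now apply Rinv_le_contravar]. }
    fold (beta N) in Hsh, Hch; fold A in Hsh; fold A3 in Hch.
    set (T2 := lin N (fun i => r N * b N i ^ 2) s ^ 2) in *.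
    assert (HT : lin N (fun i => w N i ^ 2 / ellN w N) s ^ 2 = T2).
    { unfold T2; f_equal; apply sumR_ext; intros i; unfold r, b; field; lra. }
    rewrite HT in Hg; assert (HT0 : 0 <= T2) by apply pow2_ge_0.
    assert (Hrm : cosh (3 * beta N) * (sumR (seq 0 N) (fun i => w N i ^ 3) ^ 2 / ellN w N ^ 3)
      <= rem N).
    { replace (sumR (seq 0 N) (fun i => w N i ^ 3) ^ 2 / ellN w N ^ 3) with (q N * q N * r N).
      - apply Rmult_le_compat_r; [|exact Hch].
        apply Rmult_le_pos; [apply Rle_0_sqr|].
        left; apply Rdiv_lt_0_compat; [auto|now apply pow_lt].
      - unfold q; rewrite (sumR_ext (seq 0 N) (fun i => b N i ^ 3)
          (fun i => (K N / ellN w N) ^ 3 * w N i ^ 3)) by (intros; unfold b; ring).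
        rewrite sumR_scal; unfold r; field; lra. }
    eapply Rle_trans; [apply (exp_minus1_abs (/ 4 * sinh (2 * beta N) * T2) (rem N))|].
    - apply Rmult_le_pos; lra.
    - lra.
    - apply Rplus_le_compat_r, Rmult_le_compat_r; lra. }
  split.
  - apply (ConvToDensity_of_limits _ a f (fun N => kappa N (b N) / c N) Z HZ HI).
    + exists 1%nat; intros N HN; apply Rdiv_lt_0_compat; auto.
    + apply (is_lim_seq_ext (fun N => kappa N (b N) / c N *
        sumR (bconfigs N) (fun s => 1 * annealedWeight w N (beta N) 0 s))).
      { intros N; f_equal; apply sumR_ext; intros; apply Rmult_1_l. }
      apply (Hpert (fun _ _ => 1)); [intros; lra|].
      apply (is_lim_seq_ext (fun N => kappa N (b N) * sumR (bconfigs N) (wtcw N (b N))));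
        [|exact HlZ].
      intros N; f_equal; apply sumR_ext; intros; ring.
    + intros x; destruct (Hlx x) as [I [HI1 HI2]]; exists I; split; [auto|].
      apply (Hpert (fun N => below N (Rpower (INR N) a) x)); [intros; apply below_bounds|].
      eapply is_lim_seq_ext; [|exact HI2]; intros N; cbv beta; now rewrite HKa.
  - apply (ConvToDensity_of_limits _ a f (fun N => kappa N (b N)) Z HZ HI).
    + exists 1%nat; auto.
    + eapply is_lim_seq_ext_loc; [|exact HlZ]; exists 1%nat; intros N HN; f_equal.
      apply sumR_ext; intros s; rewrite cwWeight_eq, Hwt; auto.
    + intros x; destruct (Hlx x) as [I [HI1 HI2]]; exists I; split; [auto|].
      eapply is_lim_seq_ext_loc; [|exact HI2]; exists 1%nat; intros N HN; f_equal.
      apply sumR_ext; intros s; rewrite cwWeight_eq, Hwt, HKa; auto.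
Qed.
End Weights.

(** * Convergence of moments *)

(** The supremum of the left ends; strict nesting at the next step puts it strictly inside each
    interval. *)
Lemma nested_points (u v : nat -> R) :
  (forall n, u n < u (S n) /\ u (S n) < v (S n) /\ v (S n) < v n) ->
  exists x, forall n, u n < x < v n.
Proof.
  intros H.
  assert (Hu : forall n m, u n <= u (n + m)%nat).
  { intros n; induction m as [|m IH]; [rewrite Nat.add_0_r; lra|].
    rewrite Nat.add_succ_r; generalize (H (n + m)%nat); lra. }
  assert (Hv : forall n m, v (n + m)%nat <= v n).
  { intros n; induction m as [|m IH]; [rewrite Nat.add_0_r; lra|].
    rewrite Nat.add_succ_r; generalize (H (n + m)%nat); lra. }
  assert (Huv : forall n, u n < v n) by (intros n; generalize (H n); lra).
  assert (Hnm : forall n m, u n <= v m).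
  { intros n m; generalize (Hu n m) (Hv m n) (Huv (n + m)%nat).
    rewrite (Nat.add_comm m n); lra. }
  destruct (completeness (fun y => exists n, y = u n)) as [x [Hx1 Hx2]].
  - exists (v 0%nat); intros y [n ->]; apply Hnm.
  - exists (u 0%nat), 0%nat; reflexivity.
  - exists x; intros n; split.
    + apply Rlt_le_trans with (u (S n)); [apply H|apply Hx1; now exists (S n)].
    + apply Rle_lt_trans with (v (S n)); [|apply H].
      apply Hx2; intros y [m ->]; apply Hnm.
Qed.

(** Convergence in distribution speaks only of continuity points, so cut points and truncation
    levels are taken there. The variation over the n-th interval is at most 2^-n times the total;
    working with fifths keeps both candidates off the ends, which makes the limit point interior. *)
Lemma monotone_continuity_dense (F : R -> R) u0 v0 :
  (forall x y, x <= y -> F x <= F y) -> u0 < v0 -> exists x, u0 < x < v0 /\ continuity_pt F x.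
Proof.
  intros HF Huv.
  (* Of two disjoint subintervals, one carries at most half of the variation of F. *)
  set (step := fun p : R * R => let '(u, v) := p in let d := (v - u) / 5 in
    if Rle_dec (F (u + 2 * d) - F (u + d)) (F (u + 4 * d) - F (u + 3 * d))
    then (u + d, u + 2 * d) else (u + 3 * d, u + 4 * d)).
  set (I := fun n => Nat.iter n step (u0, v0)).
  assert (HI : forall n, fst (I n) < snd (I n) /\
    F (snd (I n)) - F (fst (I n)) <= (F v0 - F u0) * (/ 2) ^ n /\
    fst (I n) < fst (I (S n)) /\ fst (I (S n)) < snd (I (S n)) /\ snd (I (S n)) < snd (I n)).
  { assert (Hs : forall n, fst (I n) < snd (I n) ->
      F (snd (I n)) - F (fst (I n)) <= (F v0 - F u0) * (/ 2) ^ n ->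
      F (snd (I (S n))) - F (fst (I (S n))) <= (F v0 - F u0) * (/ 2) ^ S n /\
      fst (I n) < fst (I (S n)) /\ fst (I (S n)) < snd (I (S n)) /\ snd (I (S n)) < snd (I n)).
    { intros n Hlt Hd; change (I (S n)) with (step (I n)).
      destruct (I n) as [u v]; cbn [fst snd] in *; unfold step.
      set (d := (v - u) / 5); assert (Hdd : 0 < d) by (unfold d; lra).
      assert (Hv : v = u + 5 * d) by (unfold d; field).
      generalize (HF u (u + d) ltac:(lra)) (HF (u + 2 * d) (u + 3 * d) ltac:(lra))
        (HF (u + 4 * d) v ltac:(lra)); intros.
      destruct (Rle_dec _ _) as [Hc|Hc]; cbn [fst snd pow]; repeat split; lra. }
    induction n as [|n IH].
    - assert (H0 : fst (I 0%nat) < snd (I 0%nat)) by exact Huv.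
      assert (H1 : F (snd (I 0%nat)) - F (fst (I 0%nat)) <= (F v0 - F u0) * (/ 2) ^ 0)
        by (simpl; lra).
      split; [auto|split; [auto|apply Hs; auto]].
    - destruct IH as [H0 [H1 [H2 [H3 H4]]]]; destruct (Hs n H0 H1) as [H5 _].
      split; [auto|split; [auto|apply (Hs (S n)); auto]]. }
  destruct (nested_points (fun n => fst (I n)) (fun n => snd (I n))) as [x Hx].
  { intros n; apply HI. }
  exists x; split; [apply (Hx 0%nat)|].
  intros eps He.
  assert (HD : 0 <= F v0 - F u0) by (generalize (HF u0 v0); lra).
  destruct (pow_lt_1_zero (/ 2)) with (y := eps / (F v0 - F u0 + 1)) as [n Hn].
  { rewrite Rabs_pos_eq; lra. }
  { apply Rdiv_lt_0_compat; lra. }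
  specialize (Hn n (Nat.le_refl _)); rewrite Rabs_pos_eq in Hn by (apply pow_le; lra).
  assert (Hsmall : F (snd (I n)) - F (fst (I n)) < eps).
  { eapply Rle_lt_trans; [apply HI|].
    apply Rle_lt_trans with ((F v0 - F u0 + 1) * (/ 2) ^ n).
    - apply Rmult_le_compat_r; [apply pow_le|]; lra.
    - apply (Rmult_lt_compat_l (F v0 - F u0 + 1)) in Hn; [|lra].
      replace ((F v0 - F u0 + 1) * (eps / (F v0 - F u0 + 1))) with eps in Hn by (field; lra); lra. }
  destruct (Hx n) as [Hx1 Hx2].
  exists (Rmin (x - fst (I n)) (snd (I n) - x)); split; [apply Rmin_case; lra|].
  intros y [_ Hy]; simpl in Hy; unfold Rdist in *; simpl.
  assert (Hy1 : Rabs (y - x) < x - fst (I n)) by (eapply Rlt_le_trans; [exact Hy|apply Rmin_l]).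
  assert (Hy2 : Rabs (y - x) < snd (I n) - x) by (eapply Rlt_le_trans; [exact Hy|apply Rmin_r]).
  apply Rabs_def2 in Hy1; apply Rabs_def2 in Hy2; unfold Rdist.
  generalize (HF (fst (I n)) y ltac:(lra)) (HF y (snd (I n)) ltac:(lra))
    (HF (fst (I n)) x ltac:(lra)) (HF x (snd (I n)) ltac:(lra)); intros.
  apply Rabs_def1; lra.
Qed.

(** With [Rmin], for k >= 1 this is the integral of k x^(k-1) P(W_N > x) over [0, a], the truncation
    of the layer-cake formula in [MomentW]; discarding the weights above [a] would not match it. *)
Definition truncated_moment (w : nat -> nat -> R) (N k : nat) (a : R) : R :=
  / INR N * sumR (seq 0 N) (fun i => Rmin (w N i) a ^ k).

Lemma Rmin_pow_increment_bounds k t u v : 0 < t -> 0 <= u <= v ->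
  (v ^ k - u ^ k) * (1 - (if Rle_dec t v then 1 else 0)) <= Rmin t v ^ k - Rmin t u ^ k
    <= (v ^ k - u ^ k) * (1 - (if Rle_dec t u then 1 else 0)).
Proof.
  intros Ht Huv; assert (Hk := pow_incr u v k Huv).
  unfold Rmin; destruct (Rle_dec t v) as [H1|H1], (Rle_dec t u) as [H2|H2]; try lra.
  assert (u ^ k <= t ^ k) by (apply pow_incr; lra).
  assert (t ^ k <= v ^ k) by (apply pow_incr; lra); lra.
Qed.

Lemma pow_increment_le k u v a : 0 <= u <= v -> v <= a ->
  v ^ k - u ^ k <= INR k * a ^ (k - 1) * (v - u).
Proof.
  intros [Hu Huv] Ha; destruct Huv as [Huv| <-]; [|rewrite Rminus_diag, Rminus_diag; lra].
  destruct (MVT_cor2 (fun x => x ^ k) (fun x => INR k * x ^ pred k) u v Huv) as [c [-> Hc]].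
  { intros; apply derivable_pt_lim_pow. }
  apply Rmult_le_compat_r; [lra|]; apply Rmult_le_compat_l; [apply pos_INR|].
  replace (k - 1)%nat with (pred k) by lia; apply pow_incr; lra.
Qed.

Lemma is_RInt_pow k u v : is_RInt (fun x => INR k * x ^ (k - 1)) u v (v ^ k - u ^ k).
Proof.
  apply (is_RInt_derive (fun x => x ^ k)).
  - intros x _; apply is_derive_Reals; replace (k - 1)%nat with (pred k) by lia.
    apply derivable_pt_lim_pow.
  - intros x _; apply (ex_derive_continuous (V := R_NormedModule)); auto_derive; auto.
Qed.

Section Moments.
Context {w : nat -> nat -> R} {F : R -> R}.
Context (Hw : forall N i, (i < N)%nat -> 0 < w N i).
Context (Hmono : forall x y, x <= y -> F x <= F y).
Context (H01 : forall x, 0 <= F x <= 1).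
Context (Hconv : forall x, continuity_pt F x -> Un_cv (fun N => FN w N x) (F x)).

(** The counterpart of [RInt_moment_bounds] with [FN] in place of [F]: comparing the two involves
    the distribution functions only at the ends of a cell. *)
Lemma truncated_moment_increment N k u v : (0 < N)%nat -> 0 <= u <= v ->
  (v ^ k - u ^ k) * (1 - FN w N v) <= truncated_moment w N k v - truncated_moment w N k u
    <= (v ^ k - u ^ k) * (1 - FN w N u).
Proof.
  intros HN Huv; unfold truncated_moment, FN; rewrite <- Rmult_minus_distr_l, <- sumR_minus.
  assert (HI : 0 < INR N) by now apply lt_0_INR.
  assert (E : forall t, (v ^ k - u ^ k) * (1 - / INR N * sumR (seq 0 N)
    (fun i => if Rle_dec (w N i) t then 1 else 0)) = / INR N * sumR (seq 0 N)
    (fun i => (v ^ k - u ^ k) * (1 - (if Rle_dec (w N i) t then 1 else 0)))).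
  { intros t; rewrite sumR_scal, sumR_minus, sumR_seq_const; field; lra. }
  rewrite !E; split; (apply Rmult_le_compat_l; [left; apply Rinv_0_lt_compat, HI|]);
    apply sumR_seq_le; intros i Hi; apply Rmin_pow_increment_bounds; auto.
Qed.

Section Order.
Context {k : nat}.
Let g := fun x => INR k * x ^ (k - 1) * (1 - F x).
Context (Hint : forall b, 0 <= b -> ex_RInt g 0 b).

Lemma ex_RInt_moment u v : 0 <= u <= v -> ex_RInt g u v.
Proof.
  intros H; apply (ex_RInt_Chasles_2 (V := R_CompleteNormedModule) g 0 u v); [lra|apply Hint; lra].
Qed.

Lemma RInt_moment_bounds u v : 0 <= u <= v ->
  (v ^ k - u ^ k) * (1 - F v) <= RInt g u v <= (v ^ k - u ^ k) * (1 - F u).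
Proof.
  intros H.
  assert (E : forall c, is_RInt (fun x => c * (INR k * x ^ (k - 1))) u v (c * (v ^ k - u ^ k)))
    by (intros c; apply (is_RInt_scal (V := R_NormedModule)), is_RInt_pow).
  assert (P : forall x, u < x < v -> 0 <= INR k * x ^ (k - 1))
    by (intros x Hx; apply Rmult_le_pos; [apply pos_INR|apply pow_le; lra]).
  split.
  - rewrite Rmult_comm, <- (is_RInt_unique _ _ _ _ (E _)).
    apply RInt_le; [lra|eexists; apply E|now apply ex_RInt_moment|].
    intros x Hx; unfold g; rewrite Rmult_comm; apply Rmult_le_compat_l; auto.
    generalize (Hmono x v); lra.
  - rewrite Rmult_comm, <- (is_RInt_unique _ _ _ _ (E _)).
    apply RInt_le; [lra|now apply ex_RInt_moment|eexists; apply E|].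
    intros x Hx; unfold g; rewrite (Rmult_comm (1 - F u)); apply Rmult_le_compat_l; auto.
    generalize (Hmono u x); lra.
Qed.

(** On a cell shorter than d both quantities lie, up to small errors, between (v^k - u^k)(1 - F v)
    and (v^k - u^k)(1 - F u), and v^k - u^k is at most k a^(k-1) d. The gaps are proportional to F v
    - F u and telescope, so the main bound does not grow with the number of cells. *)
Lemma moment_cells a d : 0 < d -> forall n u v, 0 <= u < v -> v <= a ->
  continuity_pt F u -> continuity_pt F v -> v - u < INR n * d ->
  forall del, 0 < del -> eventually (fun N =>
    Rabs (truncated_moment w N k v - truncated_moment w N k u - RInt g u v)
      <= INR k * a ^ (k - 1) * d * (F v - F u) + del).
Proof.
  intros Hd n; set (L := INR k * a ^ (k - 1)).
  induction n as [|n IH]; intros u v Huv Hva Hcu Hcv Hn del Hdel.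
  { simpl in Hn; lra. }
  assert (HL : 0 <= L) by (apply Rmult_le_pos; [apply pos_INR|apply pow_le; lra]).
  destruct (Rlt_dec (v - u) d) as [Hs|Hs].
  - assert (Hp := pow_increment_le k u v a ltac:(lra) Hva); fold L in Hp.
    assert (Hp0 : 0 <= v ^ k - u ^ k) by (generalize (pow_incr u v k); lra).
    set (q := v ^ k - u ^ k) in *.
    assert (HqL : q <= L * d) by (apply Rle_trans with (L * (v - u)); nra).
    set (e := del / (q + 1)); assert (He : 0 < e) by (apply Rdiv_lt_0_compat; lra).
    assert (Hqe : q * e <= del).
    { unfold e; apply (Rmult_le_reg_r (q + 1)); [lra|].
      replace (q * (del / (q + 1)) * (q + 1)) with (q * del) by (field; lra); nra. }
    destruct (Hconv u Hcu e He) as [N1 H1]; destruct (Hconv v Hcv e He) as [N2 H2].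
    exists (S (N1 + N2)); intros N HN; specialize (H1 N ltac:(lia)); specialize (H2 N ltac:(lia)).
    assert (HT := truncated_moment_increment N k u v ltac:(lia) ltac:(lra)); fold q in HT.
    assert (HR := RInt_moment_bounds u v ltac:(lra)); fold q in HR.
    unfold Rdist in *; apply Rabs_def2 in H1; apply Rabs_def2 in H2.
    assert (HFm := Hmono u v ltac:(lra)).
    assert (q * (F v - F u) <= L * d * (F v - F u)) by (apply Rmult_le_compat_r; lra).
    assert (q * (1 - FN w N u) <= q * (1 - F u + e)) by (apply Rmult_le_compat_l; lra).
    assert (q * (1 - F v - e) <= q * (1 - FN w N v)) by (apply Rmult_le_compat_l; lra).
    apply Rabs_le; lra.
  - assert (Hn1 : (1 <= n)%nat).
    { destruct n; [|lia]; simpl in Hn; lra. }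
    assert (Hnd : 1 <= INR n) by (apply le_INR in Hn1; exact Hn1).
    rewrite S_INR in Hn.
    (* The cut [t] is a continuity point below u + d, so the left piece is short, and above v - n d,
       so that the induction hypothesis covers [t, v]. *)
    destruct (monotone_continuity_dense F (Rmax u (v - INR n * d)) (Rmin v (u + d)) Hmono)
      as [t [[Ht1 Ht2] Hct]].
    { apply Rmax_case; apply Rmin_case; nra. }
    assert (Htu : u < t) by (eapply Rle_lt_trans; [apply Rmax_l|exact Ht1]).
    assert (Htn : v - INR n * d < t) by (eapply Rle_lt_trans; [apply Rmax_r|exact Ht1]).
    assert (Htv : t < v) by (eapply Rlt_le_trans; [exact Ht2|apply Rmin_l]).
    assert (Htd : t < u + d) by (eapply Rlt_le_trans; [exact Ht2|apply Rmin_r]).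
    destruct (IH t v ltac:(lra) Hva Hct Hcv ltac:(lra) (del / 2) ltac:(lra)) as [N1 H1].
    destruct (IH u t ltac:(lra) ltac:(lra) Hcu Hct ltac:(nra) (del / 2) ltac:(lra)) as [N2 H2].
    exists (N1 + N2)%nat; intros N HN; specialize (H1 N ltac:(lia)); specialize (H2 N ltac:(lia)).
    rewrite (RInt_Chasles_R g u t v) by (apply ex_RInt_moment; lra).
    apply Rabs_le_between in H1; apply Rabs_le_between in H2; apply Rabs_le; lra.
Qed.

(** [F] may jump at 0, so the cells start at a continuity point u > 0 with u^k <= eps/4; up to u
    both quantities are at most u^k. *)
Lemma truncated_moment_limit a : (1 <= k)%nat -> 0 < a -> continuity_pt F a ->
  is_lim_seq (fun N => truncated_moment w N k a) (RInt g 0 a).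
Proof.
  intros Hk Ha Hca; apply is_lim_seq_le_eps; intros eps He.
  set (L := INR k * a ^ (k - 1)).
  assert (HL : 0 < L).
  { apply Rmult_lt_0_compat; [apply lt_0_INR; lia|apply pow_lt; auto]. }
  destruct (monotone_continuity_dense F 0 (Rmin a (eps / (4 * L))) Hmono) as [u [[Hu1 Hu2] Hcu]].
  { apply Rmin_case; [auto|apply Rdiv_lt_0_compat; lra]. }
  assert (Hua : u < a) by (eapply Rlt_le_trans; [exact Hu2|apply Rmin_l]).
  assert (HuL : u < eps / (4 * L)) by (eapply Rlt_le_trans; [exact Hu2|apply Rmin_r]).
  assert (Hpu : u ^ k <= eps / 4).
  { assert (H := pow_increment_le k 0 u a ltac:(lra) ltac:(lra)); fold L in H.
    rewrite (pow_i k) in H by lia.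
    apply (Rmult_lt_compat_l L) in HuL; [|auto].
    replace (L * (eps / (4 * L))) with (eps / 4) in HuL by (field; lra); lra. }
  set (d := eps / (4 * L)); assert (Hd : 0 < d) by (apply Rdiv_lt_0_compat; lra).
  destruct (INR_unbounded ((a - u) / d)) as [n Hn].
  destruct (moment_cells a d Hd n u a ltac:(lra) ltac:(lra) Hcu Hca) with (del := eps / 4)
    as [N1 H1]; [|lra|].
  { apply (Rmult_lt_compat_r d) in Hn; [|auto].
    replace ((a - u) / d * d) with (a - u) in Hn by (field; lra); lra. }
  exists (S N1); intros N HN; specialize (H1 N ltac:(lia)).
  fold L in H1; replace (L * d) with (eps / 4) in H1 by (unfold d; field; lra).
  rewrite (RInt_Chasles_R g 0 u a) by (apply ex_RInt_moment; lra).
  assert (HT := truncated_moment_increment N k 0 u ltac:(lia) ltac:(lra)).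
  assert (HR := RInt_moment_bounds 0 u ltac:(lra)).
  rewrite (pow_i k), Rminus_0_r in HT, HR by lia.
  assert (HT0 : truncated_moment w N k 0 = 0).
  { unfold truncated_moment; rewrite (sumR_seq_ext N _ (fun _ => 0)).
    - rewrite sumR_seq_const; ring.
    - intros i Hi; rewrite Rmin_right by (left; auto); apply pow_i; lia. }
  assert (HFN : forall x, 0 <= FN w N x <= 1).
  { intros x; assert (HI : 0 < INR N) by (apply lt_0_INR; lia); unfold FN; split.
    - apply Rmult_le_pos; [left; now apply Rinv_0_lt_compat|].
      apply sumR_ge0_in; intros i _; destruct (Rle_dec _ _); lra.
    - apply (Rmult_le_reg_l (INR N)); [auto|]; rewrite <- Rmult_assoc, Rinv_r, Rmult_1_l by lra.
      rewrite <- sumR_seq_const; apply sumR_le; intros i; destruct (Rle_dec _ _); lra. }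
  assert (Hpu0 : 0 <= u ^ k) by (apply pow_le; lra).
  generalize (HFN 0) (HFN u) (H01 0) (H01 u) (H01 a); intros.
  assert (u ^ k * (1 - FN w N 0) <= u ^ k) by nra.
  assert (0 <= u ^ k * (1 - FN w N u)) by nra.
  assert (u ^ k * (1 - F 0) <= u ^ k) by nra.
  assert (0 <= u ^ k * (1 - F u)) by nra.
  assert (eps / 4 * (F a - F u) <= eps / 4) by nra.
  apply Rabs_le_between in H1; apply Rabs_le; lra.
Qed.

Lemma truncated_moment_approx m : (1 <= k)%nat -> MomentW F k m -> forall A eps, 0 < eps ->
  exists a, A <= a /\ 0 < a /\ eventually (fun N => Rabs (truncated_moment w N k a - m) < eps).
Proof.
  intros Hk [_ Hm] A eps He; destruct (Hm (eps / 2) ltac:(lra)) as [M HM].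
  set (T := Rmax 0 (Rmax A M)).
  assert (HT : 0 <= T /\ A <= T /\ M <= T).
  { unfold T; split; [apply Rmax_l|split].
    - apply Rle_trans with (Rmax A M); [apply Rmax_l|apply Rmax_r].
    - apply Rle_trans with (Rmax A M); [apply Rmax_r|apply Rmax_r]. }
  destruct (monotone_continuity_dense F T (T + 1) Hmono ltac:(lra)) as [a [Ha Hca]].
  exists a; split; [lra|split; [lra|]].
  assert (HI : IsRInt g 0 a (RInt g 0 a)) by (apply IsRInt_RInt; split; auto; apply Hint; lra).
  specialize (HM a _ ltac:(lra) HI).
  destruct (proj1 (is_lim_seq_eps _ _) (truncated_moment_limit a Hk ltac:(lra) Hca) (eps / 2)
    ltac:(lra)) as [N HN].
  exists N; intros n Hn; specialize (HN n Hn).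
  apply Rabs_def2 in HN; apply Rabs_def2 in HM; apply Rabs_def1; lra.
Qed.
End Order.

(** Weight regularity states convergence of the second moment. It controls the first: cutting at
    level a loses at most E[W_N^2]/a, and truncated moments converge. *)
Lemma first_moment_limit (m1 m2 : R) : MomentW F 1 m1 -> is_lim_seq (fun N => EWN w N 2) m2 ->
  is_lim_seq (fun N => EWN w N 1) m1.
Proof.
  intros Hm1 Hm2; apply is_lim_seq_le_eps; intros eps He.
  assert (Hint : forall b, 0 <= b -> ex_RInt (fun x => INR 1 * x ^ (1 - 1) * (1 - F x)) 0 b).
  { intros b Hb; destruct (proj1 Hm1 b Hb) as [v Hv]; apply IsRInt_RInt in Hv; apply Hv. }
  assert (Hm20 : 0 <= m2).
  { apply (is_lim_seq_lb _ _ _ Hm2); exists 1%nat; intros N HN; apply Rmult_le_pos.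
    - left; apply Rinv_0_lt_compat, lt_0_INR; lia.
    - apply sumR_ge0_in; intros; apply pow2_ge_0. }
  (* From this level on, E[W_N^2]/a <= eps/2 as soon as E[W_N^2] <= m2 + 1. *)
  destruct (truncated_moment_approx Hint m1 (Nat.le_refl 1) Hm1 ((m2 + 1) * 2 / eps) (eps / 2)
    ltac:(lra)) as [a [HA [Ha [N1 H1]]]].
  destruct (proj1 (is_lim_seq_eps _ _) Hm2 1 ltac:(lra)) as [N2 H2].
  exists (S (N1 + N2)); intros N HN; specialize (H1 N ltac:(lia)); specialize (H2 N ltac:(lia)).
  assert (HI : 0 < / INR N) by (apply Rinv_0_lt_compat, lt_0_INR; lia).
  assert (HB : 0 <= EWN w N 1 - truncated_moment w N 1 a <= EWN w N 2 / a).
  { unfold EWN, truncated_moment; rewrite <- Rmult_minus_distr_l, <- sumR_minus.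
    split; [apply Rmult_le_pos; [lra|]; apply sumR_seq_ge0; intros i Hi; specialize (Hw N i Hi);
      unfold Rmin; destruct (Rle_dec _ _); lra|].
    unfold Rdiv; rewrite Rmult_assoc; apply Rmult_le_compat_l; [lra|].
    rewrite Rmult_comm, <- sumR_scal; apply sumR_seq_le; intros i Hi; specialize (Hw N i Hi).
    assert (Hia : 0 < / a) by now apply Rinv_0_lt_compat.
    unfold Rmin; destruct (Rle_dec _ _) as [Hc|Hc].
    - generalize (pow2_ge_0 (w N i)); nra.
    - apply Rle_trans with (w N i); [simpl; lra|].
      apply (Rmult_le_reg_l a); [auto|]; rewrite <- Rmult_assoc, Rinv_r by lra; nra. }
  assert (HE : EWN w N 2 / a <= eps / 2).
  { apply Rabs_def2 in H2; apply (Rmult_le_reg_r (a * 2 / eps)).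
    - apply Rdiv_lt_0_compat; lra.
    - replace (EWN w N 2 / a * (a * 2 / eps)) with (EWN w N 2 * 2 / eps) by (field; lra).
      replace (eps / 2 * (a * 2 / eps)) with a by (field; lra).
      apply Rle_trans with ((m2 + 1) * 2 / eps); [|exact HA].
      unfold Rdiv; apply Rmult_le_compat_r; [left; now apply Rinv_0_lt_compat|lra]. }
  apply Rabs_def2 in H1; apply Rabs_le; lra.
Qed.

(** The full and the truncated moment are both eventually within eps/2 of [m]: convergence to the
    moment of the limit excludes an escape of mass to infinity. *)
Lemma uniformly_integrable (m : R) k : (1 <= k)%nat -> MomentW F k m ->
  is_lim_seq (fun N => EWN w N k) m -> forall eps, 0 < eps -> exists a, 0 < a /\
  eventually (fun N => EWN w N k - truncated_moment w N k a <= eps).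
Proof.
  intros Hk Hm Hl eps He.
  assert (Hint : forall b, 0 <= b -> ex_RInt (fun x => INR k * x ^ (k - 1) * (1 - F x)) 0 b).
  { intros b Hb; destruct (proj1 Hm b Hb) as [v Hv]; apply IsRInt_RInt in Hv; apply Hv. }
  destruct (truncated_moment_approx Hint m Hk Hm 0 (eps / 2) ltac:(lra)) as [a [_ [Ha [N1 H1]]]].
  destruct (proj1 (is_lim_seq_eps _ _) Hl (eps / 2) ltac:(lra)) as [N2 H2].
  exists a; split; [auto|]; exists (N1 + N2)%nat; intros N HN.
  specialize (H1 N ltac:(lia)); specialize (H2 N ltac:(lia)).
  apply Rabs_def2 in H1; apply Rabs_def2 in H2; lra.
Qed.
End Moments.

Lemma IsCDF_bounds F : IsCDF F -> forall x, 0 <= F x <= 1.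
Proof.
  intros [Hm [_ [Hl Hr]]] x; split.
  - apply Rnot_lt_le; intros H; destruct (Hl (- F x) ltac:(lra)) as [M HM].
    specialize (HM (Rmin x (- M)) (Rmin_r _ _)).
    specialize (Hm (Rmin x (- M)) x (Rmin_l _ _)).
    rewrite Rabs_left1 in HM; lra.
  - apply Rnot_lt_le; intros H; destruct (Hr (F x - 1) ltac:(lra)) as [M HM].
    specialize (HM (Rmax x M) (Rmax_r _ _)).
    specialize (Hm x (Rmax x M) (Rmax_l _ _)).
    rewrite Rabs_pos_eq in HM; lra.
Qed.

(** * Powers of the system size *)

Lemma Rpower_gt0 x y : 0 < Rpower x y.
Proof. apply exp_pos. Qed.

Lemma Rpower_pow_nat x y n : Rpower x y ^ n = Rpower x (INR n * y).
Proof.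
  rewrite <- Rpower_pow by apply Rpower_gt0.
  now rewrite Rpower_mult, Rmult_comm.
Qed.

Lemma Rpower_neg_small p eps y : 0 < p -> 0 < eps -> Rpower eps (- / p) < y ->
  Rpower y (- p) < eps.
Proof.
  intros Hp He Hy; assert (H := Rpower_gt0 eps (- / p)); rewrite Rpower_Ropp.
  assert (H1 : Rpower (Rpower eps (- / p)) p < Rpower y p)
    by (apply Rlt_Rpower_l; lra).
  rewrite Rpower_mult in H1; replace (- / p * p) with (Ropp 1) in H1 by (field; lra).
  rewrite Rpower_Ropp, Rpower_1 in H1 by auto.
  rewrite <- (Rinv_inv eps); apply Rinv_lt_contravar; [|auto].
  apply Rmult_lt_0_compat; [now apply Rinv_0_lt_compat|apply Rpower_gt0].
Qed.

Lemma is_lim_seq_Rpower_neg p : 0 < p -> is_lim_seq (fun N => Rpower (INR N) (- p)) 0.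
Proof.
  intros Hp; apply is_lim_seq_eps; intros eps He.
  destruct (eventually_INR_ge (Rpower eps (- / p) + 1)) as [N HN].
  exists N; intros n Hn; specialize (HN n Hn).
  rewrite Rminus_0_r, Rabs_pos_eq by (left; apply Rpower_gt0).
  apply Rpower_neg_small; auto; lra.
Qed.

(** The exponent 1 - 2a is negative; the two cases use a = 3/4 and a = (tau-2)/(tau-1). *)
Lemma scale_limit a : / 2 < a -> is_lim_seq (fun N => INR N / Rpower (INR N) a ^ 2) 0.
Proof.
  intros Ha; eapply is_lim_seq_ext_loc; [|apply (is_lim_seq_Rpower_neg (2 * a - 1)); lra].
  exists 1%nat; intros N HN; assert (HI : 0 < INR N) by (apply lt_0_INR; lia).
  rewrite Rpower_pow_nat; rewrite <- (Rpower_1 (INR N)) at 2 by auto.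
  unfold Rdiv; rewrite <- Rpower_Ropp, <- Rpower_plus; f_equal; simpl; ring.
Qed.

(** * Rank-one weights: the smallness conditions common to both cases *)

Section RankOne.
Context {w : nat -> nat -> R} (Hw : forall N i, (i < N)%nat -> 0 < w N i).

Lemma ellN_EWN N : (0 < N)%nat -> ellN w N = INR N * EWN w N 1.
Proof.
  intros HN; unfold ellN, EWN; rewrite (sumR_ext _ (fun i => w N i ^ 1) (w N)) by (intros; ring).
  field; apply Rgt_not_eq, lt_0_INR; lia.
Qed.

Lemma EWN_gt0 N k : (0 < N)%nat -> 0 < EWN w N k.
Proof.
  intros HN; apply Rmult_lt_0_compat; [apply Rinv_0_lt_compat, lt_0_INR; lia|].
  apply sumR_seq_gt0; auto; intros; apply pow_lt; auto.
Qed.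

Lemma EWN_sqr_le N k : (0 < N)%nat -> EWN w N k ^ 2 <= EWN w N (2 * k).
Proof.
  intros HN; assert (HI : 0 < INR N) by (apply lt_0_INR; lia).
  unfold EWN; assert (H := sumR_sqr_le (seq 0 N) (fun i => w N i ^ k)).
  rewrite length_seq in H; rewrite (sumR_ext _ (fun i => w N i ^ (2 * k))
    (fun i => (w N i ^ k) ^ 2)).
  - rewrite Rpow_mult_distr; set (S := sumR _ (fun i => w N i ^ k)) in *.
    set (Q := sumR _ (fun i => (w N i ^ k) ^ 2)) in *.
    apply Rle_trans with ((/ INR N) ^ 2 * (INR N * Q)); [|right; field; lra].
    apply Rmult_le_compat_l; [apply pow2_ge_0|exact H].
  - intros i; rewrite Nat.mul_comm; apply pow_mult.
Qed.

Lemma scaled_sum N c : (0 < N)%nat ->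
  sumR (seq 0 N) (fun i => w N i * (c / ellN w N)) = c.
Proof.
  intros HN; rewrite (sumR_ext _ _ (fun i => c / ellN w N * w N i)) by (intros; ring).
  rewrite sumR_scal; fold (ellN w N); field; apply Rgt_not_eq, (ellN_gt0 Hw N HN).
Qed.

(** Here r sum b_i^2 = nu_N is bounded and r sum b_i^4 <= r B vanishes, so r sum b_i^3 vanishes by
    b^3 <= eta b^2 + b^4/eta. The lower bound on nu_N comes from E[W_N^2] >= E[W_N]^2. *)
Lemma rank_one_convergence (K : nat -> R) f B a (e1 m2 : R) :
  0 < e1 -> is_lim_seq (fun N => EWN w N 1) e1 -> is_lim_seq (fun N => EWN w N 2) m2 ->
  (forall N, K N = Rpower (INR N) a) ->
  regime (fun N i => w N i * (K N / ellN w N)) K f B ->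
  ConvToDensity (fun N => annealedWeight w N (asinh (/ nuN w N)) 0) a f /\
  ConvToDensity (fun N => cwWeight w N (/ nuN w N) 0) a f.
Proof.
  intros He1 H1 H2 HK HR; assert (HK0 := regime_K _ _ _ _ HR).
  set (r := fun N => ellN w N / K N ^ 2).
  assert (Hr : is_lim_seq r 0).
  { apply (is_lim_seq_ext_loc (fun N => EWN w N 1 * (INR N / K N ^ 2))).
    - exists 1%nat; intros N HN; unfold r; rewrite ellN_EWN by lia; unfold Rdiv; ring.
    - replace (Finite 0) with (Finite (e1 * 0)) by (f_equal; ring).
      apply is_lim_seq_mult'; [exact H1|apply HR]. }
  assert (Hnu : is_lim_seq (nuN w) (m2 / e1)) by (apply is_lim_seq_div'; auto; lra).
  assert (Hlow : eventually (fun N => e1 / 2 <= nuN w N)).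
  { destruct (proj1 (is_lim_seq_eps _ _) H1 (e1 / 2) ltac:(lra)) as [N0 HN0].
    exists (S N0); intros N HN; specialize (HN0 N ltac:(lia)); apply Rabs_def2 in HN0.
    assert (Hs := EWN_sqr_le N 1 ltac:(lia)); change (2 * 1)%nat with 2%nat in Hs.
    apply Rle_trans with (EWN w N 1); [lra|].
    unfold nuN; apply (Rmult_le_reg_r (EWN w N 1)); [apply EWN_gt0; lia|].
    replace (EWN w N 2 / EWN w N 1 * EWN w N 1) with (EWN w N 2)
      by (field; apply Rgt_not_eq, EWN_gt0; lia).
    simpl in Hs; lra. }
  apply (converges_to_density Hw K f B a (e1 / 2)); auto; try lra.
  set (b := fun N i => w N i * (K N / ellN w N)) in *.
  change (is_lim_seq (fun N => r N * sumR (seq 0 N) (fun i => b N i ^ 3)) 0).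
  set (V := Rabs (m2 / e1) + 1); assert (HV : 1 <= V)
    by (generalize (Rabs_pos (m2 / e1)); unfold V; lra).
  apply is_lim_seq_le_eps; intros eps He.
  set (eta := eps / (2 * V)); assert (Heta : 0 < eta) by (apply Rdiv_lt_0_compat; lra).
  assert (HB := regime_B _ _ _ _ HR).
  assert (HrB : is_lim_seq (fun N => r N * (B / eta)) 0).
  { replace (Finite 0) with (Rbar_mult (Finite 0) (Finite (B / eta))) by (simpl; f_equal; ring).
    apply is_lim_seq_scal_r, Hr. }
  destruct (proj1 (is_lim_seq_eps _ _) HrB (eps / 2) ltac:(lra)) as [N1 HN1].
  destruct (proj1 (is_lim_seq_eps _ _) Hnu 1 ltac:(lra)) as [N2 HN2].
  destruct (regime_fourth _ _ _ _ HR) as [N3 HN3].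
  exists (S (N1 + N2 + N3)); intros N HN.
  specialize (HN1 N ltac:(lia)); specialize (HN2 N ltac:(lia)); specialize (HN3 N ltac:(lia)).
  assert (Hl := ellN_gt0 Hw N ltac:(lia)).
  assert (Hr0 : 0 < r N) by (apply Rdiv_lt_0_compat; [auto|apply pow_lt; auto]).
  assert (HnuV : nuN w N <= V).
  { unfold V; apply Rabs_def2 in HN2; generalize (Rle_abs (m2 / e1)); lra. }
  assert (Hrsq : r N * sumsq N (b N) = nuN w N).
  { rewrite (nuN_eq Hw) by lia; unfold sumsq.
    rewrite (sumR_ext _ (fun i => b N i ^ 2) (fun i => (K N / ellN w N) ^ 2 * w N i ^ 2))
      by (intros; unfold b; ring).
    rewrite sumR_scal; unfold r; field; split; [lra|apply Rgt_not_eq, HK0]. }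
  assert (Hb : forall i, (i < N)%nat -> 0 < b N i) by apply HR.
  rewrite Rminus_0_r, Rabs_pos_eq.
  2:{ apply Rmult_le_pos; [lra|]; apply sumR_seq_ge0; intros; apply pow_le; left; auto. }
  rewrite Rminus_0_r in HN1; apply Rabs_def2 in HN1.
  apply Rle_trans with (r N * (eta * sumsq N (b N) + / eta * sumR (seq 0 N) (fun i => b N i ^ 4))).
  - apply Rmult_le_compat_l; [lra|]; unfold sumsq; rewrite <- !sumR_scal, <- sumR_plus.
    apply sumR_seq_le; intros i Hi; specialize (Hb i Hi); cbv beta; set (t := b N i) in *.
    apply (Rmult_le_reg_l eta); [auto|].
    replace (eta * (eta * t ^ 2 + / eta * t ^ 4)) with (t ^ 2 * (eta ^ 2 + t ^ 2)) by (field; lra).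
    replace (eta * t ^ 3) with (t ^ 2 * (eta * t)) by ring.
    apply Rmult_le_compat_l; [apply pow2_ge_0|nra].
  - apply Rle_trans with (eta * nuN w N + r N * (B / eta)).
    + rewrite <- Hrsq; unfold Rdiv; rewrite Rmult_plus_distr_l.
      apply Rplus_le_compat; [right; ring|]; apply Rmult_le_compat_l; [lra|].
      rewrite Rmult_comm; apply Rmult_le_compat_r; [left; now apply Rinv_0_lt_compat|auto].
    + assert (eta * nuN w N <= eps / 2).
      { replace (eps / 2) with (eta * V) by (unfold eta; field; lra).
        apply Rmult_le_compat_l; lra. }
      lra.
Qed.

(** * Finite fourth moment *)

(** For b <= eta the Taylor remainder (b y)^6/45 is at most eta^2 y^6 b^4. For b > eta nothing is
    expanded: the whole quartic term is charged to [t * E], in the application the part of w_i^4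
    beyond a truncation level. *)
Lemma quartic_defect b y eta E t : 0 < b -> 0 < eta -> 0 <= E -> (eta < b -> b ^ 4 <= t * E) ->
  0 <= t -> (b * y) ^ 4 / 12 - h (b * y) <= eta ^ 2 * y ^ 6 * b ^ 4 + y ^ 4 * (t * E).
Proof.
  intros Hb Heta HE HbE Ht.
  assert (Hy4 : 0 <= y ^ 4) by (replace (y ^ 4) with ((y ^ 2) ^ 2) by ring; apply pow2_ge_0).
  assert (Hy6 : 0 <= y ^ 6) by (replace (y ^ 6) with ((y ^ 3) ^ 2) by ring; apply pow2_ge_0).
  assert (Hb4 : 0 <= b ^ 4) by (apply pow_le; lra).
  assert (HtE : 0 <= t * E) by now apply Rmult_le_pos.
  assert (HyE : 0 <= y ^ 4 * (t * E)) by now apply Rmult_le_pos.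
  assert (He2 : 0 <= eta ^ 2) by apply pow2_ge_0.
  assert (H0 : 0 <= eta ^ 2 * y ^ 6 * b ^ 4)
    by (apply Rmult_le_pos; [apply Rmult_le_pos|]; auto).
  destruct (Rle_dec b eta) as [Hc|Hc].
  - assert (Hh := h_ge_quartic (b * y)).
    assert ((b * y) ^ 6 <= eta ^ 2 * y ^ 6 * b ^ 4); [|lra].
    replace ((b * y) ^ 6) with (b ^ 2 * (y ^ 6 * b ^ 4)) by ring; rewrite Rmult_assoc.
    apply Rmult_le_compat_r; [now apply Rmult_le_pos|apply pow_incr; lra].
  - assert (Hh := h_ge0 (b * y)).
    assert ((b * y) ^ 4 <= y ^ 4 * (t * E)); [|lra].
    rewrite Rpow_mult_distr, Rmult_comm; apply Rmult_le_compat_l; [auto|apply HbE; lra].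
Qed.

(** K^4 = N^3 makes the sum of b_i^4 equal to E[W_N^4]/E[W_N]^4, and h(t) ~ t^4/12 produces [f]. The
    defect of this approximation is nonnegative; it vanishes because b_i is small except for weights
    beyond a fixed level, whose share of the fourth moment is small by uniform integrability. *)
Lemma fourth_moment_regime (e1 m4 : R) :
  0 < e1 -> is_lim_seq (fun N => EWN w N 1) e1 -> is_lim_seq (fun N => EWN w N 4) m4 ->
  (forall eps, 0 < eps -> exists a, 0 < a /\
    eventually (fun N => EWN w N 4 - truncated_moment w N 4 a <= eps)) ->
  let K := fun N => Rpower (INR N) (3 / (3 + 1)) in
  regime (fun N i => w N i * (K N / ellN w N)) K (fun x => / 12 * m4 / e1 ^ 4 * x ^ 4)
    (m4 / e1 ^ 4 + 1).
Proof.
  intros He1 H1 H4 HUI K.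
  set (b := fun N i => w N i * (K N / ellN w N)).
  assert (He4 : 0 < e1 ^ 4) by now apply pow_lt.
  (* Cauchy-Schwarz twice; it makes m4 positive, hence f(1) > 0. *)
  assert (Hm4 : e1 ^ 4 <= m4).
  { apply (is_lim_seq_le_loc (fun N => EWN w N 1 ^ 4) (fun N => EWN w N 4) (e1 ^ 4) m4); auto.
    - exists 1%nat; intros N HN.
      assert (Ha := EWN_sqr_le N 1 HN); assert (Hb := EWN_sqr_le N 2 HN).
      change (2 * 1)%nat with 2%nat in Ha; change (2 * 2)%nat with 4%nat in Hb.
      eapply Rle_trans; [|exact Hb]; replace (EWN w N 1 ^ 4) with ((EWN w N 1 ^ 2) ^ 2) by ring.
      apply pow_incr; split; [apply pow2_ge_0|auto].
    - apply (is_lim_seq_continuous (fun x => x ^ 4)); [|exact H1].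
      apply derivable_continuous_pt, derivable_pt_pow. }
  assert (HKl : forall N, (0 < N)%nat -> (K N / ellN w N) ^ 4 = / INR N / EWN w N 1 ^ 4).
  { intros N HN; assert (HI : 0 < INR N) by (apply lt_0_INR; lia).
    assert (HE := EWN_gt0 N 1 HN).
    assert (HK4 : K N ^ 4 = INR N ^ 3).
    { unfold K; rewrite Rpower_pow_nat, <- Rpower_pow by auto; f_equal; simpl; field. }
    rewrite ellN_EWN by auto; unfold Rdiv at 1; rewrite Rpow_mult_distr, HK4.
    field; lra. }
  assert (Hb4 : forall N, (0 < N)%nat ->
    sumR (seq 0 N) (fun i => b N i ^ 4) = EWN w N 4 / EWN w N 1 ^ 4).
  { intros N HN; unfold b.
    rewrite (sumR_ext _ _ (fun i => (K N / ellN w N) ^ 4 * w N i ^ 4)) by (intros; ring).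
    rewrite sumR_scal, HKl by auto; unfold EWN at 2, Rdiv; ring. }
  assert (Hb4l : is_lim_seq (fun N => sumR (seq 0 N) (fun i => b N i ^ 4)) (m4 / e1 ^ 4)).
  { apply (is_lim_seq_ext_loc (fun N => EWN w N 4 / EWN w N 1 ^ 4)).
    - exists 1%nat; intros N HN; now rewrite Hb4.
    - apply is_lim_seq_div'; auto; [|lra].
      apply (is_lim_seq_continuous (fun x => x ^ 4)); [|exact H1].
      apply derivable_continuous_pt, derivable_pt_pow. }
  assert (Hbpos : forall N i, (i < N)%nat -> 0 < b N i).
  { intros N i Hi; apply Rmult_lt_0_compat; [auto|].
    apply Rdiv_lt_0_compat; [apply Rpower_gt0|apply (ellN_gt0 Hw); lia]. }
  assert (HBpos : 0 < m4 / e1 ^ 4) by (apply Rdiv_lt_0_compat; lra).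
  split.
  - intros; apply Rpower_gt0.
  - exact Hbpos.
  - intros N HN; now apply scaled_sum.
  - lra.
  - destruct (proj1 (is_lim_seq_eps _ _) Hb4l 1 ltac:(lra)) as [N HN]; exists N; intros n Hn.
    specialize (HN n Hn); apply Rabs_def2 in HN; unfold b in *; lra.
  - apply scale_limit; lra.
  - intros y; fold b; change (fun N => fN N (fun i => w N i * (K N / ellN w N)) y)
      with (fun N => fN N (b N) y).
    assert (Hy4 : 0 <= y ^ 4) by (replace (y ^ 4) with ((y ^ 2) ^ 2) by ring; apply pow2_ge_0).
    assert (Hy6 : 0 <= y ^ 6) by (replace (y ^ 6) with ((y ^ 3) ^ 2) by ring; apply pow2_ge_0).
    set (S4 := fun N => sumR (seq 0 N) (fun i => b N i ^ 4)) in *.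
    apply (is_lim_seq_ext (fun N => y ^ 4 / 12 * S4 N - (y ^ 4 / 12 * S4 N - fN N (b N) y)));
      [intros; ring|].
    replace (Finite (/ 12 * m4 / e1 ^ 4 * y ^ 4))
      with (Finite (y ^ 4 / 12 * (m4 / e1 ^ 4) - 0)) by (f_equal; field; lra).
    apply is_lim_seq_minus'; [apply (is_lim_seq_scal_l _ _ (Finite _)), Hb4l|].
    apply is_lim_seq_le_eps; intros eps He.
    (* The cap at 1 gives eta^2 <= eta, and the 1 added to y^6 avoids a division by zero at y =
       0. *)
    set (B := m4 / e1 ^ 4 + 1); set (eta := Rmin 1 (eps / (2 * (B * (y ^ 6 + 1))))).
    assert (HB0 : 0 < B) by (unfold B; lra).
    assert (HBy : 0 < B * (y ^ 6 + 1)) by (apply Rmult_lt_0_compat; lra).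
    assert (Heta : 0 < eta) by (apply Rmin_case; [lra|apply Rdiv_lt_0_compat; lra]).
    assert (Heta1 : eta <= 1) by apply Rmin_l.
    assert (Heta2 : eta ^ 2 * y ^ 6 * B <= eps / 2).
    { assert (eta <= eps / (2 * (B * (y ^ 6 + 1)))) by apply Rmin_r.
      assert (eta ^ 2 <= eta) by nra.
      apply Rle_trans with (eta * (B * (y ^ 6 + 1))).
      - rewrite Rmult_assoc; apply Rmult_le_compat; [apply pow2_ge_0| |auto|].
        + apply Rmult_le_pos; unfold B; lra.
        + unfold B; nra.
      - replace (eps / 2) with (eps / (2 * (B * (y ^ 6 + 1))) * (B * (y ^ 6 + 1)))
          by (field; lra).
        apply Rmult_le_compat_r; lra. }
    (* Chosen so that 2 e' y^4 / E[W_N]^4 <= eps/2 once E[W_N] >= e1/2. *)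
    set (e' := eps * (e1 / 2) ^ 4 / (4 * (y ^ 4 + 1))).
    assert (Hee : 0 < (e1 / 2) ^ 4) by (apply pow_lt; lra).
    assert (He' : 0 < e') by (apply Rdiv_lt_0_compat; [apply Rmult_lt_0_compat|]; lra).
    destruct (HUI e' He') as [a [Ha [N1 HN1]]].
    destruct (proj1 (is_lim_seq_eps _ _) H1 (e1 / 2) ltac:(lra)) as [N2 HN2].
    destruct (proj1 (is_lim_seq_eps _ _) Hb4l 1 ltac:(lra)) as [N3 HN3].
    assert (HKE : is_lim_seq (fun N => Rpower (INR N) (- (1 / 4))) 0)
      by (apply is_lim_seq_Rpower_neg; lra).
    (* As K/ell = N^(-1/4)/E[W_N], this threshold gives 2 a K/ell <= eta. Then b_i > eta forces w_i
       > 2a, and w_i^4 <= 2 (w_i^4 - a^4) because a^4 <= w_i^4/16: hence the factor [2 * k ^ 4]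
       below. *)
    destruct (proj1 (is_lim_seq_eps _ _) HKE (eta * (e1 / 2) / (2 * a))) as [N4 HN4].
    { apply Rdiv_lt_0_compat; [apply Rmult_lt_0_compat|]; lra. }
    exists (S (N1 + N2 + N3 + N4)); intros N HN.
    specialize (HN1 N ltac:(lia)); specialize (HN2 N ltac:(lia)); specialize (HN3 N ltac:(lia)).
    specialize (HN4 N ltac:(lia)); rewrite Rminus_0_r in HN4.
    apply Rabs_def2 in HN2; apply Rabs_def2 in HN3; apply Rabs_def2 in HN4.
    assert (HN0 : (0 < N)%nat) by lia.
    assert (HI : 0 < INR N) by (apply lt_0_INR; lia).
    assert (HE := EWN_gt0 N 1 HN0); assert (Hl := ellN_gt0 Hw N HN0).
    assert (HKl1 : K N / ellN w N = Rpower (INR N) (- (1 / 4)) / EWN w N 1).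
    { rewrite ellN_EWN by auto; unfold K.
      replace (3 / (3 + 1)) with (- (1 / 4) + 1) by field.
      rewrite Rpower_plus, Rpower_1 by auto; field; lra. }
    assert (Hka : 2 * a * (K N / ellN w N) <= eta).
    { rewrite HKl1; apply (Rmult_le_reg_r (EWN w N 1)); [auto|].
      replace (2 * a * (Rpower (INR N) (- (1 / 4)) / EWN w N 1) * EWN w N 1)
        with (2 * a * Rpower (INR N) (- (1 / 4))) by (field; lra).
      apply Rle_trans with (2 * a * (eta * (e1 / 2) / (2 * a))).
      - apply Rmult_le_compat_l; lra.
      - replace (2 * a * (eta * (e1 / 2) / (2 * a))) with (eta * (e1 / 2)) by (field; lra).
        apply Rmult_le_compat_l; lra. }
    set (k := K N / ellN w N) in *.
    assert (Hk : 0 < k) by (apply Rdiv_lt_0_compat; [apply Rpower_gt0|auto]).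
    assert (Hdef : y ^ 4 / 12 * S4 N - fN N (b N) y =
      sumR (seq 0 N) (fun i => (b N i * y) ^ 4 / 12 - h (b N i * y))).
    { rewrite sumR_minus; unfold fN, S4; rewrite <- sumR_scal; f_equal.
      apply sumR_ext; intros; field. }
    rewrite Rminus_0_r, Hdef, Rabs_pos_eq.
    2:{ apply sumR_ge0_in; intros i _; generalize (h_le_quartic (b N i * y)); lra. }
    apply Rle_trans with (sumR (seq 0 N) (fun i => eta ^ 2 * y ^ 6 * b N i ^ 4 +
      y ^ 4 * ((2 * k ^ 4) * (w N i ^ 4 - Rmin (w N i) a ^ 4)))).
    { assert (Hk4 : 0 < k ^ 4) by now apply pow_lt.
      apply sumR_seq_le; intros i Hi; specialize (Hw N i Hi); apply quartic_defect; auto; [| |lra].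
      - assert (Rmin (w N i) a ^ 4 <= w N i ^ 4); [|lra].
        apply pow_incr; split; [apply Rmin_case; lra|apply Rmin_l].
      - intros Hc; unfold b in Hc; fold k in Hc.
        assert (Hwa : 2 * a < w N i) by (apply (Rmult_lt_reg_r k); lra).
        rewrite Rmin_right by lra.
        assert (Ha4 : (2 * a) ^ 4 <= w N i ^ 4) by (apply pow_incr; lra).
        unfold b; fold k; rewrite Rpow_mult_distr.
        assert (0 <= a ^ 4) by (apply pow_le; lra).
        replace (2 * k ^ 4 * (w N i ^ 4 - a ^ 4)) with ((2 * w N i ^ 4 - 2 * a ^ 4) * k ^ 4) by ring.
        apply Rmult_le_compat_r; [lra|].
        replace ((2 * a) ^ 4) with (16 * a ^ 4) in Ha4 by ring; lra. }
    rewrite sumR_plus, !sumR_scal, sumR_minus; fold (S4 N).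
    replace (2 * k ^ 4 * (sumR (seq 0 N) (fun i => w N i ^ 4) -
      sumR (seq 0 N) (fun i => Rmin (w N i) a ^ 4)))
      with (2 * (EWN w N 4 - truncated_moment w N 4 a) / EWN w N 1 ^ 4).
    2:{ unfold k; rewrite HKl by auto; unfold EWN at 1, truncated_moment; field; lra. }
    assert (Hp1 : eta ^ 2 * y ^ 6 * S4 N <= eps / 2).
    { eapply Rle_trans; [|exact Heta2]; apply Rmult_le_compat_l; [|unfold B; lra].
      apply Rmult_le_pos; [apply pow2_ge_0|auto]. }
    assert (HE4 : (e1 / 2) ^ 4 <= EWN w N 1 ^ 4) by (apply pow_incr; lra).
    assert (Hp2 : y ^ 4 * (2 * (EWN w N 4 - truncated_moment w N 4 a) / EWN w N 1 ^ 4) <= eps / 2).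
    { apply (Rmult_le_reg_r (EWN w N 1 ^ 4)); [lra|].
      replace (y ^ 4 * (2 * (EWN w N 4 - truncated_moment w N 4 a) / EWN w N 1 ^ 4) *
        EWN w N 1 ^ 4) with (y ^ 4 * (2 * (EWN w N 4 - truncated_moment w N 4 a)))
        by (field; lra).
      apply Rle_trans with (eps / 2 * (e1 / 2) ^ 4); [|apply Rmult_le_compat_l; lra].
      apply Rle_trans with ((y ^ 4 + 1) * (2 * e')).
      - apply Rle_trans with (y ^ 4 * (2 * e')); [apply Rmult_le_compat_l; lra|nra].
      - right; unfold e'; field; lra. }
    lra.
  - apply Rmult_lt_0_compat; [|lra]; replace (/ 12 * m4 / e1 ^ 4) with (/ 12 * (m4 / e1 ^ 4))
      by (field; lra); lra.
Qed.

End RankOne.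

Lemma fourth_moment_case w FW m1 m2 m4 :
  (forall N i, (i < N)%nat -> 0 < w N i) -> WeightRegularity w FW m1 m2 ->
  MomentW FW 4 m4 -> Un_cv (fun N => EWN w N 4) m4 ->
  Conclusion w 3 (fun x => / 12 * m4 / m1 ^ 4 * x ^ 4) (/ 12 * m4 / m1 ^ 4).
Proof.
  intros Hw [Hcdf [Hconv [HM1 [HM2 [H2 Hm1]]]]] HM4 H4.
  assert (H01 := IsCDF_bounds FW Hcdf); destruct Hcdf as [Hmono _].
  apply is_lim_seq_Reals in H2; apply is_lim_seq_Reals in H4.
  assert (H1 := first_moment_limit Hw Hmono H01 Hconv m1 m2 HM1 H2).
  assert (HUI := uniformly_integrable Hw Hmono H01 Hconv m4 4 ltac:(lia) HM4 H4).
  assert (HR := fourth_moment_regime Hw m1 m4 Hm1 H1 H4 HUI); cbv zeta in HR.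
  destruct (rank_one_convergence Hw _ _ _ (3 / (3 + 1)) m1 m2 Hm1 H1 H2 (fun N => eq_refl) HR)
    as [Ha Hc].
  split; [exact Ha|split; [exact Hc|]].
  (* The quotient is exactly the constant; x > 0 makes [Rpower] the fourth power. *)
  intros eps He; exists 0; intros x Hx.
  replace (1 + 3) with (INR 4) by (simpl; ring); rewrite Rpower_pow by auto.
  match goal with |- Rabs ?X < _ => replace X with 0 by (field; lra) end.
  now rewrite Rabs_R0.
Qed.

(** * Power-law weights *)

Lemma Rpower_increment x y e : 0 < x < y -> exists c, x < c < y /\
  Rpower y e - Rpower x e = e * Rpower c (e - 1) * (y - x).
Proof.
  intros [Hx Hxy]; destruct (MVT_cor2 (fun t => Rpower t e) (fun t => e * Rpower t (e - 1)) x y Hxy)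
    as [c [E Hc]].
  { intros; apply derivable_pt_lim_power; lra. }
  exists c; auto.
Qed.

Lemma Rpower_neg_anti e x y : 0 < e -> 0 < x <= y -> Rpower y (- e) <= Rpower x (- e).
Proof.
  intros He Hxy; rewrite !Rpower_Ropp; apply Rinv_le_contravar; [apply Rpower_gt0|].
  apply Rle_Rpower_l; lra.
Qed.

(** Vertices are numbered from 0, so vertex i has rank [S i]. *)
Definition zipf (p : R) (i : nat) : R := Rpower (INR (S i)) (- p).

Lemma INR_S_gt0 n : 0 < INR (S n).
Proof. apply lt_0_INR; lia. Qed.

Lemma zipf_gt0 p i : 0 < zipf p i.
Proof. apply Rpower_gt0. Qed.

Lemma Rpower_1_l e : Rpower 1 e = 1.
Proof. unfold Rpower; rewrite ln_1, Rmult_0_r; apply exp_0. Qed.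

(** Comparison with the integral, one cell at a time: by the mean value theorem the increment of
    x^(1-p) over a unit cell is (1-p) c^(-p) for some c inside. *)
Lemma zipf_sum_lower p n : 0 < p < 1 ->
  (Rpower (INR (S n)) (1 - p) - 1) / (1 - p) <= sumR (seq 0 n) (zipf p).
Proof.
  intros Hp; induction n as [|n IH].
  - simpl; rewrite Rpower_1_l; right; field; lra.
  - rewrite sumR_seq_last.
    assert (Hn := INR_S_gt0 n); rewrite (S_INR (S n)).
    destruct (Rpower_increment (INR (S n)) (INR (S n) + 1) (1 - p)) as [c [Hc E]]; [lra|].
    replace (1 - p - 1) with (- p) in E by ring.
    assert (Hz : Rpower c (- p) <= zipf p n) by (apply Rpower_neg_anti; lra).
    apply (Rmult_le_reg_r (1 - p)); [lra|].
    apply (Rmult_le_compat_r (1 - p)) in IH; [|lra].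
    replace ((Rpower (INR (S n)) (1 - p) - 1) / (1 - p) * (1 - p)) with
      (Rpower (INR (S n)) (1 - p) - 1) in IH by (field; lra).
    replace ((Rpower (INR (S n) + 1) (1 - p) - 1) / (1 - p) * (1 - p)) with
      (Rpower (INR (S n) + 1) (1 - p) - 1) by (field; lra).
    assert ((1 - p) * Rpower c (- p) <= (1 - p) * zipf p n) by (apply Rmult_le_compat_l; lra).
    lra.
Qed.

Lemma zipf_sum_upper p n : 0 < p < 1 ->
  sumR (seq 0 (S n)) (zipf p) <= Rpower (INR (S n)) (1 - p) / (1 - p).
Proof.
  intros Hp; induction n as [|n IH].
  - unfold zipf; simpl; rewrite !Rpower_1_l; apply (Rmult_le_reg_r (1 - p)); [lra|].
    replace (1 / (1 - p) * (1 - p)) with 1 by (field; lra); lra.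
  - rewrite sumR_seq_last.
    assert (Hn := INR_S_gt0 n).
    destruct (Rpower_increment (INR (S n)) (INR (S (S n))) (1 - p)) as [c [Hc E]].
    { rewrite (S_INR (S n)); lra. }
    replace (1 - p - 1) with (- p) in E by ring; rewrite (S_INR (S n)) in E at 2.
    assert (Hz : zipf p (S n) <= Rpower c (- p)) by (apply Rpower_neg_anti; lra).
    apply (Rmult_le_reg_r (1 - p)); [lra|].
    apply (Rmult_le_compat_r (1 - p)) in IH; [|lra].
    replace (Rpower (INR (S n)) (1 - p) / (1 - p) * (1 - p)) with
      (Rpower (INR (S n)) (1 - p)) in IH by (field; lra).
    replace (Rpower (INR (S (S n))) (1 - p) / (1 - p) * (1 - p)) with
      (Rpower (INR (S (S n))) (1 - p)) by (field; lra).
    assert ((1 - p) * zipf p (S n) <= (1 - p) * Rpower c (- p)) by (apply Rmult_le_compat_l; lra).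
    lra.
Qed.

Lemma zipf_sum_bounded p n : 1 < p -> sumR (seq 0 n) (zipf p) <= 1 + / (p - 1).
Proof.
  intros Hp; assert (Hi : 0 < / (p - 1)) by (apply Rinv_0_lt_compat; lra).
  destruct n as [|n]; [simpl; lra|].
  enough (sumR (seq 0 (S n)) (zipf p) <= 1 + (1 - Rpower (INR (S n)) (1 - p)) * / (p - 1)).
  { generalize (Rpower_gt0 (INR (S n)) (1 - p)); nra. }
  induction n as [|n IH].
  - unfold zipf; simpl; rewrite !Rpower_1_l; lra.
  - rewrite sumR_seq_last.
    assert (Hn := INR_S_gt0 n).
    destruct (Rpower_increment (INR (S n)) (INR (S (S n))) (1 - p)) as [c [Hc E]].
    { rewrite (S_INR (S n)); lra. }
    replace (1 - p - 1) with (- p) in E by ring; rewrite (S_INR (S n)) in E at 2.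
    assert (Hz : zipf p (S n) <= Rpower c (- p)) by (apply Rpower_neg_anti; lra).
    assert (Rpower c (- p) = (Rpower (INR (S n)) (1 - p) - Rpower (INR (S (S n))) (1 - p))
      * / (p - 1)).
    { apply (Rmult_eq_reg_r (p - 1)); [|lra].
      rewrite Rmult_assoc, Rinv_l by lra; lra. }
    lra.
Qed.

Lemma zipf_pow4 p i : zipf p i ^ 4 = zipf (4 * p) i.
Proof. unfold zipf; rewrite Rpower_pow_nat; f_equal; simpl; ring. Qed.

Lemma zipf_mean_limit p : 0 < p < 1 ->
  is_lim_seq (fun N => Rpower (INR N) (p - 1) * sumR (seq 0 N) (zipf p)) (/ (1 - p)).
Proof.
  intros Hp; assert (Hi : 0 < / (1 - p)) by (apply Rinv_0_lt_compat; lra).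
  apply (is_lim_seq_le_le_loc (fun N => (1 - Rpower (INR N) (- (1 - p))) * / (1 - p)) _
    (fun _ => / (1 - p))).
  - exists 1%nat; intros N HN; assert (HI : 0 < INR N) by (apply lt_0_INR; lia).
    assert (E : Rpower (INR N) (p - 1) * Rpower (INR N) (1 - p) = 1).
    { rewrite <- Rpower_plus; replace (p - 1 + (1 - p)) with 0 by ring; now apply Rpower_O. }
    assert (HP := Rpower_gt0 (INR N) (p - 1)).
    split.
    + replace (- (1 - p)) with (p - 1) by ring.
      apply Rle_trans with (Rpower (INR N) (p - 1) *
        ((Rpower (INR (S N)) (1 - p) - 1) / (1 - p))).
      * replace ((1 - Rpower (INR N) (p - 1)) * / (1 - p)) with
          (Rpower (INR N) (p - 1) * ((Rpower (INR N) (1 - p) - 1) / (1 - p)))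
          by (unfold Rdiv; rewrite <- Rmult_assoc, Rmult_minus_distr_l, E; ring).
        apply Rmult_le_compat_l; [lra|]; apply Rmult_le_compat_r; [lra|].
        apply Rplus_le_compat_r, Rle_Rpower_l; [lra|rewrite S_INR; lra].
      * apply Rmult_le_compat_l; [lra|now apply zipf_sum_lower].
    + destruct N as [|N]; [lia|].
      apply Rle_trans with (Rpower (INR (S N)) (p - 1) * (Rpower (INR (S N)) (1 - p) / (1 - p))).
      * apply Rmult_le_compat_l; [lra|now apply zipf_sum_upper].
      * unfold Rdiv; rewrite <- Rmult_assoc, E; lra.
  - replace (Finite (/ (1 - p))) with (Finite ((1 - 0) * / (1 - p))) by (f_equal; ring).
    apply is_lim_seq_mult'; [|apply is_lim_seq_const].
    apply is_lim_seq_minus'; [apply is_lim_seq_const|apply is_lim_seq_Rpower_neg; lra].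
  - apply is_lim_seq_const.
Qed.

Section PowerLaw.
(** [al] stands for 1/(tau-1), and 3 < tau < 5 is this range. The lower end makes the sum of i^(-4
    al) and the limit integral at infinity converge; the upper end makes y^(-2 al) integrable at
    0. *)
Context {al : R} (Hal : / 4 < al < / 2).

Definition zipf_series (x : R) : R := Series (fun n => h (x * zipf al n)).

Lemma h_zipf_le x n : 0 <= h (x * zipf al n) <= x ^ 4 * zipf (4 * al) n.
Proof.
  split; [apply h_ge0|]; eapply Rle_trans; [apply h_le_quartic|].
  rewrite Rpow_mult_distr, zipf_pow4.
  assert (0 <= x ^ 4 * zipf (4 * al) n); [|lra].
  apply Rmult_le_pos; [|left; apply zipf_gt0].
  replace (x ^ 4) with ((x ^ 2) ^ 2) by ring; apply pow2_ge_0.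
Qed.

Lemma sum_n_sumR (u : nat -> R) n : sum_n u n = sumR (seq 0 (S n)) u.
Proof.
  induction n as [|n IH]; [rewrite sum_O; simpl; ring|].
  rewrite sum_Sn, sumR_seq_last, IH; reflexivity.
Qed.

Lemma zipf_series_correct x : is_series (fun n => h (x * zipf al n)) (zipf_series x).
Proof.
  apply Series_correct; apply ex_finite_lim_seq_incr with (M := x ^ 4 * (1 + / (4 * al - 1))).
  - intros n; rewrite sum_Sn; generalize (h_ge0 (x * zipf al (S n))); unfold plus; simpl; lra.
  - intros n; rewrite sum_n_sumR.
    apply Rle_trans with (sumR (seq 0 (S n)) (fun i => x ^ 4 * zipf (4 * al) i)).
    + apply sumR_le; intros i; apply h_zipf_le.
    + rewrite sumR_scal; apply Rmult_le_compat_l; [|apply zipf_sum_bounded; lra].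
      replace (x ^ 4) with ((x ^ 2) ^ 2) by ring; apply pow2_ge_0.
Qed.

Lemma zipf_series_partial x :
  is_lim_seq (fun N => sumR (seq 0 N) (fun i => h (x * zipf al i))) (zipf_series x).
Proof.
  apply is_lim_seq_incr_1.
  apply (is_lim_seq_ext (sum_n (fun n => h (x * zipf al n)))); [intros; apply sum_n_sumR|].
  apply zipf_series_correct.
Qed.

(* The integrand of the limit constant; its Riemann sums with mesh eta are the series. *)
Definition profile (y : R) : R := h (Rpower y (- al)).

Lemma profile_ge0 y : 0 <= profile y.
Proof. apply h_ge0. Qed.

Lemma profile_anti x y : 0 < x <= y -> profile y <= profile x.
Proof.
  intros Hxy; apply h_mono; split; [left; apply Rpower_gt0|apply Rpower_neg_anti; lra].
Qed.

Lemma continuous_profile y : 0 < y -> continuous profile y.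
Proof.
  intros Hy; apply (continuous_comp (fun y => Rpower y (- al)) h); [|apply continuous_h].
  apply (ex_derive_continuous (V := R_NormedModule)).
  exists (- al * Rpower y (- al - 1)); now apply is_derive_Reals, derivable_pt_lim_power.
Qed.

Lemma ex_RInt_pos (u : R -> R) a b : (forall y, 0 < y -> continuous u y) -> 0 < a <= b ->
  ex_RInt u a b.
Proof.
  intros H Hab; apply (ex_RInt_continuous (V := R_CompleteNormedModule)); intros z Hz.
  rewrite Rmin_left in Hz by lra; apply H; lra.
Qed.

Lemma continuous_Rpower e y : 0 < y -> continuous (fun y => Rpower y e) y.
Proof.
  intros Hy; apply (ex_derive_continuous (V := R_NormedModule)).
  exists (e * Rpower y (e - 1)); now apply is_derive_Reals, derivable_pt_lim_power.
Qed.

Lemma is_RInt_Rpower e k a b : 0 < a <= b -> e <> 0 ->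
  is_RInt (fun y => k * Rpower y (e - 1)) a b (k / e * Rpower b e - k / e * Rpower a e).
Proof.
  intros Hab He.
  apply (is_RInt_derive (V := R_CompleteNormedModule) (fun y => k / e * Rpower y e)).
  - intros x Hx; rewrite Rmin_left in Hx by lra.
    replace (k * Rpower x (e - 1)) with (k / e * (e * Rpower x (e - 1))) by (field; auto).
    apply (is_derive_scal (fun y => Rpower y e)), is_derive_Reals, derivable_pt_lim_power; lra.
  - intros x Hx; rewrite Rmin_left in Hx by lra.
    apply (continuous_scal_r (V := R_NormedModule) k (fun y => Rpower y (e - 1))).
    apply continuous_Rpower; lra.
Qed.

Lemma RInt_profile_ge0 a b : 0 < a <= b -> 0 <= RInt profile a b.
Proof.
  intros Hab; apply RInt_ge_0; [lra|apply ex_RInt_pos; auto using continuous_profile|].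
  intros; apply profile_ge0.
Qed.

(** This and [right_tail] are the integrals of y^(-2 al)/2 over (0, a] and of y^(-4 al) over [b,
    infinity), majorants from the quadratic and the quartic bound on [h]. *)
Definition left_tail (a : R) : R := / 2 / (1 - 2 * al) * Rpower a (1 - 2 * al).
Definition right_tail (b : R) : R := / (4 * al - 1) * Rpower b (- (4 * al - 1)).

Lemma profile_le_quadratic y : profile y <= / 2 * Rpower y (1 - 2 * al - 1).
Proof.
  eapply Rle_trans; [apply h_le_quadratic|]; rewrite Rpower_pow_nat.
  replace (INR 2 * - al) with (1 - 2 * al - 1) by (simpl; ring); lra.
Qed.

Lemma RInt_profile_left a b : 0 < a <= b -> RInt profile a b <= left_tail b.
Proof.
  intros Hab; assert (H : is_RInt (fun y => / 2 * Rpower y (1 - 2 * al - 1)) a b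
    (left_tail b - left_tail a)) by (apply is_RInt_Rpower; lra).
  apply Rle_trans with (left_tail b - left_tail a).
  - rewrite <- (is_RInt_unique _ _ _ _ H).
    apply RInt_le; [lra|apply ex_RInt_pos; auto using continuous_profile|eexists; apply H|].
    intros; apply profile_le_quadratic.
  - assert (0 <= left_tail a); [|lra].
    apply Rmult_le_pos; [|left; apply Rpower_gt0].
    apply Rmult_le_pos; [lra|left; apply Rinv_0_lt_compat; lra].
Qed.

Lemma RInt_profile_right a b : 0 < a <= b -> RInt profile a b <= right_tail a.
Proof.
  intros Hab; assert (H : is_RInt (fun y => 1 * Rpower y (- (4 * al - 1) - 1)) a b
    (1 / - (4 * al - 1) * Rpower b (- (4 * al - 1)) - 1 / - (4 * al - 1) *
      Rpower a (- (4 * al - 1)))) by (apply is_RInt_Rpower; lra).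
  assert (Hr : 0 < / (4 * al - 1)) by (apply Rinv_0_lt_compat; lra).
  apply Rle_trans with (right_tail a - right_tail b).
  - apply Rle_trans with (RInt (fun y => 1 * Rpower y (- (4 * al - 1) - 1)) a b).
    + apply RInt_le; [lra|apply ex_RInt_pos; auto using continuous_profile|eexists; apply H|].
      intros y _; eapply Rle_trans; [apply h_le_quartic|]; rewrite Rpower_pow_nat.
      replace (INR 4 * - al) with (- (4 * al - 1) - 1) by (simpl; ring).
      generalize (Rpower_gt0 y (- (4 * al - 1) - 1)); lra.
    + rewrite (is_RInt_unique _ _ _ _ H); right; unfold right_tail; field; lra.
  - assert (0 <= right_tail b); [|lra].
    apply Rmult_le_pos; [lra|left; apply Rpower_gt0].
Qed.

Lemma left_tail_mono a b : 0 < a <= b -> left_tail a <= left_tail b.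
Proof.
  intros H; apply Rmult_le_compat_l; [|apply Rle_Rpower_l; lra].
  apply Rmult_le_pos; [lra|left; apply Rinv_0_lt_compat; lra].
Qed.

Lemma right_tail_anti a b : 0 < a <= b -> right_tail b <= right_tail a.
Proof.
  intros H; apply Rmult_le_compat_l; [left; apply Rinv_0_lt_compat; lra|].
  apply Rpower_neg_anti; lra.
Qed.

Lemma is_lim_seq_right_tail : is_lim_seq (fun n => right_tail (INR (S n))) 0.
Proof.
  apply (is_lim_seq_incr_1 (fun n => right_tail (INR n))).
  replace (Finite 0) with (Rbar_mult (/ (4 * al - 1)) 0) by (simpl; f_equal; ring).
  apply is_lim_seq_scal_l, is_lim_seq_Rpower_neg; lra.
Qed.

Lemma is_lim_seq_left_tail : is_lim_seq (fun n => left_tail (/ INR (S n))) 0.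
Proof.
  apply (is_lim_seq_incr_1 (fun n => left_tail (/ INR n))).
  replace (Finite 0) with (Rbar_mult (/ 2 / (1 - 2 * al)) 0) by (simpl; f_equal; ring).
  apply is_lim_seq_scal_l.
  eapply is_lim_seq_ext_loc; [|apply (is_lim_seq_Rpower_neg (1 - 2 * al)); lra].
  exists 1%nat; intros n Hn; assert (0 < INR n) by (apply lt_0_INR; lia).
  unfold Rpower; rewrite ln_Rinv by auto; f_equal; ring.
Qed.

(** An instance of [net_limit] on the intervals [1/(n+1), n+1]. The explicit error is exported
    because it provides the rate in [zipf_series_mesh]. *)
Lemma profile_integral : exists I, 0 < I /\ ImpIntOpen0Inf profile I /\
  forall a b, 0 < a <= b -> Rabs (RInt profile a b - I) <= left_tail a + right_tail b.
Proof.
  assert (Hex : forall a b, 0 < a <= b -> ex_RInt profile a b)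
    by (intros; apply ex_RInt_pos; auto using continuous_profile).
  assert (Hdom : forall n, 0 < / INR (S n) <= INR (S n)).
  { intros n; assert (H := INR_S_gt0 n); split; [now apply Rinv_0_lt_compat|].
    assert (H1 : 1 <= INR (S n)) by (rewrite S_INR; generalize (pos_INR n); lra).
    apply Rle_trans with 1; [|auto]; rewrite <- Rinv_1; apply Rinv_le_contravar; lra. }
  assert (Hlim0 : is_lim_seq (fun n => left_tail (/ INR (S n)) + right_tail (INR (S n))) 0).
  { replace (Finite 0) with (Finite (0 + 0)) by (f_equal; ring).
    apply is_lim_seq_plus'; [apply is_lim_seq_left_tail|apply is_lim_seq_right_tail]. }
  assert (Hlarge : forall a b, 0 < a <= b ->
    eventually (fun n => / INR (S n) <= a /\ b <= INR (S n))).
  { intros a b Hab; destruct (eventually_INR_ge (Rmax b (/ a))) as [n0 Hn0].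
    exists n0; intros n Hn; specialize (Hn0 n Hn); rewrite S_INR.
    generalize (Rmax_l b (/ a)) (Rmax_r b (/ a)); intros.
    assert (0 < / a) by (apply Rinv_0_lt_compat; lra).
    split; [|lra]; rewrite <- (Rinv_inv a); apply Rinv_le_contravar; lra. }
  destruct (net_limit (RInt profile) (fun a b => 0 < a <= b) left_tail right_tail
    (fun n => / INR (S n)) (fun n => INR (S n)) Hdom Hlim0) as [I [HI1 HI2]].
  { intros a b Hab; destruct (Hlarge a b Hab) as [n0 Hn0]; exists n0; intros n Hn.
    destruct (Hn0 n Hn) as [Ha Hb]; assert (Hd := Hdom n).
    rewrite (RInt_Chasles_R profile (/ INR (S n)) a (INR (S n))) by (apply Hex; lra).
    rewrite (RInt_Chasles_R profile a b (INR (S n))) by (apply Hex; lra).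
    assert (L1 := RInt_profile_left (/ INR (S n)) a ltac:(lra)).
    assert (L2 := RInt_profile_right b (INR (S n)) ltac:(lra)).
    assert (L3 := RInt_profile_ge0 (/ INR (S n)) a ltac:(lra)).
    assert (L4 := RInt_profile_ge0 b (INR (S n)) ltac:(lra)).
    apply Rabs_le; lra. }
  exists I; split; [|split; [|exact HI2]].
  - apply Rlt_le_trans with (RInt profile 1 2).
    + apply RInt_gt_0; [lra| |intros; apply continuous_profile; lra].
      intros; apply h_gt0, Rpower_gt0.
    + apply (is_lim_seq_lb _ _ _ HI1); destruct (Hlarge 1 2 ltac:(lra)) as [n0 Hn0].
      exists n0; intros n Hn; destruct (Hn0 n Hn) as [Ha Hb]; assert (Hd := Hdom n).
      rewrite (RInt_Chasles_R profile (/ INR (S n)) 1 (INR (S n))) by (apply Hex; lra).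
      rewrite (RInt_Chasles_R profile 1 2 (INR (S n))) by (apply Hex; lra).
      assert (L3 := RInt_profile_ge0 (/ INR (S n)) 1 ltac:(lra)).
      assert (L4 := RInt_profile_ge0 2 (INR (S n)) ltac:(lra)); lra.
  - split.
    + intros a b Ha Hab; exists (RInt profile a b); apply IsRInt_RInt; auto.
    + intros eps He; destruct (proj1 (is_lim_seq_eps _ _) Hlim0 eps He) as [n Hn].
      specialize (Hn n (Nat.le_refl n)); rewrite Rminus_0_r in Hn; apply Rabs_def2 in Hn.
      assert (Hd := Hdom n); exists (/ INR (S n)); split; [apply Hd|exists (INR (S n))].
      intros a b v' Ha Had Hb Hv; apply IsRInt_RInt in Hv; destruct Hv as [_ <-].
      eapply Rle_lt_trans; [apply HI2; lra|].
      generalize (left_tail_mono a (/ INR (S n)) ltac:(lra))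
        (right_tail_anti (INR (S n)) b ltac:(lra)); lra.
Qed.

Lemma RInt_profile_cell x y : 0 < x <= y ->
  (y - x) * profile y <= RInt profile x y <= (y - x) * profile x.
Proof.
  intros H.
  assert (Hex : ex_RInt profile x y) by (apply ex_RInt_pos; auto using continuous_profile).
  assert (E : forall c, RInt (fun _ => c) x y = (y - x) * c)
    by (intros c; rewrite RInt_const; reflexivity).
  split.
  - rewrite <- E; apply RInt_le; [lra|apply ex_RInt_const|auto|].
    intros t Ht; apply profile_anti; lra.
  - rewrite <- E; apply RInt_le; [lra|auto|apply ex_RInt_const|].
    intros t Ht; apply profile_anti; lra.
Qed.

(** As [profile] decreases, each term dominates the integral over the cell to its right and, except
    for the first, is dominated by that over the cell to its left. The first term stays apart since
    its left cell touches 0. *)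
Lemma profile_riemann_sum eta k : 0 < eta ->
  RInt profile eta (INR (S (S k)) * eta) <=
    eta * sumR (seq 0 (S k)) (fun i => profile (INR (S i) * eta)) <=
  eta * profile eta + RInt profile eta (INR (S k) * eta).
Proof.
  intros He.
  assert (Hcell : forall j, eta * profile (INR (S (S j)) * eta)
    <= RInt profile (INR (S j) * eta) (INR (S (S j)) * eta)
    <= eta * profile (INR (S j) * eta)).
  { intros j; assert (Hj := INR_S_gt0 j); rewrite (S_INR (S j)).
    assert (H := RInt_profile_cell (INR (S j) * eta) ((INR (S j) + 1) * eta)).
    replace ((INR (S j) + 1) * eta - INR (S j) * eta) with eta in H by ring.
    apply H; nra. }
  assert (Hch : forall j, RInt profile eta (INR (S (S j)) * eta) =
    RInt profile eta (INR (S j) * eta) + RInt profile (INR (S j) * eta) (INR (S (S j)) * eta)).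
  { intros j; assert (Hj := pos_INR j); rewrite !S_INR.
    apply RInt_Chasles_R; apply ex_RInt_pos; auto using continuous_profile; nra. }
  assert (H1 : RInt profile eta (INR 1 * eta) = 0).
  { simpl; rewrite Rmult_1_l; apply (RInt_point (V := R_CompleteNormedModule)). }
  induction k as [|k IH].
  - assert (Hc := Hcell 0%nat); rewrite Hch, H1; simpl in *.
    rewrite Rmult_1_l in Hc |- *; lra.
  - rewrite sumR_seq_last, Rmult_plus_distr_l.
    generalize (Hch k) (Hch (S k)) (Hcell k) (Hcell (S k)); lra.
Qed.

(** For x = eta^(-al), x (i+1)^(-al) = ((i+1) eta)^(-al): the series becomes a Riemann sum of mesh
    eta, up to the factor eta. *)
Lemma zipf_series_profile eta : 0 < eta ->
  is_lim_seq (fun k => sumR (seq 0 k) (fun i => profile (INR (S i) * eta)))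
    (zipf_series (Rpower eta (- al))).
Proof.
  intros He; eapply is_lim_seq_ext; [|apply zipf_series_partial].
  intros k; apply sumR_ext; intros i; unfold profile, zipf; f_equal.
  rewrite Rpower_mult_distr; [f_equal; ring|auto|apply INR_S_gt0].
Qed.

(** The errors are the first term of the sum and the integral over (0, eta]; the right tail
    disappears as the number of cells grows. *)
Lemma zipf_series_mesh I eta : 0 < eta ->
  (forall a b, 0 < a <= b -> Rabs (RInt profile a b - I) <= left_tail a + right_tail b) ->
  Rabs (eta * zipf_series (Rpower eta (- al)) - I) <= eta * profile eta + left_tail eta.
Proof.
  intros He HI.
  assert (Hs : is_lim_seq (fun k => eta * sumR (seq 0 (S k)) (fun i => profile (INR (S i) * eta)))
    (eta * zipf_series (Rpower eta (- al)))).
  { apply (is_lim_seq_incr_1 (fun k => eta * sumR (seq 0 k) _)).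
    apply (is_lim_seq_scal_l _ eta (Finite _)), zipf_series_profile, He. }
  assert (Ht : is_lim_seq (fun k => right_tail (INR (S k) * eta)) 0).
  { eapply is_lim_seq_ext.
    2:{ replace (Finite 0) with (Rbar_mult (Rpower eta (- (4 * al - 1))) 0)
          by (simpl; f_equal; ring).
        apply is_lim_seq_scal_l, is_lim_seq_right_tail. }
    intros k; unfold right_tail; rewrite <- Rpower_mult_distr; [ring|apply INR_S_gt0|auto]. }
  assert (Hrng : forall k, 0 < eta <= INR (S k) * eta).
  { intros k; split; [auto|]; assert (1 <= INR (S k)) by (rewrite S_INR; generalize (pos_INR k); lra).
    nra. }
  assert (Hp := Rmult_le_pos _ _ (Rlt_le _ _ He) (profile_ge0 eta)).
  apply Rabs_le; split.
  - assert (I - left_tail eta <= eta * zipf_series (Rpower eta (- al))); [|lra].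
    apply (is_lim_seq_le (fun k => I - left_tail eta - right_tail (INR (S (S k)) * eta))
      (fun k => eta * sumR (seq 0 (S k)) (fun i => profile (INR (S i) * eta)))
      (I - left_tail eta) (eta * zipf_series (Rpower eta (- al)))); [|  |exact Hs].
    + intros k; assert (H := HI _ _ (Hrng (S k))); apply Rabs_le_between in H.
      generalize (profile_riemann_sum eta k He); lra.
    + replace (Finite (I - left_tail eta)) with (Finite (I - left_tail eta - 0)) by (f_equal; ring).
      apply is_lim_seq_minus'; [apply is_lim_seq_const|].
      apply (is_lim_seq_incr_1 (fun k => right_tail (INR (S k) * eta))), Ht.
  - assert (eta * zipf_series (Rpower eta (- al)) <= eta * profile eta + (I + left_tail eta));
      [|lra].
    apply (is_lim_seq_le (fun k => eta * sumR (seq 0 (S k)) (fun i => profile (INR (S i) * eta)))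
      (fun k => eta * profile eta + (I + left_tail eta) + right_tail (INR (S k) * eta))
      (eta * zipf_series (Rpower eta (- al))) (eta * profile eta + (I + left_tail eta)));
      [|exact Hs|].
    + intros k; assert (H := HI _ _ (Hrng k)); apply Rabs_le_between in H.
      generalize (profile_riemann_sum eta k He); lra.
    + replace (Finite (eta * profile eta + (I + left_tail eta)))
        with (Finite (eta * profile eta + (I + left_tail eta) + 0)) by (f_equal; ring).
      apply is_lim_seq_plus'; [apply is_lim_seq_const|exact Ht].
Qed.

(** The mesh is eta = z^(-1/al) = z^(1-tau), which is where the growth exponent 1 + delta = tau - 1
    comes from; the error is of order eta^(1 - 2 al). *)
Lemma zipf_series_growth I :
  (forall a b, 0 < a <= b -> Rabs (RInt profile a b - I) <= left_tail a + right_tail b) ->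
  forall eps, 0 < eps -> exists M, 0 < M /\ forall z, M < z ->
    Rabs (Rpower z (- / al) * zipf_series z - I) < eps.
Proof.
  intros HI eps He.
  (* Collects 1/2 from the first term, as eta profile(eta) <= eta^(1 - 2 al)/2, and the constant of
     [left_tail]. *)
  set (k := / 2 + / 2 / (1 - 2 * al)).
  assert (Hk : 0 < k).
  { unfold k; assert (0 < / 2 / (1 - 2 * al)) by (apply Rdiv_lt_0_compat; lra); lra. }
  set (p := / al * (1 - 2 * al)).
  assert (Hp : 0 < p) by (apply Rmult_lt_0_compat; [apply Rinv_0_lt_compat|]; lra).
  assert (Hek : 0 < eps / k) by now apply Rdiv_lt_0_compat.
  exists (Rpower (eps / k) (- / p)); split; [apply Rpower_gt0|].
  intros z Hz; assert (Hz0 : 0 < z) by (eapply Rlt_trans; [apply Rpower_gt0|exact Hz]).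
  set (eta := Rpower z (- / al)).
  assert (He0 : 0 < eta) by apply Rpower_gt0.
  assert (Hze : Rpower eta (- al) = z).
  { unfold eta; rewrite Rpower_mult; replace (- / al * - al) with 1 by (field; lra).
    now apply Rpower_1. }
  assert (H := zipf_series_mesh I eta He0 HI); rewrite Hze in H.
  eapply Rle_lt_trans; [exact H|].
  apply Rle_lt_trans with (k * Rpower eta (1 - 2 * al)).
  - assert (E : eta * profile eta <= / 2 * Rpower eta (1 - 2 * al)).
    { eapply Rle_trans; [apply Rmult_le_compat_l; [lra|apply profile_le_quadratic]|].
      right; replace (Rpower eta (1 - 2 * al)) with (Rpower eta (1 - 2 * al - 1 + 1))
        by (f_equal; ring).
      rewrite Rpower_plus, Rpower_1 by auto; ring. }
    unfold k, left_tail; lra.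
  - unfold eta; rewrite Rpower_mult.
    replace (- / al * (1 - 2 * al)) with (- p) by (unfold p; ring).
    apply Rlt_le_trans with (k * (eps / k)); [|right; field; lra].
    apply Rmult_lt_compat_l; [auto|now apply Rpower_neg_small].
Qed.

(** * The power-law weight sequence in the scaling regime *)

Context {w : nat -> nat -> R} {cw : R} (Hcw : 0 < cw).
Context (Hwdef : forall N i, (i < N)%nat -> w N i = cw * Rpower (INR N / INR (S i)) al).

Lemma power_law_zipf N i : (i < N)%nat -> w N i = cw * Rpower (INR N) al * zipf al i.
Proof.
  intros Hi; rewrite Hwdef by auto; unfold zipf, Rdiv.
  rewrite <- Rpower_mult_distr; [|apply lt_0_INR; lia|apply Rinv_0_lt_compat, INR_S_gt0].
  rewrite Rmult_assoc; do 2 f_equal; unfold Rpower.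
  rewrite ln_Rinv by apply INR_S_gt0; f_equal; ring.
Qed.

Lemma power_law_mean : is_lim_seq (fun N => EWN w N 1) (cw / (1 - al)).
Proof.
  eapply is_lim_seq_ext_loc.
  2:{ apply (is_lim_seq_scal_l (fun N => Rpower (INR N) (al - 1) * sumR (seq 0 N) (zipf al))
        cw (Finite (/ (1 - al)))), zipf_mean_limit; lra. }
  exists 1%nat; intros N HN; assert (HI : 0 < INR N) by (apply lt_0_INR; lia).
  unfold EWN; rewrite (sumR_seq_ext N (fun i => w N i ^ 1) (fun i => cw * Rpower (INR N) al * zipf al i))
    by (intros; rewrite power_law_zipf by auto; ring).
  rewrite sumR_scal; unfold Rminus.
  rewrite Rpower_plus, Rpower_Ropp, Rpower_1 by auto; ring.
Qed.

(** N^al from the weights and K = N^(1 - al) multiply to N, which cancels against ell = N E[W_N]: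
    b_i = c_N (i+1)^(-al) with c_N = cw / E[W_N] tending to 1 - al. This is the factor
    (tau-2)/(tau-1) in [f]. *)
Lemma power_law_regime :
  let K := fun N => Rpower (INR N) (1 - al) in
  exists B, regime (fun N i => w N i * (K N / ellN w N)) K
    (fun x => zipf_series ((1 - al) * x)) B.
Proof.
  intros K; set (b := fun N i => w N i * (K N / ellN w N)).
  assert (Hw : forall N i, (i < N)%nat -> 0 < w N i).
  { intros N i Hi; rewrite Hwdef by auto; apply Rmult_lt_0_compat; [auto|apply Rpower_gt0]. }
  set (c := 1 - al); assert (Hc : 0 < c) by (unfold c; lra).
  set (cN := fun N => cw / EWN w N 1).
  assert (HcN : is_lim_seq cN c).
  { replace c with (cw / (cw / (1 - al))) by (unfold c; field; lra).
    apply is_lim_seq_div'; [apply is_lim_seq_const|apply power_law_mean|].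
    apply Rgt_not_eq, Rdiv_lt_0_compat; lra. }
  assert (Hb : forall N i, (i < N)%nat -> b N i = cN N * zipf al i).
  { intros N i Hi; assert (HI : 0 < INR N) by (apply lt_0_INR; lia).
    assert (HE := EWN_gt0 Hw N 1 ltac:(lia)).
    unfold b, cN, K; rewrite power_law_zipf, ellN_EWN by (auto; lia).
    assert (E : Rpower (INR N) al * Rpower (INR N) (1 - al) = INR N).
    { rewrite <- Rpower_plus; replace (al + (1 - al)) with 1 by ring; now apply Rpower_1. }
    transitivity (cw * zipf al i * (Rpower (INR N) al * Rpower (INR N) (1 - al))
      / (INR N * EWN w N 1)); [field; lra|rewrite E; field; lra]. }
  set (S4 := 1 + / (4 * al - 1)).
  assert (HS4 : 1 <= S4) by (unfold S4; assert (0 < / (4 * al - 1))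
    by (apply Rinv_0_lt_compat; lra); lra).
  assert (HcNb : eventually (fun N => (0 < N)%nat /\ 0 < cN N <= c + 1)).
  { destruct (proj1 (is_lim_seq_eps _ _) HcN 1 ltac:(lra)) as [N0 HN0].
    exists (S N0); intros N HN; specialize (HN0 N ltac:(lia)); apply Rabs_def2 in HN0.
    split; [lia|split; [|lra]]; apply Rdiv_lt_0_compat; auto; apply (EWN_gt0 Hw); lia. }
  exists ((c + 1) ^ 4 * S4); fold b; split.
  - intros; apply Rpower_gt0.
  - intros N i Hi; apply Rmult_lt_0_compat; [auto|].
    apply Rdiv_lt_0_compat; [apply Rpower_gt0|apply (ellN_gt0 Hw); lia].
  - intros N HN; now apply (scaled_sum Hw).
  - apply Rmult_le_pos; [apply pow_le|]; lra.
  - destruct HcNb as [N0 HN0]; exists N0; intros N HN; destruct (HN0 N HN) as [HN1 HcN1].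
    rewrite (sumR_seq_ext N _ (fun i => cN N ^ 4 * zipf (4 * al) i))
      by (intros i Hi; change ((fun i => w N i * (K N / ellN w N)) i) with (b N i);
          rewrite Hb, Rpow_mult_distr, zipf_pow4 by auto; ring).
    rewrite sumR_scal; apply Rmult_le_compat.
    + apply pow_le; lra.
    + apply sumR_ge0_in; intros; left; apply zipf_gt0.
    + apply pow_incr; lra.
    + apply zipf_sum_bounded; lra.
  - apply scale_limit; lra.
  - intros y; change (is_lim_seq (fun N => fN N (b N) y) (zipf_series (c * y))).
    (* Partial sums of the series, plus the effect of replacing c_N by its limit; the latter is
       Lipschitz in c_N, with a constant summable over the vertices. *)
    apply (is_lim_seq_ext (fun N => sumR (seq 0 N) (fun i => h (c * y * zipf al i)) +
      (fN N (b N) y - sumR (seq 0 N) (fun i => h (c * y * zipf al i))))); [intros; ring|].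
    replace (Finite (zipf_series (c * y))) with (Finite (zipf_series (c * y) + 0))
      by (f_equal; ring).
    apply is_lim_seq_plus'; [apply zipf_series_partial|].
    set (M := (c + 1) * Rabs y).
    apply (is_lim_seq_squeeze0 _ (fun N => M ^ 3 * Rabs y * S4 * Rabs (cN N - c))).
    2:{ replace (Finite 0) with (Rbar_mult (M ^ 3 * Rabs y * S4) (Finite (Rabs (c - c))))
          by (simpl; f_equal; rewrite Rminus_diag, Rabs_R0; ring).
        apply is_lim_seq_scal_l, (is_lim_seq_abs _ (Finite (c - c))), is_lim_seq_minus';
          [exact HcN|apply is_lim_seq_const]. }
    destruct HcNb as [N0 HN0]; exists N0; intros N HN; destruct (HN0 N HN) as [HN1 HcN1].
    unfold fN; rewrite <- sumR_minus; eapply Rle_trans; [apply sumR_abs|].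
    assert (HM : 0 <= M) by (apply Rmult_le_pos; [lra|apply Rabs_pos]).
    apply Rle_trans with (sumR (seq 0 N)
      (fun i => M ^ 3 * Rabs y * Rabs (cN N - c) * zipf (4 * al) i)).
    + apply sumR_seq_le; intros i Hi; rewrite Hb by auto.
      assert (Hz := zipf_gt0 al i).
      apply Rle_trans with ((M * zipf al i) ^ 3 *
        Rabs (cN N * zipf al i * y - c * y * zipf al i)).
      * apply h_lipschitz; unfold M; rewrite !Rabs_mult, (Rabs_pos_eq (zipf al i)) by lra.
        -- rewrite (Rabs_pos_eq (cN N)) by lra.
           replace (cN N * zipf al i * Rabs y) with (cN N * (Rabs y * zipf al i)) by ring.
           rewrite Rmult_assoc; apply Rmult_le_compat_r; [|lra].
           apply Rmult_le_pos; [apply Rabs_pos|lra].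
        -- rewrite (Rabs_pos_eq c) by lra; apply Rmult_le_compat_r; [lra|].
           apply Rmult_le_compat_r; [apply Rabs_pos|lra].
      * replace (cN N * zipf al i * y - c * y * zipf al i) with ((cN N - c) * (y * zipf al i))
          by ring.
        rewrite !Rabs_mult, (Rabs_pos_eq (zipf al i)), <- zipf_pow4 by lra; right; ring.
    + rewrite sumR_scal, (Rmult_assoc (M ^ 3 * Rabs y) S4), (Rmult_comm S4), <- Rmult_assoc.
      apply Rmult_le_compat_l; [|apply zipf_sum_bounded; lra].
      repeat apply Rmult_le_pos; auto using Rabs_pos; lra.
  (* The first vertex alone makes f(1) positive. *)
  - apply Rlt_le_trans with (h (c * 1 * zipf al 0)).
    + apply h_gt0; rewrite Rmult_1_r; apply Rmult_lt_0_compat; [auto|apply zipf_gt0].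
    + apply (is_lim_seq_lb _ _ _ (zipf_series_partial (c * 1))); exists 1%nat; intros N HN.
      destruct N as [|N]; [lia|]; rewrite sumR_seq_first.
      assert (0 <= sumR (seq 0 N) (fun i => h (c * 1 * zipf al (S i))))
        by (apply sumR_ge0_in; intros; apply h_ge0); lra.
Qed.
End PowerLaw.

Lemma power_law_case w FW m1 m2 cw tau :
  (forall N i, (i < N)%nat -> 0 < w N i) -> WeightRegularity w FW m1 m2 ->
  0 < cw -> 3 < tau < 5 ->
  (forall N i, (i < N)%nat -> w N i = cw * Rpower (INR N / INR (S i)) (/ (tau - 1))) ->
  exists f : R -> R,
    (forall x, infinite_sum
       (fun n => h ((tau - 2) / (tau - 1) * x * Rpower (INR (S n)) (- / (tau - 1)))) (f x)) /\
    exists I, ImpIntOpen0Inf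
       (fun y => / 2 * Rpower y (- (2 / (tau - 1)))
                 - ln (cosh (Rpower y (- / (tau - 1))))) I /\
    0 < Rpower ((tau - 2) / (tau - 1)) (tau - 1) * I /\
    Conclusion w (tau - 2) f (Rpower ((tau - 2) / (tau - 1)) (tau - 1) * I).
Proof.
  intros Hw [_ [_ [_ [_ [H2 _]]]]] Hcw Htau Hwdef; apply is_lim_seq_Reals in H2.
  set (al := / (tau - 1)).
  assert (Hal : / 4 < al < / 2)
    by (unfold al; split; apply Rinv_lt_contravar; lra).
  set (c := 1 - al); assert (Hc0 : 0 < c) by (unfold c; lra).
  assert (Hc : (tau - 2) / (tau - 1) = c) by (unfold c, al; field; lra).
  assert (Hta : tau - 1 = / al) by (unfold al; now rewrite Rinv_inv).
  assert (Hd : (tau - 2) / (tau - 2 + 1) = 1 - al) by (unfold al; field; lra).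
  rewrite Hc.
  exists (fun x => zipf_series (al := al) (c * x)); split.
  { intros x; apply is_series_Reals, (zipf_series_correct Hal). }
  destruct (profile_integral Hal) as [I [HI0 [HI HIb]]]; exists I.
  destruct (power_law_regime Hal Hcw Hwdef) as [B HR].
  destruct (rank_one_convergence Hw (fun N => Rpower (INR N) (1 - al))
    (fun x => zipf_series (al := al) (c * x)) B (1 - al)
    (cw / (1 - al)) m2) as [Hann Hcurie]; auto.
  { apply Rdiv_lt_0_compat; auto. }
  { apply (power_law_mean Hal Hwdef). }
  rewrite <- Hd in Hann, Hcurie.
  split; [|split; [|split; [|split]]].
  - replace (fun y => / 2 * Rpower y (- (2 / (tau - 1))) - ln (cosh (Rpower y (- al))))
      with (profile (al := al)); [exact HI|].
    apply functional_extensionality; intros y; unfold profile, h; rewrite Rpower_pow_nat.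
    do 3 f_equal; unfold al; simpl; field; lra.
  - apply Rmult_lt_0_compat; [apply Rpower_gt0|auto].
  - exact Hann.
  - exact Hcurie.
  - intros eps He; assert (Hp := Rpower_gt0 c (tau - 1)).
    (* [f] is the series at c x, so its growth picks up the factor c^(1/al) = c^(tau-1), the
       prefactor of the integral in the limit constant. *)
    destruct (zipf_series_growth Hal I HIb (eps / Rpower c (tau - 1))) as [M [HM0 HM]].
    { now apply Rdiv_lt_0_compat. }
    exists (M / c); intros x Hx.
    assert (HMc : 0 < M / c) by now apply Rdiv_lt_0_compat.
    assert (Hcx : M < c * x).
    { apply (Rmult_lt_compat_l c) in Hx; [|auto].
      replace (c * (M / c)) with M in Hx by (field; lra); auto. }
    specialize (HM _ Hcx); rewrite <- Hta, <- Rpower_mult_distr, !Rpower_Ropp in HM by lra.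
    replace (1 + (tau - 2)) with (tau - 1) by ring.
    assert (Hpx := Rpower_gt0 x (tau - 1)).
    set (z := zipf_series (c * x)) in *.
    replace (z / Rpower x (tau - 1) - Rpower c (tau - 1) * I) with
      (Rpower c (tau - 1) * (/ Rpower c (tau - 1) * / Rpower x (tau - 1) * z - I))
      by (field; lra).
    rewrite Rabs_mult, (Rabs_pos_eq (Rpower c (tau - 1))) by lra.
    replace eps with (Rpower c (tau - 1) * (eps / Rpower c (tau - 1))) by (field; lra).
    now apply Rmult_lt_compat_l.
Qed.

Theorem mainTheorem3 (w : nat -> nat -> R) (FW : R -> R) (m1 m2 : R)
  (Hpos : forall N i, (i < N)%nat -> 0 < w N i)
  (Hreg : WeightRegularity w FW m1 m2) :
  (* case (i): delta = 3 *)
  (forall m4, MomentW FW 4 m4 -> Un_cv (fun N => EWN w N 4) m4 ->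
     let C := / 12 * m4 / m1 ^ 4 in
     Conclusion w 3 (fun x => C * x ^ 4) C) /\
  (* case (ii): delta = tau - 2 *)
  (forall cw tau, 0 < cw -> 3 < tau < 5 ->
     (forall N i, (i < N)%nat ->
        w N i = cw * Rpower (INR N / INR (S i)) (/ (tau - 1))) ->
     exists f : R -> R,
       (forall x, infinite_sum
          (fun n => let t := (tau - 2) / (tau - 1) * x
                             * Rpower (INR (S n)) (- / (tau - 1)) in
                    / 2 * t ^ 2 - ln (cosh t)) (f x)) /\
       exists I, ImpIntOpen0Inf
          (fun y => / 2 * Rpower y (- (2 / (tau - 1)))
                    - ln (cosh (Rpower y (- / (tau - 1))))) I /\
       let C := Rpower ((tau - 2) / (tau - 1)) (tau - 1) * I in
       0 < C /\ Conclusion w (tau - 2) f C).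
Proof.
  split.
  - intros m4 HM4 H4; now apply (fourth_moment_case w FW m1 m2 m4).
  - intros cw tau Hcw Htau Hwdef.
    exact (power_law_case w FW m1 m2 cw tau Hpos Hreg Hcw Htau Hwdef).
Qed.
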